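(* Let $T'>0$, let $f:[0,T']\to\mathbb{R}$ be continuous with $f(0)>0$, let $(B_t)_{t\ge0}$ be a standard Brownian motion and let $\tau=\inf\{t\in[0,T'):B_t=f(t)\}$. Let $\mu$ be a Schwartz distribution on $\mathbb{R}$ with compact support contained in the interval $(f(0),+\infty)$. Assume that $$\int\exp\left(\frac{2f(t)v-v^2}{2t}\right)d\mu(v)=1\quad\text{for all }t\in(0,T'].$$ Then, for every $T\in(0,T']$, $$P(\tau<T)=N\left(\frac{-f(T)}{\sqrt T}\right)+\int N\left(\frac{f(T)-v}{\sqrt T}\right)d\mu(v).$$ If $f$ is $C^1$ on an open subset $I$ of $[0,T']$, then, for every $T\in I$ with $T>0$, $$\frac{\partial}{\partial T}P(\tau<T)=\frac{1}{2T^{3/2}}\int v\,N'\left(\frac{f(T)-v}{\sqrt T}\right)d\mu(v).$$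
   Context: $N(x)=(2\pi)^{-1/2}\int_{-\infty}^x e^{-s^2/2}\,ds$ is the standard normal distribution function and $N'$ its derivative. $(B_t)$ starts at $B_0=0$. If no $t\in[0,T')$ satisfies $B_t=f(t)$, then $\tau$ is taken to be at least $T'$ (e.g. $+\infty$), so that the event $\tau<T$ fails for every $T\le T'$. For a compactly supported Schwartz distribution $\mu$ on $\mathbb{R}$, $\int\phi(v)\,d\mu(v)$ denotes the pairing of $\mu$ with a function $\phi$ that is $C^\infty$. If $T=T'\in I$, the derivative in $T$ is understood as one-sided. *)

(* Defs.v *)
From HB Require Import structures.
From mathcomp Require Import all_boot all_order all_algebra.
From mathcomp Require Import all_classical all_reals all_analysis.
Set Implicit Arguments.
Unset Strict Implicit.
Unset Printing Implicit Defensive.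
Import Order.TTheory GRing.Theory Num.Theory.
Import numFieldNormedType.Exports.
Local Open Scope classical_set_scope.
Local Open Scope ring_scope.

Definition normal_cdf {R : realType} (x : R) : R :=
  (Num.sqrt (2 * pi))^-1 *
  (\int[lebesgue_measure]_(s in `]-oo, x]) expR (- (s ^+ 2) / 2))%R.

Definition indep_RVs {d} {Omega : measurableType d} {R : realType}
    (P : probability Omega R) (n : nat) (X : 'I_n -> Omega -> R) : Prop :=
  forall A : 'I_n -> set R, (forall i, measurable (A i)) ->
    P (\bigcap_i (X i @^-1` A i)) = (\prod_(i < n) P (X i @^-1` A i))%E.

(* The time set is [0, +oo[; nothing is required of B t for t < 0. *)
Record standard_brownian_motion {d} {Omega : measurableType d} {R : realType}
    (P : probability Omega R) (B : R -> {RV P >-> R}) : Prop := {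
  bm_start : forall w, B 0 w = 0 ;
  bm_continuous : forall w, {within `[0, +oo[, continuous (fun t => B t w)} ;
  bm_gaussian : forall s t : R, 0 <= s -> s < t ->
    forall A : set R, measurable A ->
      pushforward P (B t \- B s) A = normal_prob 0 (Num.sqrt (t - s)) A ;
  bm_indep : forall (n : nat) (t : nat -> R), 0 <= t 0%N ->
    (forall i, t i <= t i.+1) ->
    indep_RVs P (fun i : 'I_n => B (t i.+1) \- B (t i)) }.

(* ereal_inf set0 = +oo: no hit before T' gives an infinite hitting time. *)
Definition hitting_time {d} {Omega : measurableType d} {R : realType}
    (P : probability Omega R) (B : R -> {RV P >-> R}) (f : R -> R) (T' : R)
    (w : Omega) : \bar R :=
  ereal_inf [set t%:E | t in [set t | 0 <= t < T' /\ B t w = f t]].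

Definition smooth {R : realType} (phi : R -> R) : Prop :=
  forall (n : nat) (x : R), derivable (derive1n n phi) x 1.

Definition fun_supp {R : realType} (phi : R -> R) : set R :=
  closure [set x | phi x != 0].

Definition test_function {R : realType} (phi : R -> R) : Prop :=
  smooth phi /\ compact (fun_supp phi).

(* Only the values of a distribution on test functions are meaningful.
   Continuity on the space of test functions is given by the usual
   seminorm estimate on each compact set. *)
Record schwartz_distribution (R : realType) := SchwartzDistribution {
  sd_fun :> (R -> R) -> R ;
  sd_linear : forall (a : R) (phi psi : R -> R),
    test_function phi -> test_function psi ->
    sd_fun (a \*o phi \+ psi) = a * sd_fun phi + sd_fun psi ;
  sd_continuous : forall K : set R, compact K ->
    exists (C : R) (m : nat), forall phi : R -> R,
      test_function phi -> fun_supp phi `<=` K ->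
      `|sd_fun phi| <=
        C * \sum_(k < m.+1) sup (range (fun x => `|derive1n k phi x|)) }.

Definition sd_supp {R : realType} (mu : schwartz_distribution R) : set R :=
  [set x | ~ exists U : set R, [/\ open U, U x &
     forall phi : R -> R, test_function phi -> fun_supp phi `<=` U ->
       mu phi = 0]].

Definition cutoff {R : realType} (K : set R) : set (R -> R) :=
  [set chi | test_function chi /\
     exists U : set R, [/\ open U, K `<=` U & forall x, U x -> chi x = 1]].

(* Pairing of a compactly supported distribution with a smooth function phi:
   mu (chi * phi) for a test function chi equal to 1 near the support of mu;
   the value does not depend on chi. *)
Definition pairing {R : realType} (mu : schwartz_distribution R)
    (phi : R -> R) : R :=
  mu (get (cutoff (sd_supp mu)) \* phi).

(* Derivative along D, hence one-sided at an end point of an interval D. *)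
Definition is_derive_within {R : realType} (D : set R) (g : R -> R)
    (x l : R) : Prop :=
  (g y - g x) / (y - x) @[y --> within D (dnbhs x)] --> l.

(* I is meant to be relatively open in D. *)
Definition C1_on {R : realType} (D I : set R) (g : R -> R) : Prop :=
  exists g' : R -> R, {within I, continuous g'} /\
    forall x, I x -> is_derive_within D g x (g' x).

(* Main.v *)
Require Import Defs.
From HB Require Import structures.
From mathcomp Require Import all_boot all_order all_algebra.
From mathcomp Require Import all_classical all_reals all_analysis.
From mathcomp Require Import measurable_realfun ring lra.
Set Implicit Arguments.
Unset Strict Implicit.
Unset Printing Implicit Defensive.
Import Order.TTheory GRing.Theory Num.Theory.
Import numFieldNormedType.Exports.
Local Open Scope classical_set_scope.
Local Open Scope ring_scope.
Local Notation "f ^` ()" := (derive1 f) : ring_scope.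

(** Write kern t x v for exp ((2 x v - v^2) / (2 t)) and u (t, x) for the
pairing of mu with kern t x ([heat] below). The hypothesis on mu says that
u (t, f t) = 1 for 0 < t <= T'.

Two facts carry the proof of the first formula. The first is a translation
principle: for r > 0, the weight kern r (B_r) v is the likelihood ratio of the
normal laws of mean v and mean 0 and variance r, and the increments of B after
time r are independent of B_r. Hence, for an event E that depends on the path
from time r on, the expectation of kern r (B_r) v on E is the probability
that the path translated by v is in E ([markov_shift], [cell_shift]). The
second is that pairing with mu and taking expectations commute
([pairing_integral], [cell_pairing]): after the factor exp (- v^2 / (2 t)) is
split off, both are computed term by term on a power series in v. Together
they say that the expectation of u (r, B_r) on E is the pairing of mu with the
probability that v + B is in E.

This is applied on a grid s = r_0 < ... < r_N = T. On the event B_T < f T, let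
r_k be the last grid time at which B is at least f - e. Summing the identity
over k, the right-hand sides telescope to the pairing of mu with the
probability that B_T + v < f T, which is N ((f T - v) / sqrt T). On the left,
B_{r_k} is within e of f r_k, where u is close to 1, unless the path moves by
more than e with respect to f between two grid points; so the sum is close to
the probability that B_T < f T and that B reaches f - e on the grid
([grid_estimate]). What is left over is the expectation of u (s, B_s) below the
boundary. It is at most of order s, because the support of mu lies to the right
of f 0 and u (s, x) decays there ([heat_decay]). Letting N tend to infinity, e
to 0 and s to 0, the pairing is the probability that B hits f before T and
B_T < f T ([touch_prob]). By the intermediate value theorem a path with
B_T > f T has hit f, and the probability of that event is N (- f T / sqrt T);
this gives the first formula ([hit_before_prob]).

For the second formula, N ((f S - v) / sqrt S) is N composed with an affine
function of v whose coefficients are differentiable in S, and the pairing may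
be differentiated along such a path ([pairing_path]). Since
N' ((f T - v) / sqrt T) = N' (f T / sqrt T) kern T (f T) v and u (T, f T) = 1,
the terms that contain the derivative of f / sqrt cancel those of
N (- f / sqrt), and only the derivative of - 1 / sqrt remains
([pairing_cdf_derivative]).

Estimates on pairings all come from one bound: a distribution with compact
support is controlled by finitely many derivatives on any interval around its
support ([pairing_bound]). *)

(** * Smooth functions *)

Section SmoothCalculus.
Context {R : realType}.
Implicit Types (f g phi psi : R -> R) (x l : R).

(** Recursive form of n-fold differentiability. It hands over the derivative of a
function as the next function to study, which is the shape that induction on
products and compositions needs. *)
Fixpoint nderivable (n : nat) f : Prop :=
  if n is n'.+1 then (forall x, derivable f x 1) /\ nderivable n' f^`() else True.

Lemma nderivableS n f : nderivable n.+1 f -> nderivable n f.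
Proof. by elim: n f => // n IH f [df /IH]; split. Qed.

Lemma smoothP f : smooth f <-> forall n, nderivable n f.
Proof.
split=> [sf n|Df n x].
  elim: n f sf => // n IH f sf; split; first exact: (sf 0%N).
  by apply: IH => k x; rewrite -derive1Sn; exact: sf.
elim: n f Df => [|n IH] f Df; first by have [] := Df 1%N.
by rewrite derive1Sn; apply: IH => k; have [] := Df k.+1.
Qed.

Lemma smooth_derivable f x : smooth f -> derivable f x 1.
Proof. by move/(_ 0%N x). Qed.

Lemma smooth_derive1 f : smooth f -> smooth f^`().
Proof. by move=> sf n x; rewrite -derive1Sn; exact: sf. Qed.

Lemma smooth_continuous f : smooth f -> continuous f.
Proof.
by move=> sf x; apply/differentiable_continuous/derivable1_diffP/smooth_derivable.
Qed.

Lemma derive1_val f x l : is_derive x 1 f l -> f^`() x = l.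
Proof. by move=> h; rewrite derive1E derive_val. Qed.

Lemma is_derive1 f x : derivable f x 1 -> is_derive x 1 f (f^`() x).
Proof. by move=> /derivableP; rewrite derive1E. Qed.

Lemma derive1_mul f g : (forall x, derivable f x 1) ->
  (forall x, derivable g x 1) ->
  (f \* g)^`() = (f^`() \* g) \+ (f \* g^`()).
Proof.
move=> df dg; apply/funext => x /=; apply: derive1_val.
have := is_deriveM (is_derive1 (df x)) (is_derive1 (dg x)).
move=> h; apply: is_derive_eq; rewrite /GRing.scale /=; ring.
Qed.

Lemma derive1_add f g : (forall x, derivable f x 1) ->
  (forall x, derivable g x 1) -> (f \+ g)^`() = f^`() \+ g^`().
Proof.
move=> df dg; apply/funext => x /=; apply: derive1_val.
exact: is_deriveD (is_derive1 (df x)) (is_derive1 (dg x)).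
Qed.

Lemma derive1_compE f g : (forall x, derivable f x 1) ->
  (forall x, derivable g x 1) -> (g \o f)^`() = (g^`() \o f) \* f^`().
Proof. by move=> df dg; apply/funext => x /=; rewrite derive1_comp. Qed.

Lemma nderivable_cst n (a : R) : nderivable n (cst a).
Proof.
elim: n a => // n IH a; split; first by move=> x; exact: derivable_cst.
by rewrite (_ : (cst a)^`() = cst 0) //; apply/funext => x; rewrite derive1_cst.
Qed.

Lemma nderivable_add n f g : nderivable n f -> nderivable n g -> nderivable n (f \+ g).
Proof.
elim: n f g => // n IH f g [df Df] [dg Dg]; split.
  by move=> x; exact: derivableD.
by rewrite derive1_add //; exact: IH.
Qed.

Lemma nderivable_mul n f g : nderivable n f -> nderivable n g -> nderivable n (f \* g).
Proof.
elim: n f g => // n IH f g /[dup] Sf [df Df] /[dup] Sg [dg Dg]; split.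
  by move=> x; exact: derivableM.
by rewrite derive1_mul //; apply: nderivable_add; apply: IH => //; exact: nderivableS.
Qed.

Lemma derivable_compr f g x : derivable f x 1 -> derivable g (f x) 1 ->
  derivable (g \o f) x 1.
Proof.
by move=> /derivable1_diffP df /derivable1_diffP dg; apply/derivable1_diffP;
  exact: differentiable_comp.
Qed.

Lemma nderivable_comp n f g : nderivable n f -> nderivable n g -> nderivable n (g \o f).
Proof.
elim: n f g => // n IH f g /[dup] Sf [df Df] [dg Dg]; split.
  by move=> x; exact: derivable_compr.
by rewrite derive1_compE //; apply: nderivable_mul => //; apply: IH => //; exact: nderivableS.
Qed.

Lemma smooth_cst (a : R) : smooth (cst a).
Proof. by apply/smoothP => n; exact: nderivable_cst. Qed.

Arguments smooth_cst : clear implicits.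

Lemma smooth_add f g : smooth f -> smooth g -> smooth (f \+ g).
Proof.
by move=> /smoothP Df /smoothP Dg; apply/smoothP => n; exact: nderivable_add.
Qed.

Lemma smooth_mul f g : smooth f -> smooth g -> smooth (f \* g).
Proof.
by move=> /smoothP Df /smoothP Dg; apply/smoothP => n; exact: nderivable_mul.
Qed.

Lemma smooth_comp f g : smooth f -> smooth g -> smooth (g \o f).
Proof.
by move=> /smoothP Df /smoothP Dg; apply/smoothP => n; exact: nderivable_comp.
Qed.

Lemma smooth_scale (a : R) f : smooth f -> smooth (a \*o f).
Proof. by move=> sf; exact: (smooth_mul (smooth_cst a) sf). Qed.

Lemma smooth_is_derive f g : (forall x, is_derive x 1 f (g x)) -> smooth g ->
  smooth f.
Proof.
move=> fg /smoothP sg; apply/smoothP => -[//|n]; split => [x|].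
  by have [] := fg x.
by rewrite (_ : f^`() = g) //; apply/funext => x; exact: derive1_val.
Qed.

Lemma smooth_affine (a b : R) : smooth (fun x => a * x + b).
Proof.
apply: (@smooth_is_derive _ (cst a)); last exact: smooth_cst.
move=> x; rewrite (_ : (fun _ => _) = (a \*: id) \+ cst b) //.
by apply: is_derive_eq; rewrite /GRing.scale /=; ring.
Qed.

Lemma smooth_expR : smooth (@expR R).
Proof.
apply/smoothP; elim=> // n IH; split; first by move=> x; exact: derivable_expR.
rewrite (_ : expR^`() = expR) //.
by apply/funext => x; apply: derive1_val; exact: is_derive_expR.
Qed.

Lemma smooth_inv f : smooth f -> (forall x, f x != 0) ->
  smooth (fun x => (f x)^-1).
Proof.
move=> sf f0; apply/smoothP; elim=> // n IH.
have dV x : is_derive x 1 (fun x => (f x)^-1)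
    (-1 * (f^`() x * ((f x)^-1 * (f x)^-1))).
  have dfx : derivable f x 1 by exact: smooth_derivable.
  split; first exact: derivableV.
  rewrite deriveV // -derive1E /GRing.scale /= expr2 invfM; ring.
split; first by move=> x; have [] := dV x.
rewrite (_ : (fun _ => _)^`() = (cst (-1)) \* (f^`() \*
  ((fun x => (f x)^-1) \* (fun x => (f x)^-1)))); last first.
  by apply/funext => x; exact: derive1_val.
apply: nderivable_mul; first exact: nderivable_cst.
have /smoothP Df' := smooth_derive1 sf.
by apply: nderivable_mul => //; exact: nderivable_mul.
Qed.

End SmoothCalculus.

(** * A smooth step *)

Section Cutoffs.
Context {R : realType}.
Implicit Types (x a b : R).

(** exp (- 1 / x) on the right half-line with a power of 1 / x in front, so that
the family is closed under differentiation. *)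
Definition flat (k : nat) x : R :=
  if 0 < x then x^-1 ^+ k * expR (- x^-1) else 0.

Lemma flat_ge0 k x : 0 <= flat k x.
Proof.
rewrite /flat; case: ifP => // x0.
by rewrite mulr_ge0 ?expR_ge0 // exprn_ge0 // invr_ge0 ltW.
Qed.

Lemma flat_le k x : flat k.+1 x <= k.+1`!%:R.
Proof.
rewrite /flat; case: ifP => [x0|_]; last by rewrite ler0n.
rewrite expRN ler_pdivrMr ?expR_gt0 //.
have xi0 : 0 <= x^-1 by rewrite invr_ge0 ltW.
have f0 : 0 < k.+1`!%:R :> R by rewrite ltr0n fact_gt0.
rewrite mulrC -ler_pdivrMr //.
by apply: le_trans (expR_ge1Dxn k xi0); rewrite lerDr.
Qed.

Lemma flatS k x : flat k x = x * flat k.+1 x.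
Proof.
rewrite /flat; case: ifP => x0; last by rewrite mulr0.
by rewrite exprS !mulrA divff ?mul1r // gt_eqF.
Qed.

Lemma is_derive_quotient (f : R -> R) x l :
  h^-1 * (f (h + x) - f x) @[h --> 0^'] --> l -> is_derive x 1 f l.
Proof.
move=> h.
have H : h^-1 *: ((f \o shift x) h%:A - f x) @[h --> 0^'] --> l.
  apply: cvg_trans h; apply: near_eq_cvg; near=> h.
  by rewrite /= /GRing.scale /= mulr1.
by split; [apply/cvg_ex; exists l|exact: (cvg_lim (@Rhausdorff R) H)].
Unshelve. all: by end_near. Qed.

(** At 0, the difference quotient is h times a member of the family, by using
[flatS] twice, and the family is bounded by [flat_le]. *)
Lemma is_derive_flat k x :
  is_derive x 1 (flat k) (- k%:R * flat k.+1 x + flat k.+2 x).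
Proof.
have [x0|x0|<-] := ltgtP 0 x.
- rewrite {2 3}/flat x0.
  pose g y : R := y^-1 ^+ k * expR (- y^-1).
  apply: (@near_eq_is_derive _ _ _ g).
    near=> y; rewrite /flat ifT //; near: y; exact: lt_nbhsr.
  have dV : is_derive x 1 (fun y : R => y^-1) (- x ^- 2).
    have := is_deriveV (lt0r_neq0 x0) (is_derive_id x 1).
    by rewrite /GRing.scale /= mulr1.
  have dE : is_derive x 1 (fun y : R => expR (- y^-1))
      (expR (- x^-1) * - - x ^- 2).
    exact: (@is_derive1_comp R expR (fun y : R => - y^-1) x).
  have dX := is_deriveX k dV.
  have := is_deriveM dX dE.
  have -> : GRing.mul (@GRing.inv R ^+ k) (fun y : R => expR (- y^-1)) = g.
    by apply/funext => y; rewrite !fctE.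
  move=> d; apply: (is_derive_eq d).
  rewrite fctE.
  rewrite /GRing.scale /=; case: k {g dX d} => [|k] /=.
    rewrite !expr0 mulr0n /=; field; exact: lt0r_neq0.
  rewrite -mulr_natl !exprS !exprVn; field; rewrite expf_neq0 //; exact: lt0r_neq0.
- have fl j y : y < 0 -> flat j y = 0 by move=> y0; rewrite /flat ltNge (ltW y0).
  rewrite !fl // mulr0 addr0.
  apply: (@near_eq_is_derive _ _ _ (cst 0)).
    by near=> y; rewrite fl //; near: y; exact: lt_nbhsl.
- rewrite /flat ltxx mulr0 addr0; apply: is_derive_quotient.
  apply/cvgrPdist_le => e e0; near=> h.
  have C0 : 0 < k.+2`!%:R :> R by rewrite ltr0n fact_gt0.
  rewrite sub0r normrN ltxx subr0 addr0 -/(flat k h).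
  have h0 : h != 0 by near: h; exact: nbhs_dnbhs_neq.
  rewrite flatS mulrA mulVf // mul1r flatS normrM (ger0_norm (flat_ge0 _ _)).
  apply: (@le_trans _ _ (`|h| * k.+2`!%:R)).
    by rewrite ler_wpM2l // flat_le.
  rewrite -ler_pdivlMr //; near: h; apply: dnbhs0_le; exact: divr_gt0.
Unshelve. all: by end_near. Qed.

Lemma smooth_flat k : smooth (flat k).
Proof.
apply/smoothP => n; elim: n k => // n IH k; split.
  by move=> x; have [] := is_derive_flat k x.
rewrite (_ : (flat k)^`() = (- k%:R \*o flat k.+1) \+ flat k.+2); last first.
  by apply/funext => x; exact: derive1_val (is_derive_flat k x).
apply: nderivable_add => //; apply: (@nderivable_mul _ n (cst (- k%:R)) (flat k.+1)) => //.
exact: nderivable_cst.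
Qed.

Lemma flat_gt0 x : 0 < x -> 0 < flat 0 x.
Proof. by move=> x0; rewrite /flat x0 mul1r expR_gt0. Qed.

Lemma flat_eq0 x : x <= 0 -> flat 0 x = 0.
Proof. by move=> x0; rewrite /flat ltNge x0. Qed.

Definition sstep x : R := flat 0 x / (flat 0 x + flat 0 (- 1 * x + 1)).

Lemma sstep_den x : 0 < flat 0 x + flat 0 (- 1 * x + 1).
Proof.
have [x0|x0] := ltP 0 x.
  by rewrite ltr_pwDl ?flat_gt0 ?flat_ge0.
by rewrite ltr_wpDl ?flat_ge0 // flat_gt0 //; lra.
Qed.

Lemma smooth_sstep : smooth sstep.
Proof.
apply: (@smooth_mul _ (flat 0) (fun x => (flat 0 x + flat 0 (- 1 * x + 1))^-1)).
  exact: smooth_flat.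
apply: smooth_inv; last by move=> x; rewrite gt_eqF // sstep_den.
apply: (@smooth_add _ (flat 0) (flat 0 \o (fun x => - 1 * x + 1))).
  exact: smooth_flat.
by apply: smooth_comp; [exact: smooth_affine|exact: smooth_flat].
Qed.

Lemma sstep0 x : x <= 0 -> sstep x = 0.
Proof. by move=> x0; rewrite /sstep flat_eq0 // mul0r. Qed.

Lemma sstep1 x : 1 <= x -> sstep x = 1.
Proof.
move=> x1; rewrite /sstep (@flat_eq0 (- 1 * x + 1)); last lra.
by rewrite addr0 divff // gt_eqF // flat_gt0 //; lra.
Qed.

End Cutoffs.

(** * Test functions and supports *)

Section TestFunctions.
Context {R : realType}.
Implicit Types (f g phi psi chi : R -> R) (x a b : R) (mu : schwartz_distribution R).

Lemma near_supp f x : ~ fun_supp f x -> \forall y \near x, f y = 0.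
Proof.
move=> nfx; have : nbhs x (~` fun_supp f).
  by apply: open_nbhs_nbhs; split => //; apply: closed_openC; exact: closed_closure.
apply: filterS => y nfy; apply: contrapT => fy0; apply: nfy.
by apply: subset_closure => /=; apply/eqP.
Qed.

Lemma near0_derive1n f x k : (\forall y \near x, f y = 0) ->
  \forall y \near x, derive1n k f y = 0.
Proof.
elim: k f => // k IH f fx; rewrite derive1Sn; apply: IH.
move/nbhs_interior : fx; apply: filterS => y fy.
apply: derive1_val; apply: (@near_eq_is_derive _ _ _ (cst 0)) => //.
by apply: filterS fy => z ->.
Qed.

Lemma derive1n_supp f x k : ~ fun_supp f x -> derive1n k f x = 0.
Proof. by move=> /near_supp /near0_derive1n h; exact: nbhs_singleton (h k). Qed.

Lemma fun_supp_sub f (A : set R) : closed A -> (forall x, f x != 0 -> A x) ->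
  fun_supp f `<=` A.
Proof. by move=> cA fA; rewrite /fun_supp closureE => x; apply; split. Qed.

Lemma closed_fun_supp f : closed (fun_supp f).
Proof. exact: closed_closure. Qed.

Lemma fun_supp_in f x : f x != 0 -> fun_supp f x.
Proof. by move=> fx; apply: subset_closure. Qed.

Lemma fun_supp_mull f g : fun_supp (f \* g) `<=` fun_supp f.
Proof.
apply: fun_supp_sub; first exact: closed_fun_supp.
by move=> x; rewrite /= mulf_eq0 negb_or => /andP[/fun_supp_in].
Qed.

Lemma test_mull f g : test_function f -> smooth g -> test_function (f \* g).
Proof.
move=> [sf cf] sg; split; first exact: smooth_mul.
by apply: subclosed_compact cf (@fun_supp_mull _ _); exact: closed_fun_supp.
Qed.

Lemma test_lin (c : R) f g : test_function f -> test_function g ->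
  test_function (c \*o f \+ g).
Proof.
move=> [sf cf] [sg cg]; split.
  exact: (smooth_add (@smooth_scale R _ _ sf) sg).
apply: (subclosed_compact _ (compactU cf cg)); first exact: closed_fun_supp.
apply: fun_supp_sub.
  by apply: closedU; exact: closed_fun_supp.
move=> x /= h; have [fx|/eqP fx] := boolP (f x == 0); last first.
  by left; apply: fun_supp_in; apply/eqP.
by right; apply: fun_supp_in; move: h; rewrite (eqP fx) mulr0 add0r.
Qed.

Lemma test0 : @test_function R (cst 0).
Proof.
split; first exact: smooth_cst.
rewrite (_ : fun_supp _ = set0); first exact: compact0.
rewrite -subset0; apply: fun_supp_sub; first exact: closed0.
by move=> x; rewrite eqxx.
Qed.

Lemma mu0 mu : mu (cst 0) = 0.
Proof.
have := @sd_linear _ mu 1 _ _ test0 test0.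
rewrite (_ : _ \+ _ = cst 0); last first.
  by apply/funext => x /=; rewrite mulr0 addr0.
rewrite mul1r => h; apply: (@addrI _ (mu (cst 0))).
by rewrite -h addr0.
Qed.

Lemma compact_sub_itv (K : set R) a b : compact K -> K `<=` `]a, b[ ->
  exists2 e : R, 0 < e & K `<=` `]a + e, b - e[.
Proof.
move=> /compact_near_coveringP cK Kab.
have : \forall e \near 0^'+, K `<=` `]a + e, b - e[.
  apply: (cK R 0^'+ (fun e x => `]a + e, b - e[%classic x)) => x /Kab /=.
  rewrite in_itv /= => /andP[ax xb].
  pose e := Num.min ((x - a) / 2) ((b - x) / 2).
  have e0 : 0 < e by rewrite lt_min !divr_gt0 ?subr_gt0.
  have [e1 e2] : e <= (x - a) / 2 /\ e <= (b - x) / 2.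
    by rewrite !ge_min !lexx orbT.
  near=> y d => /=; rewrite in_itv /=.
  have : `|x - y| < e by near: y; exact: nbhsx_ballx.
  have : d < e by near: d; exact: nbhs_right_lt.
  rewrite ltr_norml => de /andP[]; lra.
move=> h; near (0 : R)^'+ => e; exists e => //; by near: e.
Unshelve. all: by end_near. Qed.

Lemma compact_sub_ray (K : set R) a : compact K -> K `<=` `]a, +oo[ ->
  exists c b : R, [/\ a < c, c < b & K `<=` `]c, b[].
Proof.
move=> cK Ka; have [M [Mr MK]] := compact_bounded cK.
pose b : R := Num.max (`|M| + 1) (a + 1).
have [bM ba] : `|M| + 1 <= b /\ a + 1 <= b by rewrite !le_max !lexx orbT.
have KM x : K x -> `|x| <= `|M| + 1 / 2.
  by apply: MK; have := ler_norm M; lra.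
have [] := @compact_sub_itv K a b cK.
  move=> x Kx; have := Ka _ Kx; rewrite /= !in_itv /= andbT => -> /=.
  by have := KM _ Kx; have := ler_norm x; lra.
move=> e e0 Ke; pose d : R := Num.min e (1 / 4).
have [de d4] : d <= e /\ d <= 1 / 4 by rewrite !ge_min !lexx orbT.
have d0 : 0 < d by rewrite lt_min e0 divr_gt0.
exists (a + d), (b - d); split; [lra|lra|].
by move=> x /Ke /=; rewrite !in_itv /= => /andP[? ?]; apply/andP; split; lra.
Qed.

Lemma cutoff_exists (K : set R) a b : compact K -> K `<=` `]a, b[ ->
  exists2 chi, cutoff K chi & fun_supp chi `<=` `]a, b[.
Proof.
move=> cK /(compact_sub_itv cK)[e e0 Ke].
pose u x := (e / 2)^-1 * x + - (a + e / 2) / (e / 2).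
pose v x := - (e / 2)^-1 * x + (b - e / 2) / (e / 2).
have ei : 0 < (e / 2)^-1 by rewrite invr_gt0 divr_gt0.
have uE x : u x = (x - a - e / 2) / (e / 2) by rewrite /u; field; lra.
have vE x : v x = (b - e / 2 - x) / (e / 2) by rewrite /v; field; lra.
pose chi := (sstep \o u) \* (sstep \o v).
have sub : fun_supp chi `<=` `[a + e / 2, b - e / 2].
  apply: fun_supp_sub; first exact: interval_closed.
  move=> x; rewrite /chi /= mulf_eq0 negb_or => /andP[u0 v0].
  have up : 0 < u x.
    by rewrite ltNge; apply: contra u0 => ux; rewrite sstep0.
  have vp : 0 < v x.
    by rewrite ltNge; apply: contra v0 => ux; rewrite sstep0.
  move: up vp; rewrite uE vE !pmulr_lgt0 // in_itv /=; lra.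
exists chi; last first.
  by move=> x /sub /=; rewrite !in_itv /=; lra.
split; first split.
- by apply: smooth_mul; apply: smooth_comp;
    [exact: smooth_affine|exact: smooth_sstep|exact: smooth_affine
    |exact: smooth_sstep].
- apply: (subclosed_compact _ (@segment_compact R _ _) sub).
  exact: closed_fun_supp.
exists `]a + e, b - e[%classic; split => //.
move=> x /=; rewrite in_itv /= => /andP[x1 x2].
by rewrite /chi /= !sstep1 ?mul1r // ?uE ?vE ler_pdivlMr ?divr_gt0 //; lra.
Qed.

(** Every point of the support of phi has a ball on which mu vanishes, and by
compactness one radius serves all of them. Multiplying phi by the differences
of translates of a steep smooth step cuts it into pieces that each live in such
a ball, and the sum of the pieces telescopes to phi. *)
Lemma vanish_off_supp mu phi : test_function phi ->
  fun_supp phi `&` sd_supp mu = set0 -> mu phi = 0.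
Proof.
move=> tphi disj; have [sphi cphi] := tphi.
pose V (d x : R) := forall psi, test_function psi ->
  fun_supp psi `<=` ball x d -> mu psi = 0.
have : \forall d \near 0^'+, fun_supp phi `<=` V d.
  move/compact_near_coveringP : cphi; apply => x phix.
  have : ~ sd_supp mu x.
    by move=> sx; have : set0 x by rewrite -disj.
  move=> /contrapT [U [oU Ux muU]].
  have /nbhs_ballP[e /= e0 eU] : nbhs x U by exact: open_nbhs_nbhs.
  near=> y d => psi tpsi sub; apply: muU => // z /sub; rewrite /ball /= => yz.
  apply: eU; rewrite /ball /=.
  have xy : `|x - y| < e / 2.
    by near: y; apply: nbhsx_ballx; rewrite divr_gt0.
  have de : d < e / 2 by near: d; apply: nbhs_right_lt; rewrite divr_gt0.
  by have := ler_distD y x z; lra.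
move=> h; near (0 : R)^'+ => d.
have d0 : 0 < d by [].
have Vd : fun_supp phi `<=` V d by near: d.
(* the i-th piece lives in an interval of length 2 e < d *)
pose e : R := d / 4; have e0 : 0 < e by rewrite divr_gt0.
have [M [Mr MK]] := compact_bounded cphi.
pose L : R := `|M| + 1.
have KM x : fun_supp phi x -> `|x| <= L.
  by apply: MK; rewrite /L; have := ler_norm M; lra.
have L0 : 0 <= L by rewrite addr_ge0.
pose a : R := - L - e.
pose S (i : nat) x := sstep (e^-1 * x + (- a / e - i%:R)).
have SE i x : e^-1 * x + (- a / e - i%:R) = (x - a - i%:R * e) / e.
  by field; rewrite gt_eqF.
have sS i : smooth (S i).
  by apply: (@smooth_comp _ _ sstep); [exact: smooth_affine|exact: smooth_sstep].
have sdiff f g : smooth f -> smooth g -> smooth (-1 \*o g \+ f).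
  by move=> sf sg; exact: (smooth_add (@smooth_scale R _ _ sg) sf).
have piece i : mu (phi \* (-1 \*o S i.+1 \+ S i)) = 0.
  have tp : test_function (phi \* (-1 \*o S i.+1 \+ S i)).
    exact: (test_mull tphi (sdiff _ _ (sS _) (sS _))).
  have sub x : (phi \* (-1 \*o S i.+1 \+ S i)) x != 0 ->
      fun_supp phi x /\ `[a + i%:R * e, a + i%:R * e + 2 * e]%classic x.
    rewrite /= mulf_eq0 negb_or => /andP[/fun_supp_in px Sx]; split=> //.
    rewrite in_itv /=; apply/andP; split; rewrite leNgt; apply: contra Sx => xl.
      by rewrite /S !SE !sstep0 ?mulr0 ?addr0 // pmulr_lle0 ?invr_gt0 //
        -?natr1; nra.
    rewrite /S !SE !sstep1 ?mulr1 ?addNr // ler_pdivlMr // -?natr1; lra.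
  have [[x0 nx0]|none] := pselect (exists x,
      (phi \* (-1 \*o S i.+1 \+ S i)) x != 0).
    have [px0 ix0] := sub _ nx0.
    have de : 2 * e < d by rewrite /e; lra.
    apply: (Vd _ px0) => // y.
    have : fun_supp (phi \* (-1 \*o S i.+1 \+ S i)) `<=`
        `[a + i%:R * e, a + i%:R * e + 2 * e].
      by apply: fun_supp_sub; [exact: interval_closed|move=> x /sub[]].
    move=> /[apply]; move: ix0; rewrite /= !in_itv /= /ball /=.
    by move=> /andP[? ?] /andP[? ?]; rewrite ltr_norml; apply/andP; split; lra.
  rewrite (_ : _ \* _ = cst 0) ?mu0 //; apply/funext => x /=.
  by apply/eqP; apply: contrapT => /negP nx; apply: none; exists x.
have tele n : mu (phi \* (-1 \*o S n \+ S 0%N)) = 0.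
  elim: n => [|n IH].
    rewrite (_ : _ \* _ = cst 0) ?mu0 //; apply/funext => x /=; ring.
  have t1 : test_function (phi \* (-1 \*o S n \+ S 0%N)).
    exact: (test_mull tphi (sdiff _ _ (sS _) (sS _))).
  have t2 : test_function (phi \* (-1 \*o S n.+1 \+ S n)).
    exact: (test_mull tphi (sdiff _ _ (sS _) (sS _))).
  have := @sd_linear _ mu 1 _ _ t1 t2; rewrite IH piece mulr0 addr0 => <-.
  by congr (mu _); apply/funext => x /=; ring.
pose n := Num.bound ((L - a) / e).
rewrite -[RHS](tele n); congr (mu _); apply/funext => x /=.
have [->|px] := eqVneq (phi x) 0; first by rewrite mul0r.
have := KM _ (fun_supp_in px); rewrite ler_norml => /andP[xL1 xL2].
have nb : (L - a) / e < n%:R.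
  by apply: archi_boundP; rewrite divr_ge0 ?ltW // /a; lra.
rewrite /S !SE sstep0 ?sstep1; first by rewrite mulr0 add0r mulr1.
- by rewrite mul0r subr0 ler_pdivlMr // /a; lra.
- move: nb; rewrite ltr_pdivrMr // => nb.
  by rewrite pmulr_lle0 ?invr_gt0 //; lra.
Unshelve. all: by end_near. Qed.

End TestFunctions.

(** * Pairing a compactly supported distribution with smooth functions *)

Section Seminorms.
Context {R : realType}.
Implicit Types (f g phi psi chi : R -> R) (x a b : R) (U : set R).

(** A bound in the seminorm of order m on U, the one in which compactly supported
distributions are continuous; see [pairing_bound]. *)
Definition Cbd U (m : nat) (M : R) f :=
  forall k x, (k <= m)%N -> U x -> `|derive1n k f x| <= M.

Lemma CbdS U m M f :
  Cbd U m.+1 M f <-> (forall x, U x -> `|f x| <= M) /\ Cbd U m M f^`().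
Proof.
split=> [h|[h0 h] [|k] x km Ux]; last 2 first.
- exact: h0.
- by rewrite derive1Sn; exact: h.
split; first by move=> x; exact: (h 0%N).
by move=> k x km Ux; rewrite -derive1Sn; exact: h.
Qed.

Lemma Cbd0 U M f : Cbd U 0 M f <-> forall x, U x -> `|f x| <= M.
Proof.
split=> [h x|h k x]; first exact: (h 0%N).
by rewrite leqn0 => /eqP ->; exact: h.
Qed.

Lemma Cbd_pred U m M f : Cbd U m.+1 M f -> Cbd U m M f.
Proof. by move=> h k x km; apply: h; exact: leqW. Qed.

Lemma Cbd_le U m M M' f : M <= M' -> Cbd U m M f -> Cbd U m M' f.
Proof. by move=> MM h k x km Ux; exact: le_trans (h k x km Ux) MM. Qed.

Lemma Cbd_add U m M N f g : smooth f -> smooth g -> Cbd U m M f ->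
  Cbd U m N g -> Cbd U m (M + N) (f \+ g).
Proof.
elim: m f g => [|m IH] f g sf sg.
  move=> /Cbd0 hf /Cbd0 hg; apply/Cbd0 => x Ux /=.
  by rewrite (le_trans (ler_normD _ _)) // lerD // ?hf ?hg.
move=> /CbdS[f0 hf] /CbdS[g0 hg]; apply/CbdS; split.
  by move=> x Ux; rewrite (le_trans (ler_normD _ _)) // lerD // ?f0 ?g0.
rewrite derive1_add; try by move=> ?; exact: smooth_derivable.
exact: (IH _ _ (smooth_derive1 sf) (smooth_derive1 sg) hf hg).
Qed.

(** Each differentiation of a product doubles the number of terms. *)
Lemma Cbd_mul U m M N f g : smooth f -> smooth g -> 0 <= M -> 0 <= N ->
  Cbd U m M f -> Cbd U m N g -> Cbd U m (2 ^+ m * (M * N)) (f \* g).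
Proof.
move=> + + M0 N0; elim: m f g => [|m IH] f g sf sg.
  move=> /Cbd0 hf /Cbd0 hg; apply/Cbd0 => x Ux /=.
  by rewrite mul1r normrM ler_pM ?hf ?hg.
move=> /[dup] Sf /CbdS[f0 hf] /[dup] Sg /CbdS[g0 hg]; apply/CbdS; split.
  move=> x Ux /=; rewrite normrM (@le_trans _ _ (M * N)) //.
    by rewrite ler_pM ?f0 ?g0.
  by rewrite ler_peMl ?mulr_ge0 // exprn_ege1 // ler1n.
rewrite derive1_mul; try by move=> ?; exact: smooth_derivable.
rewrite exprS -mulrA mulr_natl mulr2n.
have sf' := smooth_derive1 sf; have sg' := smooth_derive1 sg.
by apply: Cbd_add; try exact: smooth_mul; apply: IH => //; exact: Cbd_pred.
Qed.

Lemma Cbd_affine m (a b L : R) : 0 <= L ->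
  Cbd `]- L, L[ m (`|a| * Num.max 1 L + `|b|) (fun v => a * v + b).
Proof.
move=> L0.
have m1 : 1 <= Num.max 1 L by rewrite le_max lexx.
have mL : L <= Num.max 1 L by rewrite le_max lexx orbT.
have bd (x : R) : `]- L, L[%classic x -> `|x| <= Num.max 1 L.
  by rewrite /= in_itv /= -ltr_norml => /ltW /le_trans; apply.
have h0 : forall x, `]- L, L[%classic x ->
    `|a * x + b| <= `|a| * Num.max 1 L + `|b|.
  move=> x /bd xm; rewrite (le_trans (ler_normD _ _)) // lerD2r normrM.
  by rewrite ler_wpM2l.
case: m => [|m]; first exact/Cbd0.
apply/CbdS; split => //.
rewrite (_ : (fun _ => _)^`() = cst a); last first.
  apply/funext => x; apply: derive1_val.
  rewrite (_ : (fun _ => _) = (a \*: id) \+ cst b) //.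
  by apply: is_derive_eq; rewrite /GRing.scale /=; ring.
have a0 : `|a| <= `|a| * Num.max 1 L + `|b|.
  by rewrite ler_wpDr // ler_peMr.
case: m => [|m]; first exact/Cbd0.
apply/CbdS; split => // k x _ _.
rewrite (_ : (cst a)^`() = cst 0); last first.
  by apply/funext => y; rewrite derive1_cst.
have -> : derive1n k (cst 0) = cst 0 :> (R -> R).
  by elim: k => // k IH; rewrite derive1Sn (_ : (cst 0)^`() = cst 0) //;
    apply/funext => y; rewrite derive1_cst.
by rewrite normr0 (le_trans _ a0).
Qed.

Lemma smooth_Cbd m a b f : smooth f ->
  exists2 M : R, 0 <= M & Cbd `]a, b[ m M f.
Proof.
have bd0 g : smooth g -> exists2 M : R, 0 <= M & forall x, `]a, b[%classic x -> `|g x| <= M.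
  move=> sg; have [ab|ba] := leP a b; last first.
    exists 0 => // x; rewrite /= in_itv /=; lra.
  have cg : {within `[a, b], continuous (Num.norm \o g)}.
    apply: continuous_subspaceT => x.
    apply: continuous_comp; first exact: smooth_continuous.
    exact: norm_continuous.
  have [c _ hc] := EVT_max ab cg.
  exists (`|g c|) => // x xab; apply: hc; exact: subset_itv_oo_cc.
elim: m f => [|m IH] f sf.
  by have [M M0 h] := bd0 _ sf; exists M => //; exact/Cbd0.
have [M M0 h] := bd0 _ sf.
have [N N0 h'] := IH _ (smooth_derive1 sf).
exists (M + N); first exact: addr_ge0.
apply/CbdS; split; last by apply: Cbd_le h'; rewrite ler_wpDl.
by move=> x /h /le_trans; apply; rewrite ler_wpDr.
Qed.

End Seminorms.

Section Pairing.
Context {R : realType} (mu : schwartz_distribution R).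
Hypothesis cmu : compact (sd_supp mu).
Implicit Types (f g phi psi chi : R -> R) (x a b : R).

Lemma get_cutoff : cutoff (sd_supp mu) (get (cutoff (sd_supp mu))).
Proof.
have [M [Mr MK]] := compact_bounded cmu.
have [] := @cutoff_exists R (sd_supp mu) (- (`|M| + 2)) (`|M| + 2) cmu.
  move=> x Kx /=; rewrite in_itv /= -ltr_norml.
  rewrite (@le_lt_trans _ _ (`|M| + 1)) ?ltrD2l ?ltr1n //.
  by apply: MK => //; have := ler_norm M; lra.
by move=> chi cchi _; apply: getI cchi.
Qed.

(** Two cutoffs agree near the support of mu, so their difference times phi is
supported away from it. *)
Lemma pairing_cutoff chi phi : cutoff (sd_supp mu) chi -> smooth phi ->
  pairing mu phi = mu (chi \* phi).
Proof.
move=> [tchi [U [oU KU chi1]]] sphi.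
have [tget [V [oV KV get1]]] := get_cutoff.
rewrite /pairing; set c0 := get _ in tget get1 *.
have t1 := test_mull tchi sphi; have t2 := test_mull tget sphi.
have := @sd_linear _ mu (-1) _ _ t1 t2.
rewrite (vanish_off_supp (test_lin _ t1 t2)).
  by move=> h; rewrite (_ : mu (c0 \* phi) = mu (chi \* phi)) //; lra.
rewrite -subset0 => x [sx Kx]; move: sx => /=.
have cl : closed (~` (U `&` V)) by apply: open_closedC; exact: openI.
move/(fun_supp_sub cl); apply => [{Kx} {}x /=|]; last by split; [exact: KU|exact: KV].
by move=> /eqP h [Ux Vx]; apply: h; rewrite (chi1 _ Ux) (get1 _ Vx); ring.
Qed.

Lemma pairing_lin (c : R) phi psi : smooth phi -> smooth psi ->
  pairing mu (c \*o phi \+ psi) = c * pairing mu phi + pairing mu psi.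
Proof.
move=> sphi spsi; have [tget _] := get_cutoff; rewrite /pairing -sd_linear.
- by congr (mu _); apply/funext => x /=; ring.
- exact: test_mull.
- exact: test_mull.
Qed.

Lemma pairing0 : pairing mu (cst 0) = 0.
Proof.
rewrite /pairing -[RHS](mu0 mu); congr (mu _).
by apply/funext => x /=; rewrite mulr0.
Qed.

Lemma pairing_scale (c : R) phi : smooth phi ->
  pairing mu (c \*o phi) = c * pairing mu phi.
Proof.
move=> sphi; have := pairing_lin c sphi (@smooth_cst R 0).
rewrite pairing0 addr0 => <-; congr pairing.
by apply/funext => x /=; rewrite addr0.
Qed.

Lemma pairing_add phi psi : smooth phi -> smooth psi ->
  pairing mu (phi \+ psi) = pairing mu phi + pairing mu psi.
Proof.
move=> sphi spsi; have := pairing_lin 1 sphi spsi; rewrite mul1r => <-.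
by congr pairing; apply/funext => x /=; rewrite mul1r.
Qed.

Lemma pairing_sub phi psi : smooth phi -> smooth psi ->
  pairing mu (fun v => phi v - psi v) = pairing mu phi - pairing mu psi.
Proof.
move=> sphi spsi; have := pairing_lin (-1) spsi sphi.
rewrite mulN1r addrC => <-.
by congr pairing; apply/funext => x /=; rewrite mulN1r addrC.
Qed.

(** A cutoff supported in the interval transfers the seminorm estimate, which is
over the whole line, to derivatives of phi on the interval. *)
Lemma pairing_bound a b : sd_supp mu `<=` `]a, b[ ->
  exists (C : R) (m : nat), 0 <= C /\ forall phi (M : R), smooth phi -> 0 <= M ->
    Cbd `]a, b[ m M phi -> `|pairing mu phi| <= C * M.
Proof.
move=> muab; have [chi cchi chiab] := cutoff_exists cmu muab.
have [[schi kchi] _] := cchi; have tchi : test_function chi by [].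
have [C [m hC]] := sd_continuous mu kchi.
have [N N0 hN] := smooth_Cbd m a b schi.
exists (`|C| * (m.+1%:R * (2 ^+ m * N))), m; split.
  by rewrite !mulr_ge0 // exprn_ge0.
move=> phi M sphi M0 hM; rewrite (pairing_cutoff cchi sphi).
apply: (le_trans (hC _ (test_mull tchi sphi) (@fun_supp_mull _ _ _))).
apply: (@le_trans _ _ (`|C| * (m.+1%:R * (2 ^+ m * (N * M))))); last first.
  by rewrite -!mulrA.
apply: (@le_trans _ _ (`|C| * `|\sum_(k < m.+1)
    sup (range (fun x => `|derive1n k (chi \* phi) x|))|)).
  by rewrite -normrM ler_norm.
rewrite ler_wpM2l // (le_trans (ler_norm_sum _ _ _)) //.
rewrite mulr_natl -[in leRHS](card_ord m.+1) -sumr_const ler_sum // => k _.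
have hk x : `|derive1n k (chi \* phi) x| <= 2 ^+ m * (N * M).
  have [xs|nxs] := pselect (fun_supp chi x).
    by apply: (Cbd_mul schi sphi N0 M0 hN hM); [rewrite -ltnS|exact: chiab].
  rewrite derive1n_supp ?normr0 ?mulr_ge0 ?exprn_ge0 //.
  by apply: contra_not nxs => /fun_supp_mull.
rewrite ger0_norm.
  apply: ge_sup; first by exists (`|derive1n k (chi \* phi) 0|), 0.
  by move=> _ [x _ <-].
apply: (@le_trans _ _ `|derive1n k (chi \* phi) 0|) => //.
apply: ub_le_sup; last by exists 0.
by exists (2 ^+ m * (N * M)) => _ [x _ <-].
Qed.

End Pairing.

(** * Pairing with power series *)

Section EntireSeries.
Context {R : realType}.
Implicit Types (a : nat -> R) (v x K B : R).

(** Infinite radius of convergence, as a bound on the coefficients, a form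
that [rapid_diffs] transports to the derived series. *)
Definition rapid a : Prop :=
  forall K, 0 < K -> exists B, forall k, `|a k| * K ^+ k <= B.

Lemma rapid_diffs a : rapid a -> rapid (pseries_diffs a).
Proof.
move=> ra K K0; have [B hB] := ra (2 * K) (mulr_gt0 (ltr0Sn R 1) K0).
exists (B / K) => k; rewrite ler_pdivlMr //.
apply: le_trans (hB k.+1).
rewrite /pseries_diffs normrM normr_nat -mulrA -exprSr mulrC mulrA.
rewrite [leLHS]mulrC ler_wpM2l // exprMn [leLHS]mulrC.
rewrite ler_wpM2r ?exprn_ge0 ?(ltW K0) // -natrX ler_nat.
exact/ltnW/ltn_expl.
Qed.

Lemma geometric_tail B (N j : nat) : 0 <= B ->
  \sum_(N <= i < N + j) B * 2 ^- i <= 2 * B * 2 ^- N :> R.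
Proof.
move=> B0.
suff : \sum_(N <= i < N + j) B * 2 ^- i =
   2 * B * 2 ^- N - 2 * B * 2 ^- (N + j) :> R.
  by move=> ->; rewrite gerBl mulr_ge0 ?mulr_ge0 // invr_ge0 exprn_ge0.
elim: j => [|j IH]; first by rewrite addn0 big_geq // subrr.
rewrite addnS big_nat_recr /= ?leq_addr // IH exprS invfM; lra.
Qed.

Lemma rapid_term a K B v : 0 < K -> (forall k, `|a k| * (2 * K) ^+ k <= B) ->
  `|v| <= K -> forall k, `|a k * v ^+ k| <= B * 2 ^- k.
Proof.
move=> K0 hB vK k; rewrite ler_pdivlMr ?exprn_gt0 //.
apply: le_trans (hB k); rewrite normrM normrX -mulrA ler_wpM2l //.
by rewrite mulrC exprMn ler_wpM2l ?exprn_ge0 // lerXn2r // nnegrE // ltW.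
Qed.

Lemma rapid_cvg a v : rapid a -> cvgn (pseries a v).
Proof.
move=> ra; have K0 : 0 < `|v| + 1 by rewrite ltr_wpDl.
have [B hB] := ra (2 * (`|v| + 1)) (mulr_gt0 (ltr0Sn R 1) K0).
have B0 : 0 <= B by apply: le_trans (hB 0%N); rewrite mulr_ge0.
have vK : `|v| <= `|v| + 1 by rewrite lerDl.
apply: normed_cvg.
apply: (series_le_cvg _ _ (rapid_term K0 hB vK)) => //.
  by move=> k; rewrite mulr_ge0 // invr_ge0 exprn_ge0.
rewrite (_ : (fun _ => _) = geometric B 2^-1); last first.
  by apply/funext => k /=; rewrite exprVn.
by apply: is_cvg_geometric_series; rewrite ger0_norm ?invr_ge0 // invf_lt1 // ltr1n.
Qed.

Definition entire a v : R := limn (pseries a v).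

Lemma entire_tail a K B v N : rapid a -> 0 < K ->
  (forall k, `|a k| * (2 * K) ^+ k <= B) -> `|v| <= K ->
  `|entire a v - pseries a v N| <= 2 * B * 2 ^- N.
Proof.
move=> ra K0 hB vK.
have B0 : 0 <= B.
  by apply: le_trans (hB 0%N); rewrite mulr_ge0 // exprn_ge0 // mulr_ge0 // ltW.
have cv : `|pseries a v n - pseries a v N| @[n --> \oo] -->
    `|entire a v - pseries a v N|.
  by apply: cvg_norm; apply: cvgB; [exact: rapid_cvg|exact: cvg_cst].
apply: (cvgr_to_le cv); near=> n.
have Nn : (N <= n)%N by near: n; exact: nbhs_infty_ge.
rewrite /pseries sub_series_geq //; apply: le_trans (ler_norm_sum _ _ _) _.
apply: le_trans (geometric_tail N (n - N) B0); rewrite subnKC //.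
by apply: ler_sum => k _; exact: (rapid_term K0 hB vK).
Unshelve. all: by end_near. Qed.

Lemma is_derive_entire a v : rapid a ->
  is_derive v 1 (entire a) (entire (pseries_diffs a) v).
Proof.
move=> ra; have rd := rapid_diffs ra; have rdd := rapid_diffs rd.
apply: (@pseries_snd_diffs _ a (`|v| + 1)); try exact: rapid_cvg.
by rewrite [ltRHS]ger0_norm // ltrDl.
Qed.

Lemma smooth_entire a : rapid a -> smooth (entire a).
Proof.
move=> ra; apply/smoothP => n; elim: n a ra => // n IH a ra; split.
  by move=> x; have [] := is_derive_entire x ra.
rewrite (_ : (entire a)^`() = entire (pseries_diffs a)).
  by apply: IH; exact: rapid_diffs.
by apply/funext => x; apply: derive1_val; exact: is_derive_entire.
Qed.

Lemma smooth_pow k : smooth (fun v : R => v ^+ k).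
Proof.
elim: k => [|k IH].
  by rewrite (_ : (fun _ => _) = cst 1) //; exact: (@smooth_cst R 1).
rewrite (_ : (fun _ => _) = (fun v => 1 * v + 0) \* (fun v => v ^+ k)).
  exact: (smooth_mul (@smooth_affine R 1 0) IH).
by apply/funext => v; rewrite /= exprS; ring.
Qed.

Lemma pseriesS a v N : pseries a v N.+1 = pseries a v N + a N * v ^+ N.
Proof. by rewrite /pseries /series /= big_nat_recr. Qed.

Lemma pseries_0 a v : pseries a v 0%N = 0.
Proof. by rewrite /pseries /series /= big_geq. Qed.

Lemma smooth_pseries a N : smooth (fun v => pseries a v N).
Proof.
elim: N => [|N IH].
  rewrite (_ : (fun _ => _) = cst 0); first exact: (@smooth_cst R 0).
  by apply/funext => v; rewrite pseries_0.
rewrite (_ : (fun _ => _) = (fun v => pseries a v N) \+ (a N \*o (fun v => v ^+ N))).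
  exact: (smooth_add IH (@smooth_scale R _ _ (@smooth_pow N))).
by apply/funext => v; rewrite pseriesS.
Qed.

Lemma is_derive_pseries a v N :
  is_derive v 1 (fun v => pseries a v N) (pseries (pseries_diffs a) v N.-1).
Proof.
elim: N => [|N IH].
  rewrite (_ : (fun _ => _) = cst 0); last first.
    by apply/funext => w; rewrite pseries_0.
  by rewrite pseries_0; exact: is_derive_cst.
rewrite (_ : (fun _ => _) =
    (fun v => pseries a v N) \+ (a N \*o (fun v => v ^+ N))); last first.
  by apply/funext => w; rewrite pseriesS.
have dX : is_derive v 1 (fun v : R => v ^+ N) (N%:R * v ^+ N.-1).
  have := is_deriveX N (is_derive_id v 1).
  by rewrite /GRing.scale /= mulr1 exprfctE.
have d := is_deriveD IH (is_deriveZ (a N) dX).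
apply: (is_derive_eq d); case: N {IH dX d} => [|N] /=.
  by rewrite mul0r scaler0 addr0 !pseries_0.
by rewrite pseriesS /pseries_diffs /GRing.scale /=; ring.
Qed.

(** The derivative of the remainder is the remainder of the derived series, so
geometric convergence propagates from order 0 to every order. *)
Lemma Cbd_entire_rem a m (L : R) : rapid a -> 0 < L ->
  exists2 D : R, 0 <= D & forall N,
    Cbd `]- L, L[ m (D * 2 ^- N) (fun v => entire a v - pseries a v N).
Proof.
move=> + L0; elim: m a => [|m IH] a ra.
  have [B hB] := ra (2 * L) (mulr_gt0 (ltr0Sn R 1) L0).
  have B0 : 0 <= B by apply: le_trans (hB 0%N); rewrite mulr_ge0.
  exists (2 * B); first by rewrite mulr_ge0.
  move=> N; apply/Cbd0 => v /=; rewrite in_itv /= -ltr_norml => /ltW vL.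
  exact: (entire_tail _ ra L0 hB).
have [B hB] := ra (2 * L) (mulr_gt0 (ltr0Sn R 1) L0).
have B0 : 0 <= B by apply: le_trans (hB 0%N); rewrite mulr_ge0.
have [D D0 hD] := IH _ (rapid_diffs ra).
have p0 (N : nat) : 0 < 2 ^- N :> R by rewrite invr_gt0 exprn_gt0.
exists (2 * B + 2 * D); first by rewrite addr_ge0 // mulr_ge0.
move=> N; apply/CbdS; split.
  move=> v /=; rewrite in_itv /= -ltr_norml => /ltW vL.
  apply: le_trans (entire_tail _ ra L0 hB vL) _.
  by rewrite ler_pM2r // lerDl mulr_ge0.
rewrite (_ : (fun _ => _)^`() =
  fun v => entire (pseries_diffs a) v - pseries (pseries_diffs a) v N.-1).
  apply: Cbd_le (hD _); rewrite mulrDl.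
  apply: (@le_trans _ _ (2 * D * 2 ^- N)); last first.
    by rewrite lerDr mulr_ge0 ?mulr_ge0 // ltW.
  case: N => [|N] /=; first by rewrite expr0 invr1; lra.
  by rewrite exprS invfM mulrACA divff // mul1r.
apply/funext => v; apply: derive1_val.
exact: is_deriveB (is_derive_entire v ra) (is_derive_pseries a v N).
Qed.

(** The partial sums converge in the seminorm that controls the pairing. *)
Lemma pairing_entire (mu : schwartz_distribution R) g a :
  compact (sd_supp mu) -> smooth g -> rapid a ->
  series (fun k => a k * pairing mu (fun v => g v * v ^+ k)) @ \oo -->
    pairing mu (fun v => g v * entire a v).
Proof.
move=> cmu sg ra.
have [M [Mr MK]] := compact_bounded cmu.
pose L : R := `|M| + 2; have L0 : 0 < L by rewrite ltr_wpDl.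
have muL : sd_supp mu `<=` `]- L, L[.
  move=> x Kx /=; rewrite in_itv /= -ltr_norml.
  rewrite (@le_lt_trans _ _ (`|M| + 1)) ?ltrD2l ?ltr1n //.
  by apply: MK => //; have := ler_norm M; lra.
have [C [m [C0 hC]]] := pairing_bound cmu muL.
have [D D0 hD] := Cbd_entire_rem m ra L0.
have [G G0 hG] := smooth_Cbd m (- L) L sg.
have sp N : smooth (fun v => g v * pseries a v N).
  exact: (smooth_mul sg (@smooth_pseries a N)).
have sA : smooth (fun v => g v * entire a v).
  exact: (smooth_mul sg (smooth_entire ra)).
have part N : series (fun k => a k * pairing mu (fun v => g v * v ^+ k)) N =
    pairing mu (fun v => g v * pseries a v N).
  elim: N => [|N IH].
    rewrite /series /= big_geq // -(pairing0 mu); congr pairing.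
    by apply/funext => v; rewrite pseries_0 mulr0.
  rewrite seriesSr IH.
  have sX : smooth (fun v => g v * v ^+ N) by exact: (smooth_mul sg (@smooth_pow N)).
  have := pairing_lin cmu (a N) sX (sp N); rewrite addrC => <-.
  by congr pairing; apply/funext => v; rewrite pseriesS /=; ring.
apply/cvgrPdist_le => e e0; near=> N.
rewrite part -(pairing_sub cmu sA (sp N)).
rewrite (_ : (fun _ => _) = g \* (fun v => entire a v - pseries a v N)); last first.
  by apply/funext => v /=; rewrite mulrBr.
have sr : smooth (fun v => entire a v - pseries a v N).
  rewrite (_ : (fun _ => _) = -1 \*o (fun v => pseries a v N) \+ entire a).
    apply: smooth_add; last exact: smooth_entire.
    by apply: smooth_scale; exact: smooth_pseries.
  by apply/funext => v /=; ring.
have p0 : 0 <= 2 ^- N :> R by rewrite invr_ge0 exprn_ge0.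
have DN0 : 0 <= D * 2 ^- N by rewrite mulr_ge0.
have := hC _ _ (smooth_mul sg sr) _ (Cbd_mul sg sr G0 DN0 hG (hD N)).
have M0 : 0 <= 2 ^+ m * (G * (D * 2 ^- N)) by rewrite !mulr_ge0 // exprn_ge0.
move=> /(_ M0) /le_trans; apply.
set Q := C * (2 ^+ m * (G * D)).
have -> : C * (2 ^+ m * (G * (D * 2 ^- N))) = geometric Q 2^-1 N.
  by rewrite /= exprVn /Q -!mulrA.
near: N; have : geometric Q 2^-1 @ \oo --> 0.
  by apply: cvg_geometric; rewrite ger0_norm ?invr_ge0 // invf_lt1 // ltr1n.
by move=> /cvgr_le; exact.
Unshelve. all: by end_near. Qed.

End EntireSeries.

(** * The Gaussian likelihood ratio and its pairing *)

Section Kernel.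
Context {R : realType}.
Implicit Types (t x v s L : R).

(** The likelihood ratio at x of the normal laws of variance t with means v and 0. *)
Definition kern t x v : R := expR ((2 * x * v - v ^+ 2) / (2 * t)).

Lemma kern_gt0 t x v : 0 < kern t x v. Proof. exact: expR_gt0. Qed.

Lemma is_derive_kern t x v : t != 0 ->
  is_derive v 1 (kern t x) ((- t^-1 * v + x / t) * kern t x v).
Proof.
move=> t0.
have d : is_derive v 1 (fun v => (2 * x * v - v ^+ 2) / (2 * t))
    (- t^-1 * v + x / t).
  rewrite (_ : (fun _ => _) = (2 * t)^-1 \*: (((2 * x) \*: id) \- (@id R ^+ 2))).
    apply: is_derive_eq; rewrite /GRing.scale /= expr1; field; exact: t0.
  by apply/funext => w /=; rewrite exprfctE /GRing.scale /= mulrC.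
rewrite mulrC.
exact: (@is_derive1_comp R expR (fun v => (2 * x * v - v ^+ 2) / (2 * t)) v _ _
  (is_derive_expR _) d).
Qed.

Lemma smooth_kern t x : t != 0 -> smooth (kern t x).
Proof.
move=> t0; apply/smoothP; elim=> // n IH; split.
  by move=> v; have [] := is_derive_kern x v t0.
rewrite (_ : (kern t x)^`() = (fun v => - t^-1 * v + x / t) \* kern t x).
  have /smoothP Da := @smooth_affine R (- t^-1) (x / t).
  exact: nderivable_mul.
by apply/funext => v; apply: derive1_val; exact: is_derive_kern.
Qed.

(** Differentiating phi' = l phi repeatedly bounds the derivatives of phi by a
power of the bound on l times the supremum of phi. For [kern] this keeps the
size of the function as a factor, which [heat_decay] exploits. *)
Lemma Cbd_ode U m (c M : R) (l phi : R -> R) : smooth l -> smooth phi ->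
  phi^`() = l \* phi -> 1 <= c -> 0 <= M ->
  Cbd U m c l -> (forall x, U x -> `|phi x| <= M) ->
  Cbd U m ((2 ^+ m * c) ^+ m * M) phi.
Proof.
move=> sl sphi dphi c1 M0 hl hphi.
have c0 : 0 <= c by exact: le_trans c1.
elim: m hl => [|m IH] hl; first by apply/Cbd0 => x Ux; rewrite expr0 mul1r hphi.
have q1 (n : nat) : 1 <= 2 ^+ n * c.
  by rewrite (le_trans c1) // ler_peMl // exprn_ege1 // ler1n.
apply/CbdS; split.
  move=> x Ux; apply: (le_trans (hphi x Ux)).
  by rewrite ler_peMl // exprn_ege1.
rewrite dphi.
have B0 : 0 <= (2 ^+ m * c) ^+ m * M.
  by rewrite mulr_ge0 // exprn_ge0 // mulr_ge0 // exprn_ge0.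
apply: Cbd_le (Cbd_mul sl sphi c0 B0 (Cbd_pred hl) (IH (Cbd_pred hl))).
rewrite !mulrA ler_wpM2r // [in leRHS]exprS ler_pM //.
- by rewrite mulr_ge0 // exprn_ge0.
- by rewrite exprn_ge0 // mulr_ge0 // exprn_ge0.
- by rewrite ler_wpM2r // ler_weXn2l // ler1n.
- rewrite lerXn2r // ?nnegrE ?mulr_ge0 ?exprn_ge0 //.
  by rewrite ler_wpM2r // ler_weXn2l // ler1n.
Qed.

Lemma Cbd_sub U U' m (M : R) f : U `<=` U' -> Cbd U' m M f -> Cbd U m M f.
Proof. by move=> UU h k x km /UU; exact: h. Qed.

Lemma Cbd_kern U m L t x M : U `<=` `]- L, L[ -> 1 <= L -> 0 < t -> 0 <= M ->
  (forall v, U v -> kern t x v <= M) ->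
  Cbd U m ((2 ^+ m * (1 + (L + `|x|) / t)) ^+ m * M) (kern t x).
Proof.
move=> UL L1 t0 M0 hM; have tn0 : t != 0 by rewrite gt_eqF.
have L0 : 0 <= L by exact: le_trans L1.
apply: (@Cbd_ode U m (1 + (L + `|x|) / t) M (fun v => - t^-1 * v + x / t)) => //.
- exact: smooth_affine.
- exact: smooth_kern.
- by apply/funext => v; apply: derive1_val; exact: is_derive_kern.
- by rewrite lerDl divr_ge0 ?addr_ge0 // ltW.
- apply: (Cbd_sub UL); apply: Cbd_le (@Cbd_affine R m (- t^-1) (x / t) L L0).
  rewrite (max_idPr L1) normrN normrM !(@ger0_norm _ t^-1) ?invr_ge0 ?(ltW t0) //.
  by rewrite mulrDl mulrC ler_wpDl.
- by move=> v Uv; rewrite (ger0_norm (ltW (kern_gt0 _ _ _))) hM.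
Qed.

Lemma Cbd_pow m L k : 1 <= L ->
  Cbd `]- L, L[ m ((2 ^+ m * L) ^+ k) (fun v => v ^+ k).
Proof.
move=> L1; have L0 : 0 <= L by exact: le_trans L1.
elim: k => [|k IH].
  rewrite expr0 (_ : (fun _ => _) = (fun v : R => 0 * v + 1)).
    by apply: Cbd_le (@Cbd_affine R m 0 1 L L0); rewrite normr0 mul0r add0r normr1.
  by apply/funext => v; rewrite expr0; ring.
rewrite (_ : (fun _ => _) = (fun v => 1 * v + 0) \* (fun v => v ^+ k)); last first.
  by apply/funext => v; rewrite /= exprS; ring.
rewrite exprS -mulrA; apply: Cbd_mul => //.
- exact: smooth_affine.
- exact: smooth_pow.
- by rewrite exprn_ge0 // mulr_ge0 // exprn_ge0.
- apply: Cbd_le (@Cbd_affine R m 1 0 L L0).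
  by rewrite normr0 normr1 addr0 mul1r (max_idPr L1).
Qed.

End Kernel.

Section MomentSeries.
Context {R : realType} (mu : schwartz_distribution R).
Hypothesis cmu : compact (sd_supp mu).
Implicit Types (t x v s L : R).

(** The function u of the opening comment, equal to 1 on the graph of f. *)
Definition heat t x : R := pairing mu (kern t x).

(** Up to k!, the coefficients of u (t, -) as a power series in x / t; see
[heat_series]. *)
Definition moment t k : R := pairing mu (fun v => kern t 0 v * v ^+ k).

(** As a function of v, [kern] at x = 0 is at most 1, its derivatives are
bounded uniformly for t >= s, and the power of v costs a geometric factor. *)
Lemma moment_bound s : 0 < s -> exists M rho : R, [/\ 0 <= M, 0 < rho &
  forall t k, s <= t -> `|moment t k| <= M * rho ^+ k].
Proof.
move=> s0; have [K [Kr muK]] := compact_bounded cmu.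
pose L : R := `|K| + 2; have L1 : 1 <= L by rewrite /L; have := normr_ge0 K; lra.
have L0 : 0 <= L by exact: le_trans L1.
have muL : sd_supp mu `<=` `]- L, L[.
  move=> x Kx /=; rewrite in_itv /= -ltr_norml.
  rewrite (@le_lt_trans _ _ (`|K| + 1)) ?ltrD2l ?ltr1n //.
  by apply: muK => //; have := ler_norm K; lra.
have [C [m [C0 hC]]] := pairing_bound cmu muL.
pose G : R := (2 ^+ m * (1 + (L + `|0 : R|) / s)) ^+ m * 1.
have G0 : 0 <= G.
  rewrite mulr_ge0 // exprn_ge0 // mulr_ge0 ?exprn_ge0 // addr_ge0 //.
  by rewrite divr_ge0 ?addr_ge0 // ltW.
exists (C * (2 ^+ m * G)), (2 ^+ m * L); split.
- by apply: mulr_ge0 => //; apply: mulr_ge0 => //; rewrite exprn_ge0.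
- by rewrite mulr_gt0 ?exprn_gt0 //; exact: lt_le_trans L1.
move=> t k st; have t0 : 0 < t by exact: lt_le_trans st.
have tn0 : t != 0 by rewrite gt_eqF.
have hG : Cbd `]- L, L[ m G (kern t 0).
  apply: (@Cbd_le _ _ _ ((2 ^+ m * (1 + (L + `|0 : R|) / t)) ^+ m * 1)).
    rewrite ler_wpM2r // lerXn2r // ?nnegrE.
    + by rewrite mulr_ge0 ?exprn_ge0 // addr_ge0 // divr_ge0 ?addr_ge0 // ltW.
    + by rewrite mulr_ge0 ?exprn_ge0 // addr_ge0 // divr_ge0 ?addr_ge0 // ltW.
    rewrite ler_wpM2l ?exprn_ge0 // lerD2l ler_wpM2l ?addr_ge0 //.
    by rewrite lef_pV2.
  apply: Cbd_kern => // v _; rewrite /kern -[leRHS]expR0 ler_expR.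
  rewrite mulr0 mul0r sub0r mulNr oppr_le0 divr_ge0 ?sqr_ge0 //.
  by rewrite mulr_ge0 // ltW.
have P0 : 0 <= (2 ^+ m * L) ^+ k by rewrite exprn_ge0 // mulr_ge0 // exprn_ge0.
have sm : smooth (kern t 0 \* (fun v => v ^+ k)).
  by apply: smooth_mul; [exact: smooth_kern|exact: smooth_pow].
have B0 : 0 <= 2 ^+ m * (G * (2 ^+ m * L) ^+ k).
  by rewrite mulr_ge0 ?exprn_ge0 //; exact: mulr_ge0.
have := hC _ _ sm B0 (Cbd_mul (@smooth_kern R t 0 tn0) (@smooth_pow R k) G0 P0 hG
  (@Cbd_pow R m L k L1)).
rewrite (_ : C * (2 ^+ m * G) * _ = C * (2 ^+ m * (G * (2 ^+ m * L) ^+ k))) //.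
by ring.
Qed.

Lemma rapid_exp x : rapid (fun k => x ^+ k / k`!%:R).
Proof.
move=> K K0; exists (expR (`|x| * K) + 1) => k.
rewrite normrM normfV normr_nat normrX mulrAC -exprMn.
have xK0 : 0 <= `|x| * K by rewrite mulr_ge0 // ltW.
case: k => [|k]; first by rewrite expr0 fact0 divr1 lerDr expR_ge0.
apply: le_trans (_ : 1 + (`|x| * K) ^+ k.+1 / k.+1`!%:R <= _).
  by rewrite lerDr.
by apply: le_trans (expR_ge1Dxn k xK0) _; rewrite lerDl.
Qed.

Lemma entire_exp x v : entire (fun k => x ^+ k / k`!%:R) v = expR (x * v).
Proof.
rewrite /entire /expR /pseries; congr (limn (series _)).
by apply/funext => k; rewrite /exp_coeff /= exprMn mulrAC.
Qed.

Lemma kern_split t x v : t != 0 -> kern t x v = kern t 0 v * expR (x / t * v).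
Proof. by move=> t0; rewrite /kern -expRD; congr expR; field. Qed.

(** kern t x v is kern t 0 v times exp (x v / t), and the exponential is expanded
in powers of v. *)
Lemma heat_series t x : t != 0 ->
  series (fun k => (x / t) ^+ k / k`!%:R * moment t k) @ \oo --> heat t x.
Proof.
move=> t0; have := pairing_entire cmu (@smooth_kern R t 0 t0) (@rapid_exp (x / t)).
rewrite (_ : (fun v => _) = kern t x) //.
by apply/funext => v; rewrite entire_exp -kern_split.
Qed.

Lemma exp_partial (y : R) N : 0 <= y ->
  \sum_(0 <= k < N) y ^+ k / k`!%:R <= expR y.
Proof.
move=> y0; rewrite /expR.
apply: (@nondecreasing_cvgn_le _ (series (exp_coeff y))).
  apply: nondecreasing_series => k _ _; exact: exp_coeff_ge0.
exact: is_cvg_series_exp_coeff.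
Qed.

Lemma heat_bound s : 0 < s -> exists M rho : R, [/\ 0 <= M, 0 < rho &
  (forall t k, s <= t -> `|moment t k| <= M * rho ^+ k) /\
  forall t x, s <= t -> `|heat t x| <= M * expR (rho * `|x| / t)].
Proof.
move=> s0; have [M [rho [M0 r0 hM]]] := moment_bound s0.
exists M, rho; split => //; split => // t x st.
have t0 : 0 < t by exact: lt_le_trans st.
have tn0 : t != 0 by rewrite gt_eqF.
apply: (cvgr_to_le (cvg_norm (@heat_series t x tn0))); apply: nearW => N.
rewrite /series /=; apply: le_trans (ler_norm_sum _ _ _) _.
have y0 : 0 <= rho * `|x| / t by rewrite divr_ge0 ?mulr_ge0 // ltW.
apply: le_trans (ler_wpM2l M0 (exp_partial N y0)).
rewrite mulr_sumr; apply: ler_sum => k _.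
rewrite normrM normrM normfV normr_nat normrX normrM normfV (gtr0_norm t0).
apply: le_trans (ler_wpM2l _ (hM t k st)) _.
  by rewrite divr_ge0 // exprn_ge0 // divr_ge0 // ltW.
rewrite !exprMn le_eqVlt; apply/orP; left; apply/eqP; ring.
Qed.

Lemma pow_lip (X x y : R) k : 1 <= X -> `|x| <= X -> `|y| <= X ->
  `|x ^+ k - y ^+ k| <= `|x - y| * (2 * X) ^+ k.
Proof.
move=> X1 xX yX; have X0 : 0 <= X by exact: le_trans X1.
elim: k => [|k IH]; first by rewrite !expr0 subrr normr0 mulr1.
have -> : x ^+ k.+1 - y ^+ k.+1 = x * (x ^+ k - y ^+ k) + (x - y) * y ^+ k.
  by rewrite !exprS; ring.
apply: le_trans (ler_normD _ _) _; rewrite !normrM normrX.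
have h1 : `|x| * `|x ^+ k - y ^+ k| <= X * (`|x - y| * (2 * X) ^+ k).
  by rewrite ler_pM.
have h2 : `|x - y| * `|y| ^+ k <= `|x - y| * (2 * X) ^+ k.
  rewrite ler_wpM2l // lerXn2r // ?nnegrE ?mulr_ge0 //.
  by apply: (le_trans yX); rewrite ler_peMl // ler1n.
apply: le_trans (lerD h1 h2) _; rewrite exprS.
have : 0 <= `|x - y| * (2 * X) ^+ k by rewrite mulr_ge0 // exprn_ge0 // mulr_ge0.
nra.
Qed.

Lemma heat_lip s X : 0 < s -> 1 <= X -> exists2 K : R, 0 <= K &
  forall t x y, s <= t -> `|x| <= X -> `|y| <= X ->
    `|heat t x - heat t y| <= K * `|x - y|.
Proof.
move=> s0 X1; have [M [rho [M0 r0 hM]]] := moment_bound s0.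
have X0 : 0 <= X by exact: le_trans X1.
exists (M * expR (rho * (2 * X) / s)); first by rewrite mulr_ge0 // expR_ge0.
move=> t x y st xX yX.
have t0 : 0 < t by exact: lt_le_trans st.
have tn0 : t != 0 by rewrite gt_eqF.
apply: (cvgr_to_le (cvg_norm (cvgB (@heat_series t x tn0) (@heat_series t y tn0)))).
apply: nearW => N /=.
rewrite [X in `|X|](_ : _ = \sum_(0 <= k < N) ((x / t) ^+ k / k`!%:R * moment t k -
    (y / t) ^+ k / k`!%:R * moment t k)); last by rewrite sumrB.
apply: le_trans (ler_norm_sum _ _ _) _.
have z0 : 0 <= rho * (2 * X) / s by rewrite divr_ge0 ?mulr_ge0 // ltW.
rewrite -mulrA [_ * `|x - y|]mulrC mulrA.
apply: le_trans (ler_wpM2l _ (exp_partial N z0)); last by rewrite mulr_ge0.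
rewrite mulr_sumr; apply: ler_sum => k _.
rewrite -mulrBl -mulrBl !exprMn -mulrBl !normrM normfV normr_nat.
apply: (@le_trans _ _ (`|x - y| * (2 * X) ^+ k * `|t^-1 ^+ k| / k`!%:R *
   (M * rho ^+ k))).
  rewrite ler_pM ?hM // ?mulr_ge0 //.
  by rewrite ler_wpM2r // ler_wpM2r // pow_lip.
rewrite [`|t^-1 ^+ k|]ger0_norm ?exprn_ge0 ?invr_ge0 ?(ltW t0) //.
apply: (@le_trans _ _ (`|x - y| * (2 * X) ^+ k * s^-1 ^+ k / k`!%:R *
   (M * rho ^+ k))); last first.
  rewrite !exprMn le_eqVlt; apply/orP; left; apply/eqP; ring.
have k0 : 0 <= k`!%:R^-1 :> R by [].
rewrite ler_wpM2r ?mulr_ge0 // ?exprn_ge0 ?(ltW r0) //.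
rewrite ler_wpM2r // ler_wpM2l ?mulr_ge0 ?exprn_ge0 ?mulr_ge0 //.
by rewrite lerXn2r // ?nnegrE ?invr_ge0 ?(ltW t0) ?(ltW s0) // lef_pV2.
Qed.

End MomentSeries.

(** * Decay off the support, and exchange of pairing and expectation *)

Section Decay.
Context {R : realType} (mu : schwartz_distribution R).
Hypothesis cmu : compact (sd_supp mu).
Implicit Types (t x v s L : R).

Lemma pow_exp_decay (m : nat) (k z : R) : 0 < k -> 0 < z ->
  z ^+ m * expR (- (k * z)) <= m.+1`!%:R / k ^+ m.+1 / z.
Proof.
move=> k0 z0; have kz0 : 0 <= k * z by rewrite mulr_ge0 // ltW.
have h : (k * z) ^+ m.+1 / m.+1`!%:R <= expR (k * z).
  by apply: le_trans (expR_ge1Dxn m kz0); rewrite lerDr.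
have f0 : 0 < m.+1`!%:R :> R by rewrite ltr0n fact_gt0.
have km : 0 < k ^+ m.+1 by rewrite exprn_gt0.
rewrite expRN ler_pdivlMr // mulrAC ler_pdivrMr ?expR_gt0 // mulrAC ler_pdivlMr //.
by move: h; rewrite ler_pdivrMr // -exprSr -exprMn [z * k]mulrC [_ * _`!%:R]mulrC.
Qed.

(** On the support, which is to the right of a, kern s x is at most kern s x a.
Its derivatives cost a power of y / s with y = a - x >= c. Lowering the
parameter from a to a - c / 2 gains a factor exponentially small in y / s, which
absorbs that power and leaves a factor s. *)
Lemma heat_decay a b c : sd_supp mu `<=` `]a, b[ -> 0 < c ->
  exists2 K : R, 0 <= K & forall s x, 0 < s -> s <= 1 -> x <= a - c ->
    `|heat mu s x| <= K * s * kern s x (a - c / 2).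
Proof.
move=> muab c0; have [C [m [C0 hC]]] := pairing_bound cmu muab.
pose L : R := `|a| + `|b| + 1.
have L1 : 1 <= L by rewrite lerDr addr_ge0.
have sub : `]a, b[ `<=` `]- L, L[.
  move=> v /=; rewrite !in_itv /= /L => /andP[av vb].
  have := ler_norm a; have := ler_norm b; have := ler_norm (- a).
  rewrite normrN; have := ler_norm (- b); rewrite normrN => *.
  by apply/andP; split; lra.
pose K1 : R := (1 + L + `|a|) / c + 1.
have K10 : 0 <= K1.
  rewrite addr_ge0 // divr_ge0 ?(ltW c0) // !addr_ge0 //; lra.
(* the exponents of the two kernels differ by (c^2 / 4 - c y) / (2 s), which is
   at most - k (y / s) because y >= c *)
pose k : R := 3 * c / 8; have k0 : 0 < k by rewrite /k; lra.
pose K2 : R := m.+1`!%:R / k ^+ m.+1.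
have K20 : 0 <= K2 by rewrite divr_ge0 // exprn_ge0 // ltW.
have hdec z : 0 < z -> z ^+ m * expR (- (k * z)) <= K2 / z.
  exact: pow_exp_decay.
clearbody K2.
exists (C * ((2 ^+ m * K1) ^+ m * (K2 / c))).
  rewrite mulr_ge0 // mulr_ge0 //; last by rewrite divr_ge0 // ltW.
  by rewrite exprn_ge0 // mulr_ge0 // exprn_ge0.
move=> s x s0 s1 xa; pose y := a - x.
have yc : c <= y by rewrite /y; lra.
have y0 : 0 < y by exact: lt_le_trans yc.
have z0 : 0 < y / s by rewrite divr_gt0.
have hM v : `]a, b[%classic v -> kern s x v <= kern s x a.
  rewrite /= in_itv /= => /andP[av _].
  rewrite /kern ler_expR ler_pM2r ?invr_gt0 ?mulr_gt0 //; nra.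
have := hC _ _ (@smooth_kern R s x (lt0r_neq0 s0)) _
  (Cbd_kern sub L1 s0 (ltW (kern_gt0 s x a)) hM (m := m)).
rewrite -/(heat mu s x).
have q0 : 0 <= 2 ^+ m * (1 + (L + `|x|) / s).
  rewrite mulr_ge0 ?exprn_ge0 // addr_ge0 // divr_ge0 ?(ltW s0) // addr_ge0 //; lra.
have B0 : 0 <= (2 ^+ m * (1 + (L + `|x|) / s)) ^+ m * kern s x a.
  by rewrite mulr_ge0 ?(ltW (kern_gt0 _ _ _)) // exprn_ge0.
move=> /(_ B0) /le_trans; apply.
rewrite -!mulrA ler_wpM2l //.
have h1 : 1 + (L + `|x|) / s <= K1 * (y / s).
  rewrite mulrA ler_pdivlMr // mulrDl mul1r divfK ?gt_eqF //.
  have xa' : `|x| <= `|a| + y.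
    by rewrite (_ : x = a - y) ?(le_trans (ler_normB _ _)) ?(gtr0_norm y0) // /y; ring.
  have h : 1 + L + `|a| <= (1 + L + `|a|) / c * y.
    rewrite mulrAC ler_pdivlMr // ler_wpM2l //.
    by rewrite !addr_ge0 //; lra.
  rewrite /K1 mulrDl mul1r; lra.
have h2 : (2 ^+ m * (1 + (L + `|x|) / s)) ^+ m <= (2 ^+ m * K1) ^+ m * (y / s) ^+ m.
  rewrite -exprMn lerXn2r // ?nnegrE //.
    by rewrite mulr_ge0 ?(ltW z0) // mulr_ge0 // exprn_ge0.
  by rewrite -mulrA ler_wpM2l // exprn_ge0.
have h3 : kern s x a <= expR (- (k * (y / s))) * kern s x (a - c / 2).
  rewrite /kern -expRD ler_expR.
  rewrite (_ : - (k * (y / s)) = (- (2 * k * y)) / (2 * s)); last by field; lra.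
  rewrite -mulrDl ler_pM2r ?invr_gt0 ?mulr_gt0 // /k /y.
  move: yc; rewrite /y => yc; nra.
have kp := ltW (kern_gt0 s x (a - c / 2)).
have h4 := hdec _ z0.
have h5 : K2 / (y / s) <= K2 / c * s.
  by rewrite -mulrA ler_wpM2l // invf_div mulrC ler_pM2r // lef_pV2.
apply: (@le_trans _ _ ((2 ^+ m * K1) ^+ m * (y / s) ^+ m *
   (expR (- (k * (y / s))) * kern s x (a - c / 2)))).
  by rewrite ler_pM // ?exprn_ge0 // ltW // kern_gt0.
clearbody k; rewrite -!mulrA ler_wpM2l //.
  by rewrite exprn_ge0 // mulr_ge0 // exprn_ge0.
rewrite mulrA [leRHS](_ : _ = K2 / c * s * kern s x (a - c / 2)); last by rewrite !mulrA.
by rewrite ler_wpM2r // (le_trans h4).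
Qed.

End Decay.

Section Exchange.
Context {R : realType} (mu : schwartz_distribution R).
Hypothesis cmu : compact (sd_supp mu).
Context {d : measure_display} {T : measurableType d}.
Variables (P : {measure set T -> \bar R}) (X : T -> R).
Hypothesis mX : measurable_fun setT X.
Hypothesis iX : forall c : R, P.-integrable setT (EFin \o (fun w => expR (c * `|X w|))).

Lemma measurable_pseries_comp (E : set T) (a : nat -> R) (g : R -> R) n :
  measurable E -> measurable_fun setT g ->
  measurable_fun E (fun w => series (fun k => g (X w) ^+ k / k`!%:R * a k) n).
Proof.
move=> mE mg; apply: (measurable_funS measurableT) => //.
elim: n => [|n IH].
  by rewrite /series /=; under eq_fun do rewrite big_geq //; exact: measurable_cst.
under eq_fun do rewrite seriesSr.
apply: measurable_funD => //; apply: measurable_funM; last exact: measurable_cst.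
apply: measurable_funM; last exact: measurable_cst.
by apply: measurable_funX; apply: measurableT_comp.
Qed.

Lemma exp_term (K t x : R) k : 0 <= K -> 0 < t ->
  `|(x / t) ^+ k / k`!%:R * K ^+ k| <= expR (K / t * `|x|).
Proof.
move=> K0 t0; have y0 : 0 <= K / t * `|x| by rewrite mulr_ge0 // divr_ge0 // ltW.
apply: le_trans (exp_partial k.+1 y0).
rewrite big_nat_recr //= !normrM normfV normr_nat !normrX normrM normfV.
rewrite (gtr0_norm t0) (ger0_norm K0) (_ : (K / t * `|x|) ^+ k / k`!%:R =
  (`|x| / t) ^+ k / k`!%:R * K ^+ k).
  by rewrite lerDr; apply: sumr_ge0 => i _; rewrite divr_ge0 // exprn_ge0.
by rewrite !exprMn; ring.
Qed.

Lemma integrable_exp_term (E : set T) (K t : R) k : measurable E ->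
  0 <= K -> 0 < t ->
  P.-integrable E (EFin \o (fun w => (X w / t) ^+ k / k`!%:R * K ^+ k)).
Proof.
move=> mE K0 t0.
have iE : P.-integrable E (EFin \o (fun w => expR (K / t * `|X w|))).
  exact: (integrableS measurableT).
apply: (le_integrable mE _ _ iE).
  apply/measurable_EFinP; apply: measurable_funM; last exact: measurable_cst.
  apply: measurable_funM; last exact: measurable_cst.
  apply: measurable_funX; apply: measurable_funM; last exact: measurable_cst.
  exact: (measurable_funS measurableT).
by move=> w _ /=; rewrite lee_fin [leRHS]ger0_norm ?expR_ge0 // exp_term.
Qed.

(** Dominated convergence: the partial sums are at most M exp (rho |X| / t). *)
Lemma exp_series_integral (E : set T) (t M rho : R) (a : nat -> R) (F : R -> R) :
  measurable E -> 0 < t -> 0 <= M -> 0 < rho ->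
  (forall k, `|a k| <= M * rho ^+ k) ->
  (forall x, series (fun k => (x / t) ^+ k / k`!%:R * a k) @ \oo --> F x) ->
  P.-integrable E (EFin \o (fun w => F (X w))) /\
  series (fun k => (\int[P]_(w in E) ((X w / t) ^+ k / k`!%:R))%R * a k) @ \oo -->
    (\int[P]_(w in E) F (X w))%R.
Proof.
move=> mE t0 M0 r0 ha hF.
have iE c : P.-integrable E (EFin \o (fun w => expR (c * `|X w|))).
  exact: (integrableS measurableT).
have mdiv : measurable_fun setT (fun x : R => x / t).
  by apply: measurable_funM => //; exact: measurable_cst.
pose f_ n w := (series (fun k => (X w / t) ^+ k / k`!%:R * a k) n)%:E.
pose g w := (M%:E * (EFin \o (fun w => expR (rho / t * `|X w|))) w)%E.
have mf n : measurable_fun E (f_ n).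
  apply/measurable_EFinP.
  exact: (measurable_pseries_comp a n mE mdiv).
have ff w : E w -> f_ ^~ w @ \oo --> (F (X w))%:E.
  by move=> _; apply: cvg_EFin; [exact: nearW|exact: hF].
have mF : measurable_fun E (EFin \o (fun w => F (X w))).
  exact: (emeasurable_fun_cvg _ _ mf ff).
have ig : P.-integrable E g by exact: integrableZl.
have bd n (x : R) : `|series (fun k => (x / t) ^+ k / k`!%:R * a k) n| <=
    M * expR (rho / t * `|x|).
  have y0 : 0 <= rho / t * `|x| by rewrite mulr_ge0 // divr_ge0 // ltW.
  apply: le_trans (ler_norm_sum _ _ _) _.
  apply: le_trans (ler_wpM2l M0 (exp_partial n y0)).
  rewrite mulr_sumr; apply: ler_sum => k _.
  rewrite normrM normrM normfV normr_nat normrX normrM normfV (gtr0_norm t0).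
  apply: le_trans (ler_wpM2l _ (ha k)) _.
    by rewrite divr_ge0 // exprn_ge0 // divr_ge0 // ltW.
  rewrite !exprMn le_eqVlt; apply/orP; left; apply/eqP; ring.
have fg w n : E w -> (`|f_ n w| <= g w)%E.
  by move=> _; rewrite /f_ /g /= -EFinM lee_fin.
have [iF _ cvF] := dominated_convergence mE mf mF (aeW _ ff) ig
  (aeW P (fun w n => @fg w n)).
split => //.
have ik k : P.-integrable E (EFin \o (fun w => (X w / t) ^+ k / k`!%:R)).
  have := integrable_exp_term k mE ler01 t0.
  by under eq_fun do rewrite expr1n mulr1.
have sE n : (\int[P]_(w in E) f_ n w)%E =
    (series (fun k => (\int[P]_(w in E) ((X w / t) ^+ k / k`!%:R))%R * a k) n)%:E.
  rewrite /f_ /series /=.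
  under eq_integral do rewrite -sumEFin.
  rewrite integral_sum //; last first.
    move=> k; under eq_fun do rewrite EFinM muleC.
    exact: (integrableZl mE (a k) (ik k)).
  rewrite -sumEFin; apply: eq_bigr => k _.
  under eq_integral do rewrite EFinM muleC.
  rewrite (integralZl mE (ik k)) EFinM muleC; congr (_ * _)%E.
  by rewrite /Rintegral fineK //; exact: (integrable_fin_num mE (ik k)).
have fin : (\int[P]_(w in E) (F (X w))%:E)%E \is a fin_num.
  exact: integrable_fin_num.
have cv : (fun n => (series (fun k =>
    (\int[P]_(w in E) ((X w / t) ^+ k / k`!%:R))%R * a k) n)%:E) @ \oo -->
    ((\int[P]_(w in E) F (X w))%R)%:E.
  rewrite {2}/Rintegral fineK //; apply: cvg_trans cvF; apply: near_eq_cvg.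
  by apply: nearW => n /=; rewrite sE.
exact: (fine_cvg cv).
Qed.

(** In the expectation of kern t X v, the factor kern t 0 v comes out and leaves
the power series in v with coefficients E[(X / t)^k / k!]. Pairing it termwise
replaces v^k by [moment], and the resulting series is the expectation of the one
in [heat_series]. *)
Lemma pairing_integral (E : set T) (t : R) : measurable E -> 0 < t ->
  [/\ smooth (fun v => (\int[P]_(w in E) kern t (X w) v)%R),
      P.-integrable E (EFin \o (fun w => heat mu t (X w))) &
      pairing mu (fun v => (\int[P]_(w in E) kern t (X w) v)%R) =
      (\int[P]_(w in E) heat mu t (X w))%R].
Proof.
move=> mE t0; have tn0 : t != 0 by rewrite gt_eqF.
pose a k : R := (\int[P]_(w in E) ((X w / t) ^+ k / k`!%:R))%R.
have iE c : P.-integrable E (EFin \o (fun w => expR (c * `|X w|))).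
  exact: (integrableS measurableT).
have [M [rho [M0 r0 [hM hq]]]] := heat_bound cmu t0.
have hm k : `|moment mu t k| <= M * rho ^+ k by exact: hM.
have [iq cq] := exp_series_integral mE t0 M0 r0 hm (fun x => @heat_series R mu cmu t x tn0).
have ra : rapid a.
  move=> K K0; exists (\int[P]_(w in E) expR (K / t * `|X w|))%R => k.
  rewrite -(ger0_norm (exprn_ge0 k (ltW K0))) -normrM.
  have ik := integrable_exp_term k mE (ltW K0) t0.
  have ik1 : P.-integrable E (EFin \o (fun w => (X w / t) ^+ k / k`!%:R)).
    have := integrable_exp_term k mE ler01 t0.
    by under eq_fun do rewrite expr1n mulr1.
  rewrite /a -RintegralZr //; apply: le_trans (le_normr_Rintegral mE ik) _.
  apply: le_Rintegral => //.
    by have := integrable_abse ik; apply: eq_integrable.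
  by move=> w _; rewrite exp_term // ltW.
have psE v : entire a v = (\int[P]_(w in E) expR (X w / t * v))%R.
  have hv k : `|v ^+ k| <= 1 * (`|v| + 1) ^+ k.
    by rewrite mul1r normrX lerXn2r // ?nnegrE // lerDl.
  have v1 : 0 < `|v| + 1 by rewrite ltr_wpDl.
  have hF x : series (fun k => (x / t) ^+ k / k`!%:R * v ^+ k) @ \oo -->
      expR (x / t * v).
    by rewrite -entire_exp; apply: rapid_cvg; exact: rapid_exp.
  have [_ cv] := exp_series_integral mE t0 ler01 v1 hv hF.
  exact: cvg_lim cv.
have psi v : (\int[P]_(w in E) kern t (X w) v)%R = kern t 0 v * entire a v.
  rewrite psE -RintegralZl //.
    by apply: eq_Rintegral => w _; rewrite kern_split.
  apply: (le_integrable mE _ _ (iE (`|v| / t))).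
    apply/measurable_EFinP; apply: measurableT_comp => //.
    apply: measurable_funM; last exact: measurable_cst.
    apply: measurable_funM; last exact: measurable_cst.
    exact: (measurable_funS measurableT).
  move=> w _ /=; rewrite lee_fin !(ger0_norm (expR_ge0 _)) ler_expR.
  rewrite mulrAC -[leRHS]mulrAC ler_pM2r ?invr_gt0 //.
  by rewrite (le_trans (ler_norm _)) // normrM mulrC.
rewrite (_ : (fun v => _) = (fun v => kern t 0 v * entire a v)); last exact/funext.
split => //.
  by apply: smooth_mul; [exact: smooth_kern|exact: smooth_entire].
have cp := pairing_entire cmu (@smooth_kern R t 0 tn0) ra.
exact: (cvg_unique (@Rhausdorff R) cp cq).
Qed.

End Exchange.

(** * Composition in the spaces of m times differentiable functions *)

Section SmoothComposition.
Context {R : realType}.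
Implicit Types (A f g w : R -> R) (x y W : R) (U : set R).

Lemma smooth_sub f g : smooth f -> smooth g -> smooth (f \- g).
Proof.
move=> sf sg; rewrite (_ : f \- g = -1 \*o g \+ f).
  exact: (smooth_add (@smooth_scale R _ _ sg) sf).
by apply/funext => x /=; ring.
Qed.

Lemma derive1_sub f g : (forall x, derivable f x 1) ->
  (forall x, derivable g x 1) -> (f \- g)^`() = f^`() \- g^`().
Proof.
move=> df dg; apply/funext => x /=; apply: derive1_val.
exact: is_deriveB (is_derive1 (df x)) (is_derive1 (dg x)).
Qed.

Lemma derive1_sub_smooth f g : smooth f -> smooth g ->
  (f \- g)^`() = f^`() \- g^`().
Proof. by move=> sf sg; apply: derive1_sub => x; exact: smooth_derivable. Qed.

Lemma derive1_mul_smooth f g : smooth f -> smooth g ->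
  (f \* g)^`() = (f^`() \* g) \+ (f \* g^`()).
Proof. by move=> sf sg; apply: derive1_mul => x; exact: smooth_derivable. Qed.

Lemma derive1_comp_smooth A w : smooth A -> smooth w ->
  (A \o w)^`() = (A^`() \o w) \* w^`().
Proof. by move=> sA sw; apply: derive1_compE => ?; exact: smooth_derivable. Qed.

Lemma MVT_smooth A x y : smooth A ->
  exists c : R, [/\ Num.min x y <= c, c <= Num.max x y &
    A y - A x = A^`() c * (y - x)].
Proof.
move=> sA.
have dA (z : R) : is_derive z 1 A (A^`() z) by exact/is_derive1/smooth_derivable.
have cA (a b : R) : {within `[a, b], continuous A}.
  by apply: continuous_subspaceT => z; exact: smooth_continuous.
have [xy|/ltW yx] := leP x y.
  have [c] := MVT_segment xy (fun z _ => dA z) (cA x y).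
  by rewrite in_itv /= => /andP[? ?] h; exists c.
have [c] := MVT_segment yx (fun z _ => dA z) (cA y x).
rewrite in_itv /= => /andP[? ?] h; exists c; split => //.
by rewrite -opprB h -mulrN opprB.
Qed.

Lemma smooth_bd A W : smooth A ->
  exists2 K : R, 0 <= K & forall z, `|z| <= W -> `|A z| <= K.
Proof.
move=> sA; have [K K0 hK] := smooth_Cbd 0 (- (W + 1)) (W + 1) sA.
exists K => // z zW; apply: (hK 0%N) => //=; rewrite in_itv /= -ltr_norml.
by rewrite (le_lt_trans zW) // ltrDl.
Qed.

Lemma between_norm W x y c : `|x| <= W -> `|y| <= W ->
  Num.min x y <= c -> c <= Num.max x y -> `|c| <= W.
Proof.
rewrite !ler_norml => /andP[? ?] /andP[? ?].
by rewrite ge_min le_max => /orP[?|?] /orP[?|?]; apply/andP; split; lra.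
Qed.

Lemma smooth_lip A W : smooth A -> exists2 K : R, 0 <= K &
  forall x y, `|x| <= W -> `|y| <= W -> `|A y - A x| <= K * `|y - x|.
Proof.
move=> sA; have [K K0 hK] := smooth_bd W (smooth_derive1 sA).
exists K => // x y xW yW; have [c [c0 c1 ->]] := MVT_smooth x y sA.
by rewrite normrM ler_wpM2r // hK //; exact: between_norm xW yW c0 c1.
Qed.

Lemma smooth_taylor A W : smooth A -> exists2 K : R, 0 <= K &
  forall x y, `|x| <= W -> `|y| <= W ->
    `|A y - A x - A^`() x * (y - x)| <= K * (`|y - x| * `|y - x|).
Proof.
move=> sA; have [K K0 hK] := smooth_lip W (smooth_derive1 sA).
exists K => // x y xW yW; have [c [c0 c1 ->]] := MVT_smooth x y sA.
have cW := between_norm xW yW c0 c1.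
rewrite -mulrBl normrM mulrA ler_wpM2r //.
apply: (le_trans (hK x c xW cW)); rewrite ler_wpM2l //.
move: c0 c1; rewrite ge_min le_max; case: (lerP x y) => xy.
  by move=> /orP[?|?] /orP[?|?]; rewrite !ger0_norm; lra.
by move=> /orP[?|?] /orP[?|?]; rewrite !ler0_norm; lra.
Qed.

Lemma Cbd_comp U m A W : smooth A -> 0 <= W ->
  exists2 K : R, 0 <= K & forall w, smooth w -> Cbd U m W w -> Cbd U m K (A \o w).
Proof.
move=> + W0; elim: m A => [|m IH] A sA.
  have [K K0 hK] := smooth_bd W sA; exists K => // w sw /Cbd0 hw.
  by apply/Cbd0 => x Ux /=; apply: hK; exact: hw.
have [K K0 hK] := smooth_bd W sA.
have sA' := smooth_derive1 sA.
have [K' K'0 hK'] := IH _ sA'.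
have q0 : 0 <= 2 ^+ m :> R by rewrite exprn_ge0.
have K1 : 0 <= 2 ^+ m * (K' * W) by apply: mulr_ge0 => //; exact: mulr_ge0.
exists (K + 2 ^+ m * (K' * W)); first by rewrite addr_ge0.
move=> w sw /[dup] Sw /CbdS[hw hw']; apply/CbdS; split.
  by move=> x Ux; rewrite (le_trans (hK _ (hw x Ux))) // lerDl.
rewrite (derive1_comp_smooth sA sw); apply: (@Cbd_le _ _ _ (2 ^+ m * (K' * W))).
  by rewrite lerDr.
have sc := smooth_comp sw sA'; have sw' := smooth_derive1 sw.
exact: (Cbd_mul sc sw' K'0 W0 (hK' _ sw (Cbd_pred Sw)) hw').
Qed.

(** Induction on m: the derivative of a difference of compositions is, by the
chain rule, again made of such differences with A' in place of A. *)
Lemma Cbd_comp_lip U m A W : smooth A -> 0 <= W ->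
  exists2 K : R, 0 <= K & forall w0 w1 e, smooth w0 -> smooth w1 -> 0 <= e ->
    Cbd U m W w0 -> Cbd U m W w1 -> Cbd U m e (w1 \- w0) ->
    Cbd U m (K * e) ((A \o w1) \- (A \o w0)).
Proof.
move=> + W0; elim: m A => [|m IH] A sA; have [K K0 hK] := smooth_lip W sA.
  exists K => // w0 w1 e sw0 sw1 e0 /Cbd0 h0 /Cbd0 h1 /Cbd0 h01.
  apply/Cbd0 => x Ux /=; apply: (le_trans (hK _ _ (h0 x Ux) (h1 x Ux))).
  by rewrite ler_wpM2l //; exact: h01.
have sA' := smooth_derive1 sA.
have [K' K'0 hK'] := IH _ sA'.
have [K2 K20 hK2] := @Cbd_comp U m _ W sA' W0.
have q0 : 0 <= 2 ^+ m :> R by rewrite exprn_ge0.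
have q1 : 0 <= 2 ^+ m * (K' * W) by rewrite !mulr_ge0.
have q2 : 0 <= 2 ^+ m * K2 by rewrite !mulr_ge0.
exists (K + (2 ^+ m * (K' * W) + 2 ^+ m * K2)); first by rewrite !addr_ge0.
move=> w0 w1 e sw0 sw1 e0 /[dup] S0 /CbdS[h0 h0'] /[dup] S1 /CbdS[h1 h1'].
move=> /[dup] S01 /CbdS[h01]; rewrite (derive1_sub_smooth sw1 sw0).
move=> h01'; apply/CbdS; split.
  move=> x Ux; apply: (le_trans (hK _ _ (h0 x Ux) (h1 x Ux))).
  apply: (@le_trans _ _ (K * e)); first by rewrite ler_wpM2l //; exact: h01.
  by rewrite ler_wpM2r // lerDl addr_ge0.
have s0' := smooth_derive1 sw0; have s1' := smooth_derive1 sw1.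
have sc0 := smooth_comp sw0 sA'; have sc1 := smooth_comp sw1 sA'.
have scA0 := smooth_comp sw0 sA; have scA1 := smooth_comp sw1 sA.
rewrite (derive1_sub_smooth scA1 scA0).
rewrite (derive1_comp_smooth sA sw1) (derive1_comp_smooth sA sw0).
rewrite (_ : _ \- _ = (((A^`() \o w1) \- (A^`() \o w0)) \* w1^`()) \+
   ((A^`() \o w0) \* (w1^`() \- w0^`()))); last first.
  by apply/funext => x /=; ring.
apply: (@Cbd_le _ _ _ (2 ^+ m * ((K' * e) * W) + 2 ^+ m * (K2 * e))).
  rewrite [leRHS](_ : _ = K * e + (2 ^+ m * (K' * e * W) + 2 ^+ m * (K2 * e))).
    by rewrite lerDr mulr_ge0.
  ring.
have d1 := smooth_sub sc1 sc0; have d2 := smooth_sub s1' s0'.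
have P0 := Cbd_pred S0; have P1 := Cbd_pred S1; have P01 := Cbd_pred S01.
apply: (Cbd_add (smooth_mul d1 s1') (smooth_mul sc0 d2)).
  have := hK' _ _ _ sw0 sw1 e0 P0 P1 P01.
  by move=> hh; exact: (Cbd_mul d1 s1' (mulr_ge0 K'0 e0) W0 hh h1').
exact: (Cbd_mul sc0 d2 K20 e0 (hK2 _ sw0 P0) h01').
Qed.

(** The same induction as for [Cbd_comp_lip], which supplies the mixed term. *)
Lemma Cbd_comp_taylor U m A W : smooth A -> 0 <= W ->
  exists2 K : R, 0 <= K & forall w0 w1 e, smooth w0 -> smooth w1 -> 0 <= e ->
    Cbd U m W w0 -> Cbd U m W w1 -> Cbd U m e (w1 \- w0) ->
    Cbd U m (K * (e * e))
      (((A \o w1) \- (A \o w0)) \- ((A^`() \o w0) \* (w1 \- w0))).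
Proof.
move=> + W0; elim: m A => [|m IH] A sA; have [K K0 hK] := smooth_taylor W sA.
  exists K => // w0 w1 e sw0 sw1 e0 /Cbd0 h0 /Cbd0 h1 /Cbd0 h01.
  apply/Cbd0 => x Ux /=; apply: (le_trans (hK _ _ (h0 x Ux) (h1 x Ux))).
  by rewrite ler_wpM2l // ler_pM //; exact: h01.
have sA' := smooth_derive1 sA.
have [K' K'0 hK'] := IH _ sA'.
have [K2 K20 hK2] := @Cbd_comp_lip U m _ W sA' W0.
have q0 : 0 <= 2 ^+ m :> R by rewrite exprn_ge0.
have q1 : 0 <= 2 ^+ m * (K' * W) by rewrite !mulr_ge0.
have q2 : 0 <= 2 ^+ m * K2 by rewrite !mulr_ge0.
exists (K + (2 ^+ m * (K' * W) + 2 ^+ m * K2)); first by rewrite !addr_ge0.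
move=> w0 w1 e sw0 sw1 e0 /[dup] S0 /CbdS[h0 h0'] /[dup] S1 /CbdS[h1 h1'].
move=> /[dup] S01 /CbdS[h01]; rewrite (derive1_sub_smooth sw1 sw0).
move=> h01'; apply/CbdS; split.
  move=> x Ux; apply: (le_trans (hK _ _ (h0 x Ux) (h1 x Ux))).
  apply: (@le_trans _ _ (K * (e * e))).
    by rewrite ler_wpM2l // ler_pM //; exact: h01.
  by rewrite ler_wpM2r ?mulr_ge0 // lerDl addr_ge0.
have s0' := smooth_derive1 sw0; have s1' := smooth_derive1 sw1.
have sc0 := smooth_comp sw0 sA'; have sc1 := smooth_comp sw1 sA'.
have d1 := smooth_sub sc1 sc0; have d2 := smooth_sub s1' s0'.
have dw := smooth_sub sw1 sw0.
have sc2 := smooth_comp sw0 (smooth_derive1 sA').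
have scA0 := smooth_comp sw0 sA; have scA1 := smooth_comp sw1 sA.
rewrite (derive1_sub_smooth (smooth_sub scA1 scA0) (smooth_mul sc0 dw)).
rewrite (derive1_sub_smooth scA1 scA0) (derive1_mul_smooth sc0 dw).
rewrite (derive1_sub_smooth sw1 sw0).
rewrite (derive1_comp_smooth sA sw1) (derive1_comp_smooth sA sw0).
rewrite (derive1_comp_smooth sA' sw0).
rewrite (_ : _ \- _ = ((((A^`() \o w1) \- (A^`() \o w0)) \-
     ((A^`()^`() \o w0) \* (w1 \- w0))) \* w0^`()) \+
   (((A^`() \o w1) \- (A^`() \o w0)) \* (w1^`() \- w0^`()))); last first.
  by apply/funext => x /=; ring.
apply: (@Cbd_le _ _ _ (2 ^+ m * ((K' * (e * e)) * W) + 2 ^+ m * ((K2 * e) * e))).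
  rewrite [leRHS](_ : _ = K * (e * e) +
    (2 ^+ m * ((K' * (e * e)) * W) + 2 ^+ m * ((K2 * e) * e))).
    by rewrite lerDr !mulr_ge0.
  ring.
have sm1 := smooth_sub d1 (smooth_mul sc2 dw).
have P0 := Cbd_pred S0; have P1 := Cbd_pred S1; have P01 := Cbd_pred S01.
have hh1 := hK' _ _ _ sw0 sw1 e0 P0 P1 P01.
have hh2 := hK2 _ _ _ sw0 sw1 e0 P0 P1 P01.
apply: (Cbd_add (smooth_mul sm1 s0') (smooth_mul d1 d2)).
  exact: (Cbd_mul sm1 s0' (mulr_ge0 K'0 (mulr_ge0 e0 e0)) W0 hh1 h0').
exact: (Cbd_mul d1 d2 (mulr_ge0 K20 e0) e0 hh2 h01').
Qed.

End SmoothComposition.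

(** * Differentiating a pairing along a path of affine maps *)

Section PairingPath.
Context {R : realType} (mu : schwartz_distribution R).
Hypothesis cmu : compact (sd_supp mu).

(** Between S and T the affine map moves by O(|S - T|) in every seminorm, so the
second-order Taylor remainder of A along it is quadratic, and so is its pairing.
The linear term is paired exactly. *)
Lemma pairing_path (A al be : R -> R) (D : set R) (T da db : R) : smooth A ->
  is_derive_within D al T da -> is_derive_within D be T db ->
  is_derive_within D (fun S => pairing mu (fun v => A (al S * v + be S))) T
    (da * pairing mu (fun v => v * A^`() (al T * v + be T)) +
     db * pairing mu (fun v => A^`() (al T * v + be T))).
Proof.
move=> sA; rewrite /is_derive_within => hal hbe.
set F := within D T^' in hal hbe *.
have [K0 [K0r muK]] := compact_bounded cmu.
pose L : R := `|K0| + 2; have L1 : 1 <= L by rewrite /L; have := normr_ge0 K0; lra.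
have L0 : 0 <= L by exact: le_trans L1.
have muL : sd_supp mu `<=` `]- L, L[.
  move=> x Kx /=; rewrite in_itv /= -ltr_norml.
  rewrite (@le_lt_trans _ _ (`|K0| + 1)) ?ltrD2l ?ltr1n //.
  by apply: muK => //; have := ler_norm K0; lra.
have [C [m [C0 hC]]] := pairing_bound cmu muL.
pose M : R := `|da| + `|db| + 2.
have M0 : 0 <= M by rewrite !addr_ge0.
pose W : R := (`|al T| + M) * L + (`|be T| + M).
have W0 : 0 <= W by rewrite addr_ge0 ?mulr_ge0 ?addr_ge0.
have [K Kp hK] := @Cbd_comp_taylor R `]- L, L[ m A W sA W0.
pose w S v := al S * v + be S.
have sw S : smooth (w S) by exact: smooth_affine.
have sA' := smooth_derive1 sA.
have scA S : smooth (fun v => A (al S * v + be S)) by exact: (smooth_comp (sw S) sA).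
have scA' : smooth (fun v => A^`() (al T * v + be T)) by exact: (smooth_comp (sw T) sA').
have sid : smooth (@id R).
  by have := @smooth_pow R 1; rewrite (_ : (fun _ => _) = id) //; apply/funext => v; rewrite expr1.
have svA' : smooth (fun v => v * A^`() (al T * v + be T)) by exact: (smooth_mul sid scA').
pose p1 := pairing mu (fun v => v * A^`() (al T * v + be T)).
pose p0 := pairing mu (fun v => A^`() (al T * v + be T)).
pose a S := (al S - al T) / (S - T).
pose b S := (be S - be T) / (S - T).
pose N := C * (K * ((M * L + M) * (M * L + M))).
have N0 : 0 <= N by rewrite !mulr_ge0 // addr_ge0 // mulr_ge0.
have nT : \forall S \near F, S != T.
  by apply: cvg_within; rewrite /dnbhs /within /=; exact: nearW.
have nS e : 0 < e -> \forall S \near F, `|S - T| <= e.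
  move=> e0; apply: cvg_within; apply: nbhs_dnbhs.
  have := nbhsx_ballx T e e0; apply: filterS => S.
  by rewrite /ball /= distrC => /ltW.
have main : \forall S \near F,
    `|(pairing mu (fun v => A (al S * v + be S)) -
       pairing mu (fun v => A (al T * v + be T))) / (S - T) -
      (a S * p1 + b S * p0)| <= N * `|S - T|.
  have nal : \forall S \near F, `|a S| <= M.
    have /cvgrPdist_le/(_ 1 ltr01) := hal; apply: filterS => S h.
    rewrite (_ : a S = da - (da - a S)); last by ring.
    rewrite (le_trans (ler_normB _ _)) // /M; have := normr_ge0 db.
    by move: h; rewrite -/(a S); lra.
  have nbe : \forall S \near F, `|b S| <= M.
    have /cvgrPdist_le/(_ 1 ltr01) := hbe; apply: filterS => S h.
    rewrite (_ : b S = db - (db - b S)); last by ring.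
    rewrite (le_trans (ler_normB _ _)) // /M; have := normr_ge0 da.
    by move: h; rewrite -/(b S); lra.
  near=> S.
  have ST : S - T != 0 by rewrite subr_eq0; near: S.
  have aM : `|a S| <= M by near: S.
  have bM : `|b S| <= M by near: S.
  have S1 : `|S - T| <= 1 by near: S; exact: nS.
  pose e := `|S - T| * (M * L + M).
  have e0 : 0 <= e by rewrite mulr_ge0 // addr_ge0 // mulr_ge0.
  have alE : al S - al T = a S * (S - T) by rewrite /a divfK.
  have beE : be S - be T = b S * (S - T) by rewrite /b divfK.
  have W1 : Cbd `]- L, L[ m W (w T).
    apply: Cbd_le (@Cbd_affine R m (al T) (be T) L L0).
    by rewrite (max_idPr L1) /W lerD // ?ler_wpM2r // lerDl.
  have W2 : Cbd `]- L, L[ m W (w S).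
    apply: Cbd_le (@Cbd_affine R m (al S) (be S) L L0).
    rewrite (max_idPr L1) /W lerD // ?ler_wpM2r //.
      rewrite (_ : al S = al T + a S * (S - T)); last by rewrite -alE; ring.
      rewrite (le_trans (ler_normD _ _)) // lerD2l normrM.
      by rewrite -[leRHS]mulr1 ler_pM.
    rewrite (_ : be S = be T + b S * (S - T)); last by rewrite -beE; ring.
    rewrite (le_trans (ler_normD _ _)) // lerD2l normrM.
    by rewrite -[leRHS]mulr1 ler_pM.
  have De : Cbd `]- L, L[ m e (w S \- w T).
    rewrite (_ : w S \- w T = fun v => (a S * (S - T)) * v + b S * (S - T)).
      apply: Cbd_le (@Cbd_affine R m _ _ L L0).
      rewrite (max_idPr L1) (normrM (a S)) (normrM (b S)) /e.
      rewrite [leRHS](_ : _ = M * `|S - T| * L + M * `|S - T|); last by ring.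
      by rewrite lerD // ?ler_wpM2r // ler_wpM2r.
    by apply/funext => v; rewrite /w /= -alE -beE; ring.
  have := hK _ _ _ (sw T) (sw S) e0 W1 W2 De.
  set phi := (X in Cbd _ _ _ X) => hphi.
  have KE0 : 0 <= K * (e * e) := mulr_ge0 Kp (mulr_ge0 e0 e0).
  have sphi : smooth phi.
    apply: smooth_sub.
      by apply: smooth_sub; [exact: (scA S)|exact: (scA T)].
    by apply: smooth_mul; [exact: (smooth_comp (sw T) sA')|exact: smooth_sub (sw S) (sw T)].
  have pE : pairing mu phi = pairing mu (fun v => A (al S * v + be S)) -
       pairing mu (fun v => A (al T * v + be T)) -
       (S - T) * (a S * p1 + b S * p0).
    have scw := smooth_comp (sw T) sA'.
    rewrite /phi (pairing_sub cmu); last 2 first.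
    - by apply: smooth_sub; [exact: (scA S)|exact: (scA T)].
    - exact: (smooth_mul scw (smooth_sub (sw S) (sw T))).
    rewrite (pairing_sub cmu (scA S) (scA T)); congr (_ - _).
    rewrite (_ : _ \* _ = (a S * (S - T)) \*o (fun v => v * A^`() (al T * v + be T)) \+
      ((b S * (S - T)) \*o (fun v => A^`() (al T * v + be T)))).
      rewrite (pairing_lin cmu _ svA'); last exact: smooth_scale.
      by rewrite (pairing_scale cmu _ scA') -/p1 -/p0; ring.
    by apply/funext => v; rewrite /= /w -alE -beE; ring.
  have := hC _ _ sphi KE0 hphi; rewrite pE => hh.
  rewrite (_ : _ - _ = ((pairing mu (fun v => A (al S * v + be S)) -
       pairing mu (fun v => A (al T * v + be T)) -
       (S - T) * (a S * p1 + b S * p0)) / (S - T))); last by field.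
  rewrite normrM normfV ler_pdivrMr ?normr_gt0 //.
  apply: (le_trans hh); rewrite le_eqVlt; apply/orP; left; apply/eqP.
  by rewrite /e /N; ring.
have c1 : a S * p1 + b S * p0 @[S --> F] --> da * p1 + db * p0.
  by apply: cvgD; apply: cvgM => //; exact: cvg_cst.
have c2 : (pairing mu (fun v => A (al S * v + be S)) -
       pairing mu (fun v => A (al T * v + be T))) / (S - T) -
      (a S * p1 + b S * p0) @[S --> F] --> (0 : R).
  apply/cvgrPdist_le => e e0; near=> S.
  rewrite sub0r normrN.
  have h : `|S - T| <= e / (N + 1).
    by near: S; apply: nS; rewrite divr_gt0 // ltr_wpDl.
  apply: (@le_trans _ _ (N * `|S - T|)); first by near: S.
  apply: (@le_trans _ _ ((N + 1) * (e / (N + 1)))).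
    by rewrite ler_pM // lerDl.
  by rewrite mulrC divfK // gt_eqF // ltr_wpDl.
have h := cvgD c2 c1; rewrite add0r in h.
rewrite [X in X @ F](_ : _ = (fun S => (pairing mu (fun v => A (al S * v + be S)) -
       pairing mu (fun v => A (al T * v + be T))) / (S - T) -
      (a S * p1 + b S * p0)) \+ (fun S => a S * p1 + b S * p0)); first exact: h.
by apply/funext => S /=; rewrite subrK.
Unshelve. all: by end_near. Qed.

End PairingPath.

(** * Translation of normal laws *)

Section GaussianShift.
Context {R : realType}.
Local Open Scope ereal_scope.
Notation leb := (@lebesgue_measure R).
Implicit Types (s t v x : R).

(** A named map, so that it can carry the structure of a measurable function. *)
Definition translation v : measurableTypeR R -> measurableTypeR R :=
  fun x => (x + v)%R.

Lemma measurable_translation v : measurable_fun setT (translation v).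
Proof. by apply: measurable_funD => //; exact: measurable_cst. Qed.

HB.instance Definition _ v :=
  isMeasurableFun.Build _ _ _ _ (translation v) (measurable_translation v).

(** It suffices to compare the two measures on half-open intervals. *)
Lemma lebesgue_measure_translation v (A : set (measurableTypeR R)) :
  measurable A -> pushforward leb (translation v) A = leb A.
Proof.
move=> mA; apply/esym/lebesgue_measure_unique => //= _ [[a b]] _ <-.
rewrite /pushforward (_ : _ @^-1` _ = `](a - v)%R, (b - v)%R]%classic).
  rewrite !lebesgue_measure_itv /= !lte_fin ltrD2r -!EFinB.
  by rewrite opprB addrA subrK.
by apply/seteqP; split => x /=; rewrite !in_itv /= ltrBlDr lerBrDr.
Qed.

Lemma integral_translation (f : R -> \bar R) v : measurable_fun setT f ->
  (forall x, 0 <= f x) -> \int[leb]_x f (x + v)%R = \int[leb]_x f x.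
Proof.
move=> mf f0.
transitivity (\int[pushforward leb (translation v)]_x f x).
  by rewrite (ge0_integral_pushforward (measurable_translation v)).
by apply: eq_measure_integral => A mA _; exact: lebesgue_measure_translation.
Qed.

Lemma normal_pdf_kern s x v : (0 < s)%R ->
  (kern s x v * normal_pdf 0 (Num.sqrt s) x = normal_pdf 0 (Num.sqrt s) (x - v))%R.
Proof.
move=> s0; have q0 : Num.sqrt s != 0%R by rewrite gt_eqF // sqrtr_gt0.
rewrite !normal_pdfE // /normal_fun /kern mulrCA -expRD; congr (_ * expR _)%R.
rewrite !subr0 sqr_sqrtr ?ltW // -mulr_natl; field; exact: lt0r_neq0.
Qed.

(** The density has the same integral over every set as the Radon-Nikodym
derivative, hence is almost everywhere equal to it. *)
Lemma integral_normal_prob s (f : R -> \bar R) : measurable_fun setT f ->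
  (forall x, 0 <= f x) ->
  \int[normal_prob 0%R s]_x f x = \int[leb]_x (f x * (normal_pdf 0 s x)%:E).
Proof.
move=> mf f0; have dom := @normal_prob_dominates R 0%R s.
have mpdf : measurable_fun setT (fun x => (normal_pdf 0 s x)%:E).
  by apply/measurable_EFinP; exact: measurable_normal_pdf.
have iD := Radon_Nikodym_SigmaFinite.f_integrable dom.
rewrite -(Radon_Nikodym_SigmaFinite.change_of_variables dom f0 measurableT mf).
apply: ae_eq_integral => //; [|exact: emeasurable_funM|].
  exact: emeasurable_funM mf (measurable_int _ iD).
apply: ae_eqe_mul2l; apply: integral_ae_eq => // E _ mE.
by rewrite -(Radon_Nikodym_SigmaFinite.f_integral dom mE).
Qed.

(** Multiplying the normal density by the likelihood ratio translates it
([normal_pdf_kern]), and Lebesgue measure is invariant. *)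
Lemma gauss_shift s v (f : R -> \bar R) : (0 < s)%R ->
  measurable_fun setT f -> (forall x, 0 <= f x) ->
  \int[normal_prob 0%R (Num.sqrt s)]_x (f x * (kern s x v)%:E) =
  \int[normal_prob 0%R (Num.sqrt s)]_x f (x + v)%R.
Proof.
move=> s0 mf f0.
have mk : measurable_fun setT (fun x : R => kern s x v).
  apply: measurableT_comp => //; apply: measurable_funM; last exact: measurable_cst.
  apply: measurable_funB; last exact: measurable_cst.
  by apply: measurable_funM; last exact: measurable_cst.
have mpdf := measurable_normal_pdf (0%R : R) (Num.sqrt s).
have mfv : measurable_fun setT (fun x : R => f (x + v)%R).
  apply: (measurableT_comp mf); apply: measurable_funD => //; exact: measurable_cst.
rewrite !integral_normal_prob //; last first.
- by move=> x; rewrite mule_ge0 // lee_fin ltW // kern_gt0.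
- by apply: emeasurable_funM => //; exact/measurable_EFinP.
rewrite -[RHS](@integral_translation _ (- v)%R); last 2 first.
- apply: emeasurable_funM => //; exact/measurable_EFinP.
- by move=> x; rewrite mule_ge0 // lee_fin normal_pdf_ge0.
apply: eq_integral => x _; rewrite subrK -muleA -EFinM.
by rewrite normal_pdf_kern.
Qed.

End GaussianShift.

(** * Translation in the presence of an independent variable *)

Section IndependentShift.
Context {d : measure_display} {T : measurableType d} {R : realType}.
Variable P : probability T R.
Local Open Scope ereal_scope.

(** Bundles a measurable map, so that its law can be formed. *)
Lemma mfun_exists (X : T -> R) : measurable_fun setT X ->
  exists X' : {mfun T >-> R}, X' = X :> (T -> R).
Proof.
move=> mX; pose mix := isMeasurableFun.Build _ _ _ _ X mX.
by pose X' : {mfun T >-> R} := HB.pack X mix; exists X'.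
Qed.

Lemma pair_mfun_exists (X Y : T -> R) : measurable_fun setT X ->
  measurable_fun setT Y ->
  exists Z : {mfun T >-> (measurableTypeR R * R)%type},
    Z = (fun w => (X w, Y w)) :> (T -> R * R).
Proof.
move=> mX mY; pose mix := isMeasurableFun.Build _ _ T (measurableTypeR R * R)%type _
  (measurable_fun_pair mX mY).
by pose Z : {mfun T >-> (measurableTypeR R * R)%type} :=
  HB.pack (fun w => (X w, Y w)) mix; exists Z.
Qed.

(** The joint law is the product measure, by uniqueness of the latter, and
Tonelli's theorem applies. *)
Lemma expectation_indep (X M : T -> R) (nu : probability (measurableTypeR R) R) :
  measurable_fun setT X -> measurable_fun setT M ->
  (forall A, measurable A -> P (X @^-1` A) = nu A) ->
  (forall A D, measurable A -> measurable D ->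
    P (X @^-1` A `&` M @^-1` D) = P (X @^-1` A) * P (M @^-1` D)) ->
  exists lam : probability R R, forall f : R * R -> \bar R,
    measurable_fun setT f -> (forall z, 0 <= f z) ->
    \int[P]_w f (X w, M w) = \int[lam]_m \int[nu]_x f (x, m).
Proof.
move=> mX mM lawX ind.
have [M' M'E] := mfun_exists mM; have [Z ZE] := pair_mfun_exists mX mM.
exists (distribution P M') => f mf f0.
have mZ : measurable_fun setT Z by [].
transitivity (\int[(nu \x distribution P M')]_z f z); last exact: fubini_tonelli2.
transitivity (\int[pushforward P Z]_z f z).
  by rewrite (ge0_integral_pushforward mZ) // ZE.
apply: eq_measure_integral => S mS _; apply/esym.
apply: (@product_measure_unique _ _ _ _ _ nu (distribution P M') (pushforward P Z)) => //.
move=> A D mA mD.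
transitivity (P (X @^-1` A) * P (M @^-1` D)); last first.
  congr (_ * _); first exact: lawX.
  exact: (congr1 (fun g : T -> R => P (g @^-1` D)) (esym M'E)).
rewrite -ind // /pushforward; congr (P _).
by rewrite ZE; apply/seteqP; split => w /=.
Qed.

(** Conditionally on M the variable X still has its normal law, and [gauss_shift]
applies for each value of M. *)
Lemma indep_shift (X M : T -> R) (s v : R) (S : set (R * R)) : (0 < s)%R ->
  measurable_fun setT X -> measurable_fun setT M ->
  (forall A, measurable A -> P (X @^-1` A) = normal_prob 0%R (Num.sqrt s) A) ->
  (forall A D, measurable A -> measurable D ->
    P (X @^-1` A `&` M @^-1` D) = P (X @^-1` A) * P (M @^-1` D)) ->
  measurable S ->
  \int[P]_(w in [set w | S (X w, M w)]) (kern s (X w) v)%:E =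
  P [set w | S ((X w + v)%R, M w)].
Proof.
move=> s0 mX mM lawX ind mS.
have mZ := measurable_fun_pair mX mM.
have mXv : measurable_fun setT (fun w => X w + v)%R.
  by apply: measurable_funD => //; exact: measurable_cst.
have mZv := measurable_fun_pair mXv mM.
have mk : measurable_fun setT (fun x : R => kern s x v).
  apply: measurableT_comp => //; apply: measurable_funM; last exact: measurable_cst.
  apply: measurable_funB; last exact: measurable_cst.
  by apply: measurable_funM; last exact: measurable_cst.
have mE1 : measurable [set w | S (X w, M w)].
  by have := mZ measurableT _ mS; rewrite setTI.
have mE2 : measurable [set w | S ((X w + v)%R, M w)].
  by have := mZv measurableT _ mS; rewrite setTI.
pose f (z : R * R) : \bar R := (\1_S z * kern s z.1 v)%:E.
pose g (z : R * R) : \bar R := (\1_S ((z.1 + v)%R, z.2))%:E.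
have f0 z : 0 <= f z by rewrite /f lee_fin mulr_ge0 // ltW // kern_gt0.
have g0 z : 0 <= g z by rewrite /g lee_fin.
have mf : measurable_fun setT f.
  apply/measurable_EFinP; apply: measurable_funM; first exact: measurable_indic.
  exact: (measurableT_comp mk).
have msh : measurable_fun setT (fun z : R * R => ((z.1 + v)%R, z.2)).
  apply: measurable_fun_pair => //; apply: measurable_funD => //; exact: measurable_cst.
have mg : measurable_fun setT g.
  have mi : measurable_fun setT (\1_S : R * R -> R) by exact: measurable_indic.
  by apply/measurable_EFinP; exact: (measurableT_comp mi msh).
have mix : measurable_fun setT (EFin \o (fun w => kern s (X w) v)).
  by apply/measurable_EFinP; exact: (measurableT_comp mk).
have -> : P [set w | S ((X w + v)%R, M w)] = \int[P]_w g (X w, M w).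
  transitivity (\int[P]_w (\1_[set w | S ((X w + v)%R, M w)] w)%:E).
    by rewrite integral_indic // setIT.
  apply: eq_integral => w _; rewrite /g !indicE /=.
  rewrite (_ : (w \in _) = (((X w + v)%R, M w) \in S)) //.
have -> : \int[P]_(w in [set w | S (X w, M w)]) (kern s (X w) v)%:E =
    \int[P]_w f (X w, M w).
  rewrite integral_mkcond; apply: eq_integral => w _.
  rewrite /f patchE indicE.
  rewrite (_ : ((X w, M w) \in S) = (w \in [set w | S (X w, M w)])) //.
  by case: ifP => _; rewrite ?mul1r ?mul0r.
have [lam lamE] :=
  @expectation_indep X M (normal_prob 0%R (Num.sqrt s)) mX mM lawX ind.
rewrite !lamE //; apply: eq_integral => m _.
pose fm x : \bar R := (\1_S (x, m))%:E.
have mfm : measurable_fun setT fm.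
  have mi : measurable_fun setT (\1_S : R * R -> R) by exact: measurable_indic.
  apply/measurable_EFinP; apply: (measurableT_comp mi).
  by apply: measurable_fun_pair => //; exact: measurable_cst.
rewrite -[RHS](@gauss_shift _ s v fm s0 mfm) //.
by move=> x; rewrite /fm lee_fin.
Qed.

End IndependentShift.

(** * The Markov property of Brownian motion *)

Section BrownianIncrements.
Context {d : measure_display} {Omega : measurableType d} {R : realType}.
Context {P : probability Omega R} {B : R -> {RV P >-> R}}.
Hypothesis hB : standard_brownian_motion B.
Implicit Types (r c : nat -> R).

Lemma bm_law (t : R) (A : set R) : 0 < t -> measurable A ->
  P (B t @^-1` A) = normal_prob 0 (Num.sqrt t) A.
Proof.
move=> t0 mA; have := bm_gaussian hB (lexx 0) t0 mA; rewrite subr0 => <-.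
rewrite /pushforward (_ : (B t \- B 0) = B t :> (Omega -> R)) //.
by apply/funext => w /=; rewrite (bm_start hB) subr0.
Qed.

(** A pi-system that generates the sigma-algebra of the increments. *)
Definition incr_rect r (n : nat) : set (set Omega) :=
  [set E | exists2 A : 'I_n -> set R, (forall i, measurable (A i)) &
     E = \bigcap_(i : 'I_n) ((B (r i.+1) \- B (r i))%R @^-1` A i)].

Lemma incr_rect_setI r n : setI_closed (incr_rect r n).
Proof.
move=> _ _ [A mA ->] [A' mA' ->]; exists (fun i => A i `&` A' i).
  by move=> i; exact: measurableI.
apply/seteqP; split => w /=.
  by move=> [h1 h2] i _; split; [exact: h1|exact: h2].
by move=> h; split => i _; have [] := h i I.
Qed.

Lemma incr_rect_measurable r n E : incr_rect r n E -> measurable E.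
Proof.
move=> [A mA ->]; apply: fin_bigcap_measurable => // i _.
have mX : measurable_fun setT (B (r i.+1) \- B (r i)) by exact: measurable_funB.
by have := mX measurableT _ (mA i); rewrite setTI.
Qed.

(** The value at the first time is itself an increment, from time 0. *)
Lemma incr_rect_indep r n A E : 0 <= r 0%N -> (forall i, r i <= r i.+1) ->
  measurable A -> incr_rect r n E ->
  (P (B (r 0%N) @^-1` A `&` E) = P (B (r 0%N) @^-1` A) * P E)%E.
Proof.
move=> r0 hr mA [A' mA' ->].
pose t (i : nat) : R := if i is i'.+1 then r i' else 0.
have ht i : t i <= t i.+1 by case: i.
have key (C : set R) : measurable C ->
   (P (B (r 0%N) @^-1` C `&` \bigcap_(i : 'I_n) ((B (r i.+1) \- B (r i))%R @^-1` A' i)) =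
    P (B (r 0%N) @^-1` C) *
    \prod_(i < n) P ((B (r i.+1) \- B (r i))%R @^-1` A' i))%E.
  move=> mC.
  pose AA (i : 'I_n.+1) := if unlift ord0 i is Some j then A' j else C.
  have mAA i : measurable (AA i) by rewrite /AA; case: unliftP.
  have B0 : (B (t 1%N) \- B (t 0%N)) = B (r 0%N) :> (Omega -> R).
    by apply/funext => w /=; rewrite (bm_start hB) subr0.
  have ind : indep_RVs P (fun i : 'I_n.+1 => (B (t i.+1) \- B (t i))%R).
    by apply: (bm_indep hB).
  have := ind AA mAA.
  rewrite big_ord_recl /AA unlift_none B0.
  rewrite (eq_bigr (fun i : 'I_n => P ((B (r i.+1) \- B (r i))%R @^-1` A' i))).
    move=> <-; congr (P _); apply/seteqP; split => w /=.
      move=> [h1 h2] i _; case: (unliftP ord0 i) => [j ->|->] /=.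
        exact: (h2 j I).
      by rewrite (bm_start hB) subr0.
    move=> h; split.
      by have := h ord0 I; rewrite unlift_none /= (bm_start hB) subr0.
    by move=> j _; have := h (lift ord0 j) I; rewrite liftK lift0.
  by move=> i _; rewrite liftK lift0.
rewrite key //; congr (_ * _)%E.
have := key setT measurableT; rewrite preimage_setT setTI probability_setT mul1e.
by move=> <-.
Qed.

(** The pi-lambda theorem, from [incr_rect_indep]. *)
Lemma incr_sigma_indep r n A E : 0 <= r 0%N -> (forall i, r i <= r i.+1) ->
  measurable A -> <<s incr_rect r n >> E ->
  measurable E /\
  (P (B (r 0%N) @^-1` A `&` E) = P (B (r 0%N) @^-1` A) * P E)%E.
Proof.
move=> r0 hr mA; move: E.
set L := fun E => measurable E /\
  (P (B (r 0%N) @^-1` A `&` E) = P (B (r 0%N) @^-1` A) * P E)%E.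
have mBA : measurable (B (r 0%N) @^-1` A).
  by rewrite -[X in measurable X]setTI; exact: measurable_funPT.
suff : <<s incr_rect r n >> `<=` L by [].
apply: lambda_system_subset; [exact: incr_rect_setI| | |by []].
- apply/dynkin_lambda_system; split.
  + by split => //; rewrite setIT probability_setT mule1.
  + move=> E [mE PE]; split; first exact: measurableC.
    have fin X : measurable X -> P X = (fine (P X))%:E.
      by move=> mX; rewrite fineK // fin_num_measure.
    have PD : P (B (r 0%N) @^-1` A `\` E) =
        (P (B (r 0%N) @^-1` A) - P (B (r 0%N) @^-1` A `&` E))%E.
      by rewrite measureD // -ge0_fin_numE // fin_num_measure.
    rewrite -setDE PD PE probability_setC // (fin _ mBA) (fin _ mE).
    rewrite (_ : (1 - (fine (P E))%:E)%E = (1 - fine (P E))%:E) //.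
    rewrite -!EFinM -EFinB.
    by congr EFin; ring.
  + move=> F tF hF; split.
      by apply: bigcup_measurable => k _; apply hF.
    have mF k : measurable (F k) by apply hF.
    rewrite setI_bigcupr !measure_bigcup //; last 2 first.
    * by move=> k _; exact: measurableI.
    * exact: trivIset_setIl.
    have e : (fine (P (B (r 0%N) @^-1` A)))%:E = P (B (r 0%N) @^-1` A).
      by rewrite fineK // fin_num_measure.
    rewrite -[in RHS]e -nneseriesZl //; apply: eq_eseriesr => k _; rewrite e.
    by have [] := hF k.
- move=> E hE; split; first exact: incr_rect_measurable hE.
  exact: (incr_rect_indep r0 hr mA hE).
Qed.

(** The maximum over j of the increment of B from r_0 to r_j minus c_j. This one
variable decides whether the path stays below the levels, see [fmax_lt], and is
a function of the increments. *)
Fixpoint fmax r c (n : nat) (w : Omega) : R :=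
  if n is n'.+1 then
    Num.max (fmax r c n' w) (B (r n.+1) w - B (r 0%N) w - c n.+1)
  else B (r 1%N) w - B (r 0%N) w - c 1%N.

Lemma fmax_lt r c n (x : R) w :
  (x + fmax r c n w < 0) <->
  forall j, (0 < j <= n.+1)%N -> x + (B (r j) w - B (r 0%N) w) < c j.
Proof.
have E (y z : R) : x + (y - z) < 0 <-> x + y < z by split=> ?; lra.
elim: n => [|n IH] /=.
  split=> [/E h j|h]; last by apply/E; exact: h.
  by rewrite -eqn_leq => /eqP <-.
rewrite addr_maxr gt_max; split=> [/andP[/IH h /E h'] j|h].
  move=> /andP[j0]; rewrite leq_eqVlt => /orP[/eqP -> //|jn].
  by apply: h; rewrite j0.
apply/andP; split; last by apply/E; apply: h; rewrite /= leqnn.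
by apply/IH => j /andP[j0 jn]; apply: h; rewrite j0 leqW.
Qed.

(** Measurability is with respect to the sigma-algebra of the increments, which is
the one known to be independent of B_{r_0}. *)
Lemma fmax_measurable r c n : measurable_fun setT
  (fmax r c n : g_sigma_algebraType (incr_rect r n.+1) -> R).
Proof.
set m := n.+1; pose T := g_sigma_algebraType (incr_rect r m).
have minc i : (i < m)%N ->
    measurable_fun (setT : set T) (fun w => B (r i.+1) w - B (r i) w).
  move=> im _ A mA; rewrite setTI; apply: sub_sigma_algebra.
  exists (fun j : 'I_m => if val j == i then A else setT).
    by move=> j; case: ifP.
  apply/seteqP; split => w /=.
    by move=> h j _ /=; case: ifP => // /eqP ->.
  by move=> /(_ (Ordinal im) I) /=; rewrite eqxx.
have mdiff j : (j <= m)%N ->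
    measurable_fun (setT : set T) (fun w => B (r j) w - B (r 0%N) w).
  elim: j => [|j IH] jm.
    rewrite (_ : (fun _ => _) = cst 0); first exact: measurable_cst.
    by apply/funext => w; rewrite subrr.
  rewrite (_ : (fun _ => _) = (fun w => B (r j.+1) w - B (r j) w) \+
      (fun w => B (r j) w - B (r 0%N) w)).
    by apply: measurable_funD; [exact: minc|exact: IH (ltnW jm)].
  by apply/funext => w /=; rewrite addrA subrK.
suff H k : (k < m)%N -> measurable_fun (setT : set T) (fmax r c k) by exact: H.
elim: k => [|k IH] km.
  by apply: measurable_funB; [exact: mdiff|exact: measurable_cst].
apply: measurable_maxr; first exact: IH (ltnW km).
by apply: measurable_funB; [exact: mdiff|exact: measurable_cst].
Qed.

(** The translation principle for events that depend on B_{r_0} and on whether the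
path stays below given levels afterwards. *)
Lemma markov_shift r c n (v : R) (S : set (R * R)) : 0 < r 0%N ->
  (forall i, r i <= r i.+1) -> measurable S ->
  (\int[P]_(w in [set w | S (B (r 0%N) w, fmax r c n w)])
     (kern (r 0%N) (B (r 0%N) w) v)%:E =
   P [set w | S ((B (r 0%N) w + v)%R, fmax r c n w)])%E.
Proof.
move=> r0 hr mS; have mM := @fmax_measurable r c n.
have msub D : measurable D -> <<s incr_rect r n.+1 >> (fmax r c n @^-1` D).
  by move=> mD; have := mM measurableT _ mD; rewrite setTI.
apply: indep_shift => //.
- move=> _ D mD; rewrite setTI.
  by have [] := incr_sigma_indep (ltW r0) hr measurableT (msub _ mD).
- by move=> A mA; exact: bm_law.
- move=> A D mA mD.
  by have [] := incr_sigma_indep (ltW r0) hr mA (msub _ mD).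
Qed.

End BrownianIncrements.

(** * Translation of Brownian paths on a grid *)

Section ExponentialMoments.
Context {d : measure_display} {Omega : measurableType d} {R : realType}.
Context {P : probability Omega R} {B : R -> {RV P >-> R}}.
Hypothesis hB : standard_brownian_motion B.

(** The integral is a probability, by the translation principle on the whole
space. *)
Lemma kern_integrable (t v : R) (E : set Omega) : 0 < t -> measurable E ->
  P.-integrable E (EFin \o (fun w => kern t (B t w) v)).
Proof.
move=> t0 mE; apply: (@integrableS _ _ _ _ setT) => //.
have mk : measurable_fun setT (fun x : R => kern t x v).
  apply: measurableT_comp => //; apply: measurable_funM; last exact: measurable_cst.
  apply: measurable_funB; last exact: measurable_cst.
  by apply: measurable_funM; last exact: measurable_cst.
apply/integrableP; split.
  by apply/measurable_EFinP; exact: (measurableT_comp mk).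
under eq_integral do rewrite /= ger0_norm ?(ltW (kern_gt0 _ _ _)) //.
have := @markov_shift _ _ _ _ _ hB (fun=> t) (fun=> 0) 0%N v setT t0
  (fun=> lexx t) measurableT.
rewrite (_ : [set w | _] = setT); last by apply/seteqP.
by move=> ->; rewrite probability_setT ltry.
Qed.

Lemma bm_exp_integrable (t c : R) : 0 < t ->
  P.-integrable setT (EFin \o (fun w => expR (c * `|B t w|))).
Proof.
move=> t0.
have i1 := kern_integrable (c * t) t0 measurableT.
have i2 := kern_integrable (- (c * t)) t0 measurableT.
have i3 := integrableD measurableT i1 i2.
have i4 := integrableZl measurableT (expR (c ^+ 2 * t / 2)) i3.
have tn0 : t != 0 by rewrite gt_eqF.
apply: (le_integrable measurableT _ _ i4).
  apply/measurable_EFinP; apply: measurableT_comp => //.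
  by apply: measurable_funM; [exact: measurable_cst|exact: measurableT_comp].
move=> w _ /=; rewrite lee_fin (ger0_norm (expR_ge0 _)).
rewrite [leRHS]ger0_norm; last first.
  by rewrite mulr_ge0 ?expR_ge0 // addr_ge0 // ltW // kern_gt0.
have e1 : expR (c ^+ 2 * t / 2) * kern t (B t w) (c * t) = expR (c * B t w).
  by rewrite /kern -expRD; congr expR; field.
have e2 : expR (c ^+ 2 * t / 2) * kern t (B t w) (- (c * t)) = expR (- (c * B t w)).
  by rewrite /kern -expRD; congr expR; field.
rewrite mulrDr e1 e2; case: (lerP 0 (B t w)) => h.
  by rewrite (ger0_norm h) lerDl expR_ge0.
by rewrite (ltr0_norm h) mulrN lerDr expR_ge0.
Qed.

End ExponentialMoments.

Section Grid.
Context {d : measure_display} {Omega : measurableType d} {R : realType}.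
Context {P : probability Omega R} {B : R -> {RV P >-> R}}.
Hypothesis hB : standard_brownian_motion B.
Variables (f : R -> R) (s T e : R) (N : nat).
Hypotheses (s0 : 0 < s) (sT : s < T) (N0 : (0 < N)%N) (e0 : 0 < e).
Implicit Types (v : R) (D : set R) (k j : nat).

Definition grid k : R := s + k%:R * ((T - s) / N%:R).

(** The boundary is lowered by e, except at the final time, where staying below
it must mean B_T < f T. *)
Definition level k : R := if (k < N)%N then f (grid k) - e else f (grid k).
Definition below k v : set Omega :=
  [set w | forall j, (k <= j <= N)%N -> B (grid j) w + v < level j].
Definition cell k D v : set Omega :=
  [set w | below k.+1 v w /\ D (B (grid k) w + v)].

Lemma gridN : grid N = T.
Proof. by rewrite /grid mulrC divfK ?subrKC // pnatr_eq0 -lt0n. Qed.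

Lemma grid_step_gt0 : 0 < (T - s) / N%:R.
Proof. by rewrite divr_gt0 ?subr_gt0 // ltr0n. Qed.

Lemma grid_mono k : grid k <= grid k.+1.
Proof. by rewrite lerD2l ler_wpM2r ?(ltW grid_step_gt0) // ler_nat. Qed.

Lemma grid_ge k : s <= grid k.
Proof. by rewrite lerDl mulr_ge0 // ltW // grid_step_gt0. Qed.

Lemma grid_gt0 k : 0 < grid k.
Proof. exact: lt_le_trans (grid_ge k). Qed.

Lemma grid_le k : (k <= N)%N -> grid k <= T.
Proof.
move=> kN; rewrite -gridN lerD2l ler_wpM2r ?(ltW grid_step_gt0) // ler_nat //.
Qed.

Lemma grid0 : grid 0 = s.
Proof. by rewrite /grid mul0r addr0. Qed.

Lemma level_lt k : (k < N)%N -> level k = f (grid k) - e.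
Proof. by rewrite /level => ->. Qed.

Lemma levelN : level N = f T.
Proof. by rewrite /level ltnn gridN. Qed.

Lemma level_le k : level k <= f (grid k).
Proof. by rewrite /level; case: ifP => // _; rewrite gerBl ltW. Qed.

(** The variable of [fmax] for the grid points after time k. *)
Definition future k : Omega -> R :=
  fmax (B := B) (fun i => grid (k + i)) (fun i => level (k + i)) (N - k).-1.

Lemma below_future k v w : (k < N)%N ->
  below k.+1 v w <-> (B (grid k) w + v) + future k w < 0.
Proof.
move=> kN; rewrite /future fmax_lt addn0; have kN' : (0 < N - k)%N by rewrite subn_gt0.
split=> [h j|h j /andP[kj jN]].
  rewrite prednK // => /andP[j0 jN].
  have := h (k + j)%N; rewrite -addn1 leq_add2l j0 -leq_subRL ?(ltnW kN) //.
  by move=> /(_ jN); rewrite addrC [v + _]addrC [X in X < _ -> _]addrC; lra.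
have := h (j - k)%N; rewrite subnKC ?(ltnW kj) // prednK // subn_gt0 kj /=.
rewrite leq_sub2r // => /(_ isT); lra.
Qed.

Lemma cell_future k D v : (k < N)%N -> cell k D v =
  [set w | (fun z : R * R => D z.1 /\ z.1 + z.2 < 0) (B (grid k) w + v, future k w)].
Proof.
move=> kN; apply/seteqP; split => w /=.
  by move=> [/(below_future _ _ kN) h Dw]; split.
by move=> [Dw h]; split => //; apply/below_future.
Qed.

Lemma measurable_cell_set D : measurable D ->
  measurable [set z : R * R | D z.1 /\ z.1 + z.2 < 0].
Proof.
move=> mD; apply: measurableI.
  have m1 : measurable_fun setT (fst : R * R -> R) by exact: measurable_fst.
  by have := m1 measurableT _ mD; rewrite setTI.
have m2 : measurable_fun setT (fun z : R * R => z.1 + z.2).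
  by apply: measurable_funD; [exact: measurable_fst|exact: measurable_snd].
have := m2 measurableT _ (measurable_itv `]-oo, 0[); rewrite setTI.
by rewrite (_ : _ @^-1` _ = [set x | x.1 + x.2 < 0]).
Qed.

Lemma measurable_shift_lt t v (a : R) : measurable [set w | B t w + v < a].
Proof.
have m : measurable_fun setT (fun w => B t w + v).
  by apply: measurable_funD => //; exact: measurable_cst.
have := m measurableT _ (measurable_itv `]-oo, a[); rewrite setTI.
by rewrite (_ : _ @^-1` _ = [set x | B t x + v < a]).
Qed.

Lemma measurable_below k v : measurable (below k v).
Proof.
rewrite (_ : below k v = \bigcap_j (if (k <= j <= N)%N then
    [set w | B (grid j) w + v < level j] else setT)).
  by apply: bigcapT_measurable => j; case: ifP => // _; exact: measurable_shift_lt.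
apply/seteqP; split => w /=.
  by move=> h j _; case: ifP => // /h.
by move=> h j kj; have := h j I; rewrite kj.
Qed.

Lemma measurable_cell k D v : measurable D -> measurable (cell k D v).
Proof.
move=> mD; apply: measurableI; first exact: measurable_below.
have m : measurable_fun setT (fun w => B (grid k) w + v).
  by apply: measurable_funD => //; exact: measurable_cst.
by have := m measurableT _ mD; rewrite setTI.
Qed.

Lemma cell_shift k D v : (k < N)%N -> measurable D ->
  (\int[P]_(w in cell k D 0%R) (kern (grid k) (B (grid k) w) v)%:E =
   P (cell k D v))%E.
Proof.
move=> kN mD; rewrite !cell_future //.
have := @markov_shift _ _ _ _ _ hB (fun i => grid (k + i)) (fun i => level (k + i))
  (N - k).-1 v _ _ _ (measurable_cell_set mD).
rewrite addn0 => <-; last 2 first.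
- exact: grid_gt0.
- by move=> i; rewrite addnS; exact: grid_mono.
by congr (integral _ _ _); apply/seteqP; split => w /=; rewrite addr0.
Qed.

Lemma cell_pairing (mu : schwartz_distribution R) k D :
  compact (sd_supp mu) -> (k < N)%N -> measurable D ->
  [/\ smooth (fun v => fine (P (cell k D v))),
      P.-integrable (cell k D 0) (EFin \o (fun w => heat mu (grid k) (B (grid k) w))) &
      pairing mu (fun v => fine (P (cell k D v))) =
      (\int[P]_(w in cell k D 0) heat mu (grid k) (B (grid k) w))%R].
Proof.
move=> cmu kN mD.
have mX : measurable_fun setT (B (grid k)) by [].
have iX c := bm_exp_integrable hB c (grid_gt0 k).
have := pairing_integral cmu mX iX (measurable_cell k 0 mD) (grid_gt0 k).
rewrite (_ : (fun v => (\int[P]_(w in _) kern _ _ v)%R) =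
  (fun v => fine (P (cell k D v)))) //.
by apply/funext => v; rewrite /Rintegral cell_shift.
Qed.

End Grid.

(** * Decomposition at the last visit *)

Section RintegralBound.
Context {d : measure_display} {T : measurableType d} {R : realType}.
Variable P : {measure set T -> \bar R}.

Lemma Rintegral_bound (E : set T) (g h : T -> R) : measurable E ->
  P.-integrable E (EFin \o g) -> P.-integrable E (EFin \o h) ->
  (forall w, E w -> `|g w| <= h w) ->
  `|(\int[P]_(w in E) g w)%R| <= (\int[P]_(w in E) h w)%R.
Proof.
move=> mE ig ih gh; apply: le_trans (le_normr_Rintegral mE ig) _.
apply: le_Rintegral => //; first exact: (integrable_abse ig).
Qed.

End RintegralBound.

Section GridEstimate.
Context {d : measure_display} {Omega : measurableType d} {R : realType}.
Context {P : probability Omega R} {B : R -> {RV P >-> R}}.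
Hypothesis hB : standard_brownian_motion B.
Variables (f : R -> R) (s T e : R) (N : nat).
Hypotheses (s0 : 0 < s) (sT : s < T) (N0 : (0 < N)%N) (e0 : 0 < e).
Implicit Types (v : R) (D : set R) (k j : nat).
Notation grid := (grid s T N).
Notation level := (level f s T e N).
Notation below := (below (B := B) f s T e N).
Notation cell := (cell (B := B) f s T e N).

(** The path moves by more than e relative to the boundary in one step. Outside of
this event a visit to the lowered boundary that is the last one lies in the
strip of width e around f. *)
Definition jump : set Omega := [set w | exists k, (k < N)%N /\
  e < `|(B (grid k.+1) w - f (grid k.+1)) - (B (grid k) w - f (grid k))|].

Definition hit k v := cell k `[level k, +oo[ v.
Definition over k v := cell k `]f (grid k) + e, +oo[ v.
Definition strip k v := cell k `[level k, f (grid k) + e] v.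

Lemma measurable_jump : measurable jump.
Proof.
rewrite (_ : jump = \bigcup_k (if (k < N)%N then [set w |
  e < `|(B (grid k.+1) w - f (grid k.+1)) - (B (grid k) w - f (grid k))|] else set0)).
  apply: bigcupT_measurable => k; case: ifP => // _.
  have m : measurable_fun setT (fun w =>
      `|(B (grid k.+1) w - f (grid k.+1)) - (B (grid k) w - f (grid k))|).
    apply: measurableT_comp => //; apply: measurable_funB;
      by apply: measurable_funB => //; exact: measurable_cst.
  have := m measurableT _ (measurable_itv `]e, +oo[); rewrite setTI.
  rewrite (_ : _ @^-1` _ = [set w |
    e < `|(B (grid k.+1) w - f (grid k.+1)) - (B (grid k) w - f (grid k))|]) //.
  by apply/seteqP; split => w /=; rewrite in_itv /= andbT.
apply/seteqP; split => w /=.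
  by move=> [k [kN h]]; exists k => //; rewrite kN.
by move=> [k _]; case: ifP => // kN h; exists k.
Qed.

Lemma belowS k v : (k < N)%N -> below k v =
  below k.+1 v `&` [set w | B (grid k) w + v < level k].
Proof.
move=> kN; apply/seteqP; split => w /=.
  move=> h; split; last by apply: h; rewrite leqnn ltnW.
  by move=> j /andP[kj jN]; apply: h; rewrite jN ltnW.
move=> [h hk] j /andP[]; rewrite leq_eqVlt => /orP[/eqP <- //|kj jN].
by apply: h; rewrite kj.
Qed.

(** The last visit takes place at time k when the path is below the levels after
k but not from k on; this is what makes the sum over k telescope. *)
Lemma hitE k v : (k < N)%N -> hit k v = below k.+1 v `\` below k v.
Proof.
move=> kN; rewrite (belowS _ kN); apply/seteqP; split => w /=.
  move=> [h]; rewrite /= in_itv /= andbT => hk; split => // -[_].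
  by rewrite ltNge hk.
move=> [h nh]; split => //=; rewrite in_itv /= andbT leNgt.
by apply/negP => hk; exact: nh.
Qed.

Lemma fine_hit k v : (k < N)%N ->
  fine (P (hit k v)) = fine (P (below k.+1 v)) - fine (P (below k v)).
Proof.
move=> kN; rewrite hitE // measureD; last 3 first.
- exact: measurable_below.
- exact: measurable_below.
- by rewrite -ge0_fin_numE // fin_num_measure //; exact: measurable_below.
rewrite (setIidr _); last by rewrite (belowS _ kN); exact: subIsetl.
by rewrite fineB // fin_num_measure //; exact: measurable_below.
Qed.

Lemma below0 v : below 0 v = cell 0 `]-oo, level 0[ v.
Proof.
rewrite belowS //; apply/seteqP; split => w /= [h1]; rewrite ?in_itv /= => h2;
  by split => //; rewrite ?in_itv.
Qed.

(** An overshoot is followed by a jump, and overshoots at different times exclude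
each other: the one at k is in [below] from k + 1 on and not from k on. *)
Lemma over_sum v : \sum_(k < N) fine (P (over k v)) <= fine (P jump).
Proof.
have mJ := measurable_jump.
pose b k := fine (P (below k v `&` jump)).
have mb k : measurable (below k v `&` jump).
  by apply: measurableI => //; exact: measurable_below.
have fin X : measurable X -> P X \is a fin_num by exact: fin_num_measure.
have step (k : 'I_N) : fine (P (over k v)) <= b k.+1 - b k.
  have kN := ltn_ord k.
  have sub : over k v `<=` (below k.+1 v `&` jump) `\` (below k v `&` jump).
    move=> w [h]; rewrite /= in_itv /= andbT => hk.
    have lk : level k <= f (grid k) + e.
      by rewrite level_lt //; have := e0; lra.
    split.
      split => //; exists k; split => //.
      have := h k.+1; rewrite leqnn kN => /(_ isT) h1.
      have lk1 := level_le f s T N e0 k.+1.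
      rewrite ltr_normr; apply/orP; right; lra.
    by rewrite (belowS _ kN) => -[[_ /=]]; lra.
  rewrite /b -fineB ?fin //; rewrite -[in leRHS](setIidr (_ : below k v `&` jump `<=`
    below k.+1 v `&` jump)); last first.
    by rewrite (belowS _ kN); apply: setSI; exact: subIsetl.
  rewrite -measureD //; last by rewrite -ge0_fin_numE // fin.
  apply: fine_le; rewrite ?fin //.
  - by apply: measurable_cell; exact: measurable_itv.
  - exact: measurableD.
  - apply: le_measure; rewrite ?inE //; last exact: measurableD.
    by apply: measurable_cell; exact: measurable_itv.
apply: (@le_trans _ _ (\sum_(k < N) (b k.+1 - b k))).
  by apply: ler_sum => k _; exact: step.
rewrite -(big_mkord xpredT (fun k => b k.+1 - b k)) telescope_sumr //.
apply: (@le_trans _ _ (b N)); first by rewrite gerBl fine_ge0.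
by apply: fine_le; rewrite ?fin // le_measure ?inE.
Qed.

Variables (mu : schwartz_distribution R) (C rho eta err : R).
Hypothesis cmu : compact (sd_supp mu).
Hypotheses (C0 : 0 <= C) (eta0 : 0 <= eta).
Hypothesis hq : forall t x, s <= t ->
  `|heat mu t x| <= C * (kern t x rho + kern t x (- rho)).
Hypothesis hstrip : forall k x, (k < N)%N ->
  f (grid k) - e <= x <= f (grid k) + e -> `|heat mu (grid k) x - 1| <= eta.
Hypothesis herr : `|(\int[P]_(w in below 0 0) heat mu s (B s w))%R| <= err.

Notation Iq k := (\int[P]_(w in hit k 0) heat mu (grid k) (B (grid k) w))%R.

(** Each step adds one last visit, whose pairing is an expectation of u by
[cell_pairing]. The induction starts from the paths that never visit. *)
Lemma pairing_below n : (n <= N)%N -> smooth (fun v => fine (P (below n v))) /\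
  pairing mu (fun v => fine (P (below n v))) =
  \sum_(k < n) Iq k + (\int[P]_(w in below 0 0) heat mu s (B s w))%R.
Proof.
elim: n => [_|n IH nN].
  have [sm _ pE] := cell_pairing hB f e s0 sT N0 cmu N0 (measurable_itv `]-oo, level 0[).
  rewrite big_ord0 add0r; under eq_fun do rewrite below0.
  by split; [exact: sm|rewrite pE below0 grid0].
have [sn pn] := IH (ltnW nN).
have [sm _ pE] := cell_pairing hB f e s0 sT N0 cmu nN (measurable_itv `[level n, +oo[).
have E : (fun v => fine (P (below n.+1 v))) =
    (fun v => fine (P (hit n v))) \+ (fun v => fine (P (below n v))).
  by apply/funext => v /=; rewrite fine_hit // subrK.
rewrite E; split; first exact: smooth_add.
by rewrite (pairing_add cmu sm sn) pn pE big_ord_recr /= addrAC addrC addrA.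
Qed.

(** On the strip, u is within eta of 1. On an overshoot u is only known to be
at most exponential, but the expectation of that exponential is the
probability that a translated path overshoots. *)
Lemma hit_estimate k : (k < N)%N ->
  `|Iq k - fine (P (hit k 0))| <= eta * fine (P (hit k 0)) +
    (fine (P (over k 0)) + C * (fine (P (over k rho)) + fine (P (over k (- rho))))).
Proof.
move=> kN.
have lk : level k = f (grid k) - e by rewrite level_lt.
have mh : measurable (hit k 0) by apply: measurable_cell; exact: measurable_itv.
have ms : measurable (strip k 0) by apply: measurable_cell; exact: measurable_itv.
have mo : measurable (over k 0) by apply: measurable_cell; exact: measurable_itv.
have g0 : 0 < grid k by exact: grid_gt0.
have hU : hit k 0 = strip k 0 `|` over k 0.
  apply/seteqP; split => w.
    move=> [h]; rewrite /= in_itv /= andbT => hk.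
    have [h1|h1] := leP (B (grid k) w + 0) (f (grid k) + e).
      by left; split => //=; rewrite in_itv /= hk.
    by right; split => //=; rewrite in_itv /= andbT.
  move=> [|] [h]; rewrite /= in_itv /= ?andbT => hk; split => //=;
    rewrite in_itv /= andbT; first by case/andP: hk.
  by apply: le_trans (ltW hk); rewrite lk; have := e0; lra.
have [_ iq _] := cell_pairing hB f e s0 sT N0 cmu kN (measurable_itv `[level k, +oo[).
have i1 E : measurable E -> P.-integrable E (EFin \o (fun=> 1 : R)).
  by move=> mE; apply: finite_measure_integrable_cst.
pose g w := heat mu (grid k) (B (grid k) w) - 1.
have ig : P.-integrable (hit k 0) (EFin \o g).
  by have := integrableB mh iq (i1 _ mh); apply: eq_integrable.
have -> : Iq k - fine (P (hit k 0)) = (\int[P]_(w in hit k 0) g w)%R.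
  rewrite RintegralB //; last exact: i1.
  by rewrite Rintegral_cst // mul1r.
rewrite hU in ig *.
have disj : [disjoint strip k 0 & over k 0].
  apply/eqP/seteqP; split => // w [[_ /=]]; rewrite in_itv /= => /andP[_ h1] [_ /=].
  by rewrite in_itv /= andbT ltNge h1.
rewrite Rintegral_setU //.
have igs : P.-integrable (strip k 0) (EFin \o g).
  by apply: integrableS ig; [exact: measurableU| |exact: subsetUl].
have igo : P.-integrable (over k 0) (EFin \o g).
  by apply: integrableS ig; [exact: measurableU| |exact: subsetUr].
apply: le_trans (ler_normD _ _) _; apply: lerD.
  apply: (@le_trans _ _ (\int[P]_(w in strip k 0) eta)%R).
    apply: Rintegral_bound => //.
      exact: finite_measure_integrable_cst.
    move=> w [_ /=]; rewrite in_itv /= addr0 lk => h; exact: hstrip.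
  rewrite Rintegral_cst // ler_wpM2l // -hU; apply: fine_le.
  - exact: fin_num_measure.
  - exact: fin_num_measure.
  - by rewrite hU; apply: le_measure; rewrite ?inE //; exact: measurableU.
have ik v := kern_integrable hB v g0 mo.
have kE v : (\int[P]_(w in over k 0) kern (grid k) (B (grid k) w) v)%R =
    fine (P (over k v)).
  by rewrite /Rintegral cell_shift //; exact: measurable_itv.
have ikk : P.-integrable (over k 0)
    (EFin \o (fun w => kern (grid k) (B (grid k) w) rho + kern (grid k) (B (grid k) w) (- rho))).
  by have := integrableD mo (ik rho) (ik (- rho)); apply: eq_integrable.
have ikC : P.-integrable (over k 0)
    (EFin \o (fun w => C * (kern (grid k) (B (grid k) w) rho +
      kern (grid k) (B (grid k) w) (- rho)))).
  by have := integrableZl mo C ikk; apply: eq_integrable.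
apply: (@le_trans _ _ (\int[P]_(w in over k 0) (1 + C *
   (kern (grid k) (B (grid k) w) rho + kern (grid k) (B (grid k) w) (- rho))))%R).
  apply: Rintegral_bound => //.
    by have := integrableD mo (i1 _ mo) ikC; apply: eq_integrable.
  move=> w _; rewrite /g addrC (le_trans (ler_normD _ _)) // normrN normr1 lerD2l.
  by apply: hq; exact: grid_ge.
rewrite RintegralD //; last exact: i1.
by rewrite Rintegral_cst // mul1r RintegralZl // RintegralD // !kE.
Qed.

(** The sum of [hit_estimate] over the grid. By [over_sum], the overshoots of the
path and of its two translates are each bounded by one jump probability,
because a jump is insensitive to translation. *)
Lemma grid_estimate :
  `|pairing mu (fun v => fine (P [set w | B T w + v < f T])) -
    fine (P (below N 0 `\` below 0 0))| <=
  eta + (1 + 2 * C) * fine (P jump) + err.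
Proof.
have bN v : below N v = [set w | B T w + v < f T].
  apply/seteqP; split => w /=.
    by move=> /(_ N); rewrite leqnn levelN // gridN //; exact.
  by move=> h j; rewrite -eqn_leq => /eqP <-; rewrite levelN // gridN.
under [X in pairing mu X]eq_fun do rewrite -bN.
have [_ ->] := pairing_below (leqnn N).
have bsub n : (n <= N)%N -> below 0 0 `<=` below n 0.
  by move=> nN w h j /andP[_ jN]; exact: h.
have -> : fine (P (below N 0 `\` below 0 0)) = \sum_(k < N) fine (P (hit k 0)).
  rewrite measureD; last 3 first.
  - exact: measurable_below.
  - exact: measurable_below.
  - by rewrite -ge0_fin_numE // fin_num_measure //; exact: measurable_below.
  rewrite (setIidr (bsub _ (leqnn N))) fineB ?fin_num_measure //; try exact: measurable_below.
  rewrite -(telescope_sumr (fun k => fine (P (below k 0))) (leq0n N)) big_mkord.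
  by apply: eq_bigr => k _; rewrite fine_hit.
rewrite addrAC -sumrB (le_trans (ler_normD _ _)) // lerD //.
apply: le_trans (ler_norm_sum _ _ _) _.
apply: (le_trans (ler_sum _ (fun (k : 'I_N) _ => hit_estimate (ltn_ord k)))).
rewrite !big_split /= -!mulr_sumr big_split /=.
have o1 := over_sum 0; have o2 := over_sum rho; have o3 := over_sum (- rho).
have h1 : \sum_(k < N) fine (P (hit k 0)) <= 1.
  under eq_bigr do rewrite fine_hit //.
  rewrite -(big_mkord xpredT (fun k => fine (P (below k.+1 0)) - fine (P (below k 0)))).
  rewrite telescope_sumr //.
  apply: (@le_trans _ _ (fine (P (below N 0)))); first by rewrite gerBl fine_ge0.
  rewrite -[leRHS]/(fine 1%E); apply: fine_le => //.
  - by apply: fin_num_measure; exact: measurable_below.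
  - by apply: probability_le1; exact: measurable_below.
have h2 : eta * \sum_(k < N) fine (P (hit k 0)) <= eta by rewrite ler_piMr.
have h3 : C * (\sum_(k < N) fine (P (over k rho)) +
    \sum_(k < N) fine (P (over k (- rho)))) <= C * (fine (P jump) + fine (P jump)).
  by rewrite ler_wpM2l // lerD.
lra.
Qed.

End GridEstimate.

(** * Continuous functions on refining grids *)

Section PathLemmas.
Context {R : realType}.
Implicit Types (g : R -> R) (a b : R).

Lemma within_itv_sub g a b a' b' : a <= a' -> b' <= b ->
  {within `[a, b], continuous g} -> {within `[a', b'], continuous g}.
Proof.
move=> aa bb; apply: continuous_subspaceW => x /=; rewrite !in_itv /= => /andP[h1 h2].
by rewrite (le_trans aa h1) (le_trans h2 bb).
Qed.

(** Compactness in the form of near coverings: near each point the modulus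
of continuity at that point serves all pairs of close points. *)
Lemma within_unif_continuous g a b : {within `[a, b], continuous g} ->
  forall e, 0 < e -> exists2 dl, 0 < dl & forall x y, a <= x <= b -> a <= y <= b ->
    `|x - y| < dl -> `|g x - g y| < e.
Proof.
move=> /subspace_continuousP cg e e0.
pose Q dl x := forall y, a <= x <= b -> a <= y <= b -> `|x - y| < dl -> `|g x - g y| < e.
have : \forall dl \near 0^'+, (`[a, b]%classic : set R) `<=` Q dl.
  apply: (compact_near_coveringP _).1; first exact: segment_compact.
  move=> x xab; have e2 : 0 < e / 2 by rewrite divr_gt0.
  have /cvgrPdist_lt /(_ _ e2) := cg x xab.
  rewrite /prop_near1 /nbhs /= /within /= => /nbhs_ballP[d /= d0 hd].
  have d2 : 0 < d / 2 by rewrite divr_gt0.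
  exists (ball x (d / 2), [set dl | dl < d / 2]).
    split => /=; first exact: nbhsx_ballx.
    exact: nbhs_right_lt.
  move=> [x' dl] /= [hx hdl] y hx' hy xy.
  have h z : a <= z <= b -> `|x - z| < d -> `|g x - g z| < e / 2.
    by move=> hz hxz; apply: hd => //=; rewrite in_itv.
  have h1 : `|g x - g x'| < e / 2.
    by apply: h => //; apply: lt_le_trans hx _; lra.
  have h2 : `|g x - g y| < e / 2.
    apply: h => //; rewrite (le_lt_trans (ler_distD x' _ _)) //.
    have := ltrD hx (lt_trans xy hdl); rewrite /ball_ /=; lra.
  rewrite (le_lt_trans (ler_distD (g x) _ _)) // (distrC (g x')); lra.
move=> h.
have h' : \forall dl \near 0^'+, 0 < dl /\ (`[a, b]%classic : set R) `<=` Q dl.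
  near=> dl; split; first by near: dl; exact: nbhs_right_gt.
  by near: dl.
have [dl [dl0 hdl]] := filter_ex h'.
by exists dl => // x y hx; apply: hdl => //=; rewrite in_itv.
Unshelve. all: by end_near. Qed.

Lemma within_bounded g a b : {within `[a, b], continuous g} ->
  exists2 X, 0 <= X & forall x, a <= x <= b -> `|g x| <= X.
Proof.
move=> cg; have [ab|ba] := leP a b; last first.
  by exists 0 => // x /andP[h1 h2]; move: (le_trans h1 h2); rewrite leNgt ba.
have [c _ hc] := EVT_max ab cg; have [c' _ hc'] := EVT_min ab cg.
exists (`|g c| + `|g c'|) => [|x hx]; first by rewrite addr_ge0.
have xab : x \in `[a, b] by rewrite in_itv.
have h1 := hc x xab; have h2 := hc' x xab.
have h3 := ler_norm (g c); have h4 := ler_norm (- g c').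
rewrite normrN in h4; rewrite ler_norml; apply/andP; split.
  by have := normr_ge0 (g c); lra.
by have := normr_ge0 (g c'); lra.
Qed.

(** The maximum of g cannot be negative. *)
Lemma touch_of_approx g a b : a <= b -> {within `[a, b], continuous g} ->
  (forall m : nat, exists2 t, a <= t <= b & - m.+1%:R^-1 <= g t) ->
  exists2 t, a <= t <= b & 0 <= g t.
Proof.
move=> ab cg h; have [c cab hc] := EVT_max ab cg.
exists c; first by move: cab; rewrite in_itv.
rewrite leNgt; apply/negP => gc.
have [m hm] : exists m : nat, m.+1%:R^-1 < - g c.
  have /ltr_add_invr[m] : 0 < - g c by rewrite oppr_gt0.
  by rewrite add0r; exists m.
have [t tab ht] := h m.
have h1 : g t <= g c by apply: hc; rewrite in_itv.
have : g c < g t by apply: lt_le_trans ht; rewrite ltrNr.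
by rewrite ltNge h1.
Qed.

Variables (s T : R).
Hypothesis sT : s < T.

Lemma grid_between N m t : (0 < m)%N -> (m <= N)%N ->
  s <= t <= grid s T N m ->
  exists2 k, (k < m)%N & grid s T N k <= t <= grid s T N k.+1.
Proof.
case: m => // m _; elim: m => [|m IH] mN /andP[st tm].
  by exists 0%N => //; rewrite grid0 st.
have [h|h] := leP t (grid s T N m.+1).
  have [|k km hk] := IH (ltnW mN); first by rewrite st.
  by exists k => //; exact: ltnW.
by exists m.+1 => //; rewrite (ltW h).
Qed.

Lemma grid_stepE N k : grid s T N k.+1 - grid s T N k = (T - s) / N%:R.
Proof. by rewrite /grid -natr1; ring. Qed.

(** Doubling N refines the grid; along powers of 2 grid events are monotone. *)
Lemma grid_double N k : grid s T N k = grid s T (2 * N) (2 * k).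
Proof.
rewrite /grid !natrM; have [->|N0] := eqVneq N 0%N; first by rewrite mulr0 !invr0 !mulr0.
have N0' : N%:R != 0 :> R by rewrite pnatr_eq0.
by congr (_ + _); field.
Qed.

Lemma fine_mesh dl : 0 < dl -> exists M, forall n, (M <= n)%N ->
  (T - s) / (2 ^ n)%:R < dl.
Proof.
move=> dl0.
have sT0 : 0 < T - s by rewrite subr_gt0.
have [M hM] : exists M : nat, M.+1%:R^-1 < dl / (T - s).
  have /ltr_add_invr[m] : 0 < dl / (T - s) by rewrite divr_gt0.
  by rewrite add0r; exists m.
exists M => n Mn; rewrite mulrC -ltr_pdivlMr //; apply: le_lt_trans hM.
rewrite lef_pV2 ?posrE ?ltr0n ?expn_gt0 // ler_nat.
by apply: leq_ltn_trans Mn (ltn_expl _ _).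
Qed.

Lemma grid_near_touch g t : {within `[s, T], continuous g} -> s <= t <= T ->
  forall e, 0 < e -> exists n, exists2 k, (k < 2 ^ n)%N &
    g t - e <= g (grid s T (2 ^ n) k).
Proof.
move=> cg tsT e e0; have [dl dl0 hdl] := within_unif_continuous cg e0.
have [M hM] := fine_mesh dl0; exists M.
have N0 : (0 < 2 ^ M)%N by rewrite expn_gt0.
have [|k kN /andP[h1 h2]] := @grid_between (2 ^ M) (2 ^ M) t N0 (leqnn _).
  by rewrite gridN.
exists k => //; have := hM M (leqnn _); rewrite -(grid_stepE _ k) => h3.
have : `|g t - g (grid s T (2 ^ M) k)| < e.
  apply: hdl => //.
    by rewrite (grid_ge sT N0) (grid_le sT N0) // ltnW.
  by rewrite ger0_norm ?subr_ge0 //; lra.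
by rewrite ltr_norml => /andP[_]; lra.
Qed.

End PathLemmas.

(** * Touching the boundary *)

Section ProbabilityLimits.
Context {d : measure_display} {Omega : measurableType d} {R : realType}.
Variable P : probability Omega R.
Implicit Type F : (set Omega)^nat.

Lemma near_bigcup F (eps : R) : (forall n, measurable (F n)) ->
  (forall n, F n `<=` F n.+1) -> 0 < eps ->
  \forall n \near \oo, `|fine (P (\bigcup_n F n)) - fine (P (F n))| < eps.
Proof.
move=> mF hF e0; have mU : measurable (\bigcup_n F n) by exact: bigcupT_measurable.
have : (P \o F) n @[n --> \oo] --> (fine (P (\bigcup_n F n)))%:E.
  rewrite fineK ?fin_num_measure //; apply: nondecreasing_cvg_mu => //.
  by apply/nondecreasing_seqP => n; apply/subsetPset; exact: hF.
by move=> /fine_cvgP[_ /cvgrPdist_lt /(_ _ e0)].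
Qed.

Lemma near_bigcap F (eps : R) : (forall n, measurable (F n)) ->
  (forall n, F n.+1 `<=` F n) -> 0 < eps ->
  \forall n \near \oo, `|fine (P (\bigcap_n F n)) - fine (P (F n))| < eps.
Proof.
move=> mF hF e0; have mU : measurable (\bigcap_n F n) by exact: bigcapT_measurable.
have : (P \o F) n @[n --> \oo] --> (fine (P (\bigcap_n F n)))%:E.
  rewrite fineK ?fin_num_measure //; apply: nonincreasing_cvg_mu => //.
    by rewrite -ge0_fin_numE // fin_num_measure.
  by apply/nonincreasing_seqP => n; apply/subsetPset; exact: hF.
by move=> /fine_cvgP[_ /cvgrPdist_lt /(_ _ e0)].
Qed.

End ProbabilityLimits.

Section Touch.
Context {d : measure_display} {Omega : measurableType d} {R : realType}.
Context {P : probability Omega R} {B : R -> {RV P >-> R}}.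
Hypothesis hB : standard_brownian_motion B.
Variables (f : R -> R) (T' : R).
Hypothesis hf : {within `[0, T'], continuous f}.
Implicit Types (s T e : R) (n m : nat).

Definition touch s T : set Omega :=
  [set w | exists2 t, s <= t <= T & f t <= B t w].

Definition grid_touch s T e n : set Omega :=
  [set w | exists2 k, (k < 2 ^ n)%N &
     f (grid s T (2 ^ n) k) - e <= B (grid s T (2 ^ n) k) w].

Lemma path_continuous s T w : 0 <= s -> T <= T' ->
  {within `[s, T], continuous (fun t => B t w - f t)}.
Proof.
move=> s0 TT; apply: within_continuousB.
  have := bm_continuous hB (w := w); apply: continuous_subspaceW => x /=.
  by rewrite !in_itv /= andbT => /andP[h _]; exact: le_trans h.
exact: within_itv_sub hf.
Qed.

Lemma measurable_ge (t a : R) : measurable [set w | a <= B t w].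
Proof.
have m : measurable_fun setT (B t) by [].
have := m measurableT _ (measurable_itv `[a, +oo[); rewrite setTI.
rewrite (_ : _ @^-1` _ = [set w | a <= B t w]) //.
by apply/seteqP; split => w /=; rewrite in_itv /= andbT.
Qed.

Lemma measurable_grid_touch s T e n : measurable (grid_touch s T e n).
Proof.
rewrite (_ : grid_touch s T e n = \bigcup_(k in [set k | (k < 2 ^ n)%N])
    [set w | f (grid s T (2 ^ n) k) - e <= B (grid s T (2 ^ n) k) w]).
  by apply: bigcup_measurable => k _; exact: measurable_ge.
by apply/seteqP; split => w [k h1 h2]; exists k.
Qed.

Lemma grid_touchS s T e n : grid_touch s T e n `<=` grid_touch s T e n.+1.
Proof.
move=> w [k kn]; rewrite (grid_double s T) -expnS => h; exists (2 * k)%N => //.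
by rewrite expnS ltn_pmul2l.
Qed.

(** Only countably many grid times enter, whence measurability. By continuity, a
touch is seen on fine grids up to any error; conversely, by compactness,
approximate touches for every error imply a touch. *)
Lemma touchE s T : 0 <= s -> s < T -> T <= T' ->
  touch s T = \bigcap_m \bigcup_n grid_touch s T m.+1%:R^-1 n.
Proof.
move=> s0 sT TT; apply/seteqP; split => w.
  move=> [t tsT ft] m _.
  have m0 : 0 < m.+1%:R^-1 :> R by rewrite invr_gt0.
  have [n [k kn hk]] := grid_near_touch sT (path_continuous (w := w) s0 TT) tsT m0.
  exists n => //; exists k => //; move: hk ft; set z := _^-1; lra.
move=> h.
have [|t tsT ht] := touch_of_approx (ltW sT) (path_continuous (w := w) s0 TT); last first.
  by exists t => //; rewrite subr_ge0 in ht.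
move=> m; have [n _ [k kn hk]] := h m I.
have N0 : (0 < 2 ^ n)%N by rewrite expn_gt0.
exists (grid s T (2 ^ n) k).
  by rewrite (grid_ge sT N0) (grid_le sT N0) // ltnW.
by move: hk; set z := _^-1; lra.
Qed.

Lemma measurable_touch s T : 0 <= s -> s < T -> T <= T' ->
  measurable (touch s T).
Proof.
move=> s0 sT TT; rewrite touchE //; apply: bigcapT_measurable => m.
by apply: bigcupT_measurable => n; exact: measurable_grid_touch.
Qed.

(** Every path is uniformly continuous relative to f, so it jumps on finitely many
of the grids only. *)
Lemma jump_cvg s T e (eps : R) : 0 <= s -> s < T -> T <= T' -> 0 < e -> 0 < eps ->
  \forall n \near \oo, fine (P (jump (B := B) f s T e (2 ^ n))) < eps.
Proof.
move=> s0 sT TT e0 eps0.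
pose J n := jump (B := B) f s T e (2 ^ n).
have mJ n : measurable (J n) by exact: measurable_jump.
pose F M := \bigcup_(n in [set n | (M <= n)%N]) J n.
have mF M : measurable (F M) by exact: bigcup_measurable.
have F0 : \bigcap_M F M = set0.
  apply/seteqP; split => // w h.
  have [dl dl0 hdl] := within_unif_continuous (path_continuous (w := w) s0 TT) e0.
  have [M hM] := fine_mesh sT dl0.
  have [n /= Mn [k [kn]]] := h M I; rewrite ltNge => /negP; apply.
  have N0 : (0 < 2 ^ n)%N by rewrite expn_gt0.
  apply/ltW/hdl.
  - by rewrite (grid_ge sT N0) (grid_le sT N0).
  - by rewrite (grid_ge sT N0) (grid_le sT N0) // ltnW.
  - by rewrite grid_stepE ger0_norm ?hM // ltW // grid_step_gt0.
have := near_bigcap P mF (_ : forall n, F n.+1 `<=` F n) eps0.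
rewrite F0 measure0 /= => /(_ _) near; apply: filterS (near _); last first.
  by move=> n w [k /= nk h]; exists k => //=; exact: ltnW.
move=> n; rewrite sub0r normrN ger0_norm ?fine_ge0 //; apply: le_lt_trans.
apply: fine_le; rewrite ?fin_num_measure //; first exact: mJ.
by apply: le_measure; rewrite ?inE //; [exact: mJ|move=> w h; exists n => /=].
Qed.

End Touch.

(** * Passage to the limit *)

Section FirstPassage.
Context {d : measure_display} {Omega : measurableType d} {R : realType}.
Context {P : probability Omega R} {B : R -> {RV P >-> R}}.
Hypothesis hB : standard_brownian_motion B.
Variables (f : R -> R) (T' : R).
Hypothesis hf : {within `[0, T'], continuous f}.
Hypothesis T'0 : 0 < T'.
Variable mu : schwartz_distribution R.
Hypothesis cmu : compact (sd_supp mu).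
Hypothesis mu_supp : sd_supp mu `<=` `]f 0, +oo[.
Hypothesis hmu : forall t, 0 < t <= T' -> heat mu t (f t) = 1.

(** exp (rho |x| / t) is at most the sum of its two one-sided versions, and
kern t x rho is exp (rho x / t) up to the constant exp (- rho^2 / (2 t)). *)
Lemma kern_exp_bound (s t x rho : R) : 0 < s -> s <= t -> 0 < rho ->
  expR (rho * `|x| / t) <=
  expR (rho ^+ 2 / (2 * s)) * (kern t x rho + kern t x (- rho)).
Proof.
move=> s0 st r0; have t0 : 0 < t := lt_le_trans s0 st.
have tn0 : t != 0 by rewrite gt_eqF.
apply: (@le_trans _ _ (expR (rho ^+ 2 / (2 * t)) * (kern t x rho + kern t x (- rho)))).
  have e1 : expR (rho ^+ 2 / (2 * t)) * kern t x rho = expR (rho * x / t).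
    by rewrite /kern -expRD; congr expR; field.
  have e2 : expR (rho ^+ 2 / (2 * t)) * kern t x (- rho) = expR (rho * (- x) / t).
    by rewrite /kern -expRD; congr expR; field.
  rewrite mulrDr e1 e2; case: (lerP 0 x) => h.
    by rewrite (ger0_norm h) lerDl expR_ge0.
  by rewrite (ltr0_norm h) lerDr expR_ge0.
rewrite ler_wpM2r //; first by rewrite addr_ge0 // ltW // kern_gt0.
rewrite ler_expR ler_wpM2l ?sqr_ge0 // lef_pV2 ?posrE ?mulr_gt0 //.
by rewrite ler_pM2l.
Qed.

Lemma heat_kern_bound s : 0 < s -> exists2 C, 0 <= C & exists rho,
  forall t x, s <= t -> `|heat mu t x| <= C * (kern t x rho + kern t x (- rho)).
Proof.
move=> s0; have [M [rho [M0 r0 [_ hM]]]] := heat_bound cmu s0.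
exists (M * expR (rho ^+ 2 / (2 * s))); first by rewrite mulr_ge0 // expR_ge0.
exists rho => t x st; apply: le_trans (hM t x st) _.
by rewrite -(mulrA M); apply: ler_wpM2l => //; exact: kern_exp_bound.
Qed.

(** u equals 1 on the graph of f and is Lipschitz in x, uniformly for t >= s. *)
Lemma heat_strip s T : 0 < s -> T <= T' -> exists2 K, 0 <= K &
  forall t e x, s <= t <= T -> 0 <= e <= 1 -> f t - e <= x <= f t + e ->
    `|heat mu t x - 1| <= K * e.
Proof.
move=> s0 TT; have [X X0 hX] := within_bounded hf.
have [|K K0 hK] := heat_lip cmu s0 (_ : 1 <= X + 1); first by rewrite lerDr.
exists K => // t e x /andP[st tT] /andP[e0 e1] hx.
have t0 : 0 < t := lt_le_trans s0 st.
have tT' : t <= T' := le_trans tT TT.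
have fX : `|f t| <= X by apply: hX; rewrite (ltW t0).
have xf : `|x - f t| <= e by rewrite ler_distl.
rewrite -(hmu (t := t)) ?t0 //; apply: le_trans (hK t x (f t) st _ _) _.
- have := ler_distD 0 x (f t).
  have h : `|x| <= `|x - f t| + `|f t| by rewrite -{1}[x](subrK (f t)) ler_normD.
  lra.
- by lra.
- by rewrite ler_wpM2l.
Qed.

(** Paths that end below the boundary; those that end above it must have hit it. *)
Definition terminal T : set Omega := [set w | B T w < f T].

Lemma measurable_terminal T : measurable (terminal T).
Proof.
have m : measurable_fun setT (B T) by [].
by have := m measurableT _ (measurable_itv `]-oo, f T[); rewrite setTI.
Qed.

Lemma below_diff s T e n : 0 < s -> s < T ->
  below (B := B) f s T e (2 ^ n) (2 ^ n) 0 `\` below (B := B) f s T e (2 ^ n) 0 0 =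
  terminal T `&` grid_touch (B := B) f s T e n.
Proof.
move=> s0 sT; have N0 : (0 < 2 ^ n)%N by rewrite expn_gt0.
have EN w : below (B := B) f s T e (2 ^ n) (2 ^ n) 0 w <-> terminal T w.
  split=> [/(_ (2 ^ n)%N)|h j].
    by rewrite leqnn levelN // gridN // addr0; exact.
  by rewrite -eqn_leq => /eqP <-; rewrite levelN // gridN // addr0.
apply/seteqP; split => w [h1 h2]; split; try exact/EN.
  apply: contrapT => h; apply: h2 => j /andP[_]; rewrite leq_eqVlt => /orP[/eqP ->|jN].
    by rewrite levelN // gridN // addr0; exact/EN.
  rewrite level_lt // addr0 ltNge; apply/negP => hj; apply: h; exists j => //.
move=> h; case: h2 => k kN; rewrite leNgt => /negP; apply.
by have := h k; rewrite (ltnW kN) level_lt // addr0; exact.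
Qed.

(** The grid is refined for fixed e, which removes the jumps and increases the grid
events, and then e tends to 0, which decreases them to [touch]. *)
Lemma touch_estimate s T err : 0 < s -> s < T -> T <= T' ->
  (forall e n, 0 < e ->
    `|(\int[P]_(w in below (B := B) f s T e (2 ^ n) 0 0) heat mu s (B s w))%R| <= err) ->
  `|pairing mu (fun v => fine (P [set w | B T w + v < f T])) -
    fine (P (terminal T `&` touch (B := B) f s T))| <= err.
Proof.
move=> s0 sT TT herr.
have [C C0 [rho hC]] := heat_kern_bound s0.
have [K K0 hK] := heat_strip s0 TT.
set L := pairing mu _; set A := terminal T.
have mA : measurable A by exact: measurable_terminal.
apply/ler_addgt0Pr => eps eps0.
have eps5 : 0 < eps / 5 by rewrite divr_gt0.
pose G e n := A `&` grid_touch (B := B) f s T e n.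
have mG e n : measurable (G e n).
  by apply: measurableI => //; exact: measurable_grid_touch.
have main e n : 0 < e -> e <= 1 -> `|L - fine (P (G e n))| <=
    K * e + (1 + 2 * C) * fine (P (jump (B := B) f s T e (2 ^ n))) + err.
  move=> e0 e1; rewrite /G -below_diff //.
  apply: (grid_estimate hB s0 sT (N := 2 ^ n) _ e0 cmu C0 (eta := K * e) _ hC).
  - by rewrite expn_gt0.
  - by rewrite mulr_ge0 // ltW.
  - move=> k x kN; have N0 : (0 < 2 ^ n)%N by rewrite expn_gt0.
    by apply: hK; rewrite ?(ltW e0) // (grid_ge sT N0) (grid_le sT N0) // ltnW.
  - exact: herr.
pose F m := A `&` \bigcup_n grid_touch (B := B) f s T m.+1%:R^-1 n.
have mF m : measurable (F m).
  apply: measurableI => //; apply: bigcupT_measurable => n.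
  exact: measurable_grid_touch.
have FE : \bigcap_m F m = A `&` touch (B := B) f s T.
  rewrite (touchE hB hf (ltW s0) sT TT); apply/seteqP; split => w.
    by move=> h; split; [have [] := h 0%N I|move=> m _; have [] := h m I].
  by move=> [h1 h2] m _; split => //; exact: h2.
have Fdec m : F m.+1 `<=` F m.
  apply: setIS; apply: subset_bigcup => n _ w [k kn h]; exists k => //.
  apply: le_trans h; rewrite lerD2l lerN2 lef_pV2 ?posrE // ler_nat //.
have near1 := near_bigcap P mF Fdec eps5.
have near2 : \forall m \near \oo, K * m.+1%:R^-1 < eps / 5.
  near=> m.
  rewrite mulrC ltr_pdivrMl // mulrC -ltr_pdivrMl //.
  apply: (@lt_trans _ _ m%:R); last by rewrite ltr_nat.
  near: m; exact: nbhs_infty_gtr.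
have [m [h1 h2]] := filter_ex (filterI near1 near2).
pose e := m.+1%:R^-1 : R.
have e0 : 0 < e by rewrite invr_gt0.
have e1 : e <= 1 by rewrite invf_le1 // ler1n.
have near3 : \forall n \near \oo, `|fine (P (F m)) - fine (P (G e n))| < eps / 5.
  rewrite /F setI_bigcupr; apply: near_bigcup => // n.
    exact: mG.
  by apply: setIS; exact: grid_touchS.
have C1 : 0 < 1 + 2 * C by lra.
have near4 := jump_cvg hB hf (ltW s0) sT TT e0 (divr_gt0 eps5 C1).
have [n [h3 h4]] := filter_ex (filterI near3 near4).
have h5 := main e n e0 e1.
rewrite FE in h1; rewrite ltr_pdivlMr // mulrC in h4.
rewrite /G in h3; have hFG := ler_distD (fine (P (F m))) (fine (P (A `&` touch (B := B) f s T)))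
  (fine (P (G e n))).
have := ler_distD (fine (P (G e n))) L (fine (P (A `&` touch (B := B) f s T))).
rewrite (distrC (fine (P (G e n))) (fine (P (A `&` _)))).
move: h2 h5 h4 hFG h1 h3; rewrite -/e -/(G e n); lra.
Unshelve. all: by end_near. Qed.

(** At a small time s, f s is still at a distance from the support of mu, so
[heat_decay] bounds u below the boundary by a multiple of s times a likelihood
ratio, whose expectation is at most 1. *)
Lemma initial_error : exists s1 K, [/\ 0 < s1, 0 <= K & forall s T e n,
  0 < s -> s <= s1 -> s < T -> 0 < e ->
  `|(\int[P]_(w in below (B := B) f s T e (2 ^ n) 0 0) heat mu s (B s w))%R| <= K * s].
Proof.
have [a [b [fa ab muab]]] := compact_sub_ray cmu mu_supp.
pose c := (a - f 0) / 2.
have c0 : 0 < c by rewrite divr_gt0 // subr_gt0.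
have [K K0 hK] := heat_decay cmu muab c0.
have [dl dl0 hdl] := within_unif_continuous hf c0.
exists (Num.min 1 (Num.min T' (dl / 2))), K; split => //.
  by rewrite !lt_min ltr01 T'0 divr_gt0.
move=> s T e n s0; rewrite !le_min => /and3P[s1 sT' sdl] sT e0.
have N0 : (0 < 2 ^ n)%N by rewrite expn_gt0.
have fs : f s <= a - c.
  have : `|f s - f 0| < c.
    apply: hdl; rewrite ?lexx ?(ltW s0) ?(ltW T'0) //.
    by rewrite subr0 gtr0_norm //; lra.
  by rewrite ltr_norml /c => /andP[_]; lra.
have mb : measurable (below (B := B) f s T e (2 ^ n) 0 0) by exact: measurable_below.
have mI := measurable_itv `]-oo, level f s T e (2 ^ n) 0[.
have [_ iq _] := cell_pairing hB f e s0 sT N0 cmu N0 mI.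
rewrite -below0 // grid0 in iq.
have ik := kern_integrable hB (a - c / 2) s0 mb.
apply: (@le_trans _ _ (\int[P]_(w in below (B := B) f s T e (2 ^ n) 0 0)
    (K * s * kern s (B s w) (a - c / 2)))%R).
  apply: Rintegral_bound => //.
    by have := integrableZl mb (K * s) ik; apply: eq_integrable.
  move=> w hw; apply: hK => //; apply: le_trans fs.
  have := hw 0%N isT; rewrite grid0 addr0 => /ltW /le_trans; apply.
  by have := level_le f s T (2 ^ n) e0 0; rewrite grid0.
rewrite RintegralZl // ler_piMr ?mulr_ge0 ?(ltW s0) //.
have -> : (\int[P]_(w in below (B := B) f s T e (2 ^ n) 0 0) kern s (B s w) (a - c / 2))%R =
    fine (P (below (B := B) f s T e (2 ^ n) 0 (a - c / 2))).
  rewrite !below0 // /Rintegral -[X in kern X]/s.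
  by have := cell_shift hB f e s0 sT N0 (a - c / 2) N0 mI; rewrite grid0 => ->.
rewrite -[leRHS]/(fine 1%E); apply: fine_le => //.
  by apply: fin_num_measure; exact: measurable_below.
by apply: probability_le1; exact: measurable_below.
Qed.

Definition touch_pos T : set Omega :=
  [set w | exists2 t, 0 < t <= T & f t <= B t w].

(** Intervals starting at T / (m + 2), which exhaust the half-open one and stay
shorter than it. *)
Lemma touch_posE T : 0 < T ->
  touch_pos T = \bigcup_m touch (B := B) f (T / m.+2%:R) T.
Proof.
move=> T0; apply/seteqP; split => w.
  move=> [t /andP[t0 tT] h].
  have [m hm] : exists m : nat, m.+1%:R^-1 < t / T.
    have /ltr_add_invr[m] : 0 < t / T by rewrite divr_gt0.
    by rewrite add0r; exists m.
  exists m => //; exists t => //; rewrite tT andbT.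
  rewrite mulrC -ler_pdivlMr //; apply: le_trans (ltW hm).
  by rewrite lef_pV2 ?posrE // ler_nat.
move=> [m _ [t /andP[st tT] h]]; exists t => //; rewrite tT andbT.
by apply: lt_le_trans st; rewrite divr_gt0.
Qed.

Lemma itv_step (T : R) (m : nat) : 0 < T -> 0 < T / m.+2%:R < T.
Proof.
by move=> T0; rewrite divr_gt0 //= ltr_pdivrMr // ltr_pMr // ltr1n.
Qed.

Lemma measurable_touch_pos T : 0 < T <= T' -> measurable (touch_pos T).
Proof.
move=> /andP[T0 TT]; rewrite touch_posE //; apply: bigcupT_measurable => m.
have /andP[h1 h2] := itv_step m T0.
by apply: (measurable_touch hB hf (ltW h1) h2 TT).
Qed.

(** [touch_estimate] with the error of [initial_error], as s tends to 0. *)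
Lemma touch_prob T : 0 < T <= T' ->
  pairing mu (fun v => fine (P [set w | B T w + v < f T])) =
  fine (P (terminal T `&` touch_pos T)).
Proof.
move=> /andP[T0 TT]; have [s1 [K [s10 K0 hK]]] := initial_error.
set L := pairing mu _; apply/eqP; rewrite -subr_eq0 -normr_le0.
apply/ler_addgt0Pr => eps eps0; rewrite add0r.
have eps2 : 0 < eps / 2 by rewrite divr_gt0.
have mA : measurable (terminal T) by exact: measurable_terminal.
pose F m := terminal T `&` touch (B := B) f (T / m.+2%:R) T.
have mF m : measurable (F m).
  have /andP[h1 h2] := itv_step m T0.
  by apply: measurableI => //; apply: (measurable_touch hB hf (ltW h1) h2 TT).
have Finc m : F m `<=` F m.+1.
  apply: setIS => w [t /andP[st tT] h]; exists t => //; rewrite tT andbT.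
  by apply: le_trans st; rewrite ler_pM2l // lef_pV2 ?posrE // ler_nat.
have near1 := near_bigcup P mF Finc eps2.
have near2 : \forall m \near \oo, T / m.+2%:R <= s1 /\ K * (T / m.+2%:R) < eps / 2.
  near=> m.
  have hm : (T / s1 + K * T / (eps / 2)) < m.+2%:R.
    apply: (@lt_trans _ _ m%:R); last by rewrite ltr_nat.
    near: m; exact: nbhs_infty_gtr.
  have a0 : 0 <= T / s1 by rewrite divr_ge0 // ltW.
  have b0 : 0 <= K * T / (eps / 2) by rewrite divr_ge0 ?mulr_ge0 // ltW.
  split.
    rewrite ler_pdivrMr // mulrC -ler_pdivrMr //; lra.
  have h : K * T / (eps / 2) < m.+2%:R by lra.
  by rewrite mulrA ltr_pdivrMr // -ltr_pdivrMl // mulrC.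
have [m [h1 [h2 h3]]] := filter_ex (filterI near1 near2).
have /andP[s0 sT] := itv_step m T0.
have h4 := touch_estimate s0 sT TT (fun e n e0 => hK _ T e n s0 h2 sT e0).
rewrite touch_posE // setI_bigcupr.
apply: le_trans (ler_distD (fine (P (F m))) _ _) _.
rewrite [X in _ + X]distrC; have := lerD (ltW (le_lt_trans h4 h3)) (ltW h1).
by rewrite -splitr.
Unshelve. all: by end_near. Qed.

End FirstPassage.

(** * The normal distribution function *)

Section NormalDistribution.
Context {R : realType}.
Local Notation leb := (@lebesgue_measure R).
Implicit Types (x y z s : R).

(** The derivative N' of the distribution function. *)
Definition gauss_density z : R := (Num.sqrt (2 * pi))^-1 * expR (- (z ^+ 2) / 2).

Lemma smooth_gauss_density : smooth gauss_density.
Proof.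
have sq := smooth_mul (@smooth_affine R (- 2^-1) 0) (@smooth_affine R 1 0).
have -> : gauss_density = (Num.sqrt (2 * pi))^-1 \*o
    (expR \o ((fun z => - 2^-1 * z + 0) \* (fun z => 1 * z + 0))).
  apply/funext => z /=; rewrite /gauss_density; congr (_ * expR _).
  by rewrite expr2; field.
exact: (@smooth_scale R _ _ (smooth_comp sq (@smooth_expR R))).
Qed.

Lemma normal_pdf_density s z : 0 < s -> normal_pdf 0 s z = gauss_density (z / s) / s.
Proof.
move=> s0; have sn0 : s != 0 by rewrite gt_eqF.
rewrite normal_pdfE // /normal_peak /normal_fun /gauss_density subr0.
have -> : s ^+ 2 * pi *+ 2 = (2 * pi) * s ^+ 2 by rewrite -mulr_natl; ring.
rewrite sqrtrM ?mulr_ge0 ?pi_ge0 // sqrtr_sqr gtr0_norm // invfM.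
rewrite -!mulrA; congr (_ * _); rewrite mulrC; congr (expR _ * _).
by rewrite -mulr_natl; field.
Qed.

Lemma gauss_density_pdf : gauss_density = normal_pdf 0 1.
Proof. by apply/funext => z; rewrite normal_pdf_density // !divr1. Qed.

Lemma integrable_gauss_density (A : set R) : measurable A ->
  leb.-integrable A (EFin \o gauss_density).
Proof.
move=> mA; rewrite gauss_density_pdf; apply: (@integrableS _ _ _ _ setT) => //.
exact: integrable_normal_pdf.
Qed.

Lemma normal_cdfE x : normal_cdf x = (\int[leb]_(t in `]-oo, x]) gauss_density t)%R.
Proof.
rewrite /normal_cdf /gauss_density RintegralZl //.
have mD : measurable (`]-oo, x]%classic : set R) by exact: measurable_itv.
have ig := integrable_gauss_density mD.
have := @integrableZl _ _ _ leb _ mD (Num.sqrt (2 * pi)) _ ig.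
apply: eq_integrable => // z _ /=; rewrite /gauss_density -EFinM mulVKf //.
by rewrite gt_eqF // sqrtr_gt0 mulr_gt0 ?pi_gt0.
Qed.

Lemma normal_cdf_prob x : (normal_cdf x)%:E = normal_prob 0 1 `]-oo, x].
Proof.
rewrite normal_cdfE gauss_density_pdf /normal_prob /Rintegral fineK //.
exact: integrable_fin_num (integrableS measurableT _ _ (integrable_normal_pdf 0 1)).
Qed.

Lemma is_derive_normal_cdf x : is_derive x 1 normal_cdf (gauss_density x).
Proof.
have -> : normal_cdf = (fun x => \int[leb]_(t in `]-oo, x]) gauss_density t)%R.
  by apply/funext => y; exact: normal_cdfE.
have x1 : x < x + 1 by rewrite ltrDl.
have [||h1 h2] := @continuous_FTC1 _ gauss_density -oo%O x (x + 1) x1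
  (integrable_gauss_density (measurable_itv _)).
- exact: ltNyr.
- exact: smooth_continuous smooth_gauss_density x.
- by rewrite derive1E in h2; exact: DeriveDef h1 h2.
Qed.

Lemma derive1_normal_cdf : derive1 normal_cdf = gauss_density.
Proof. by apply/funext => x; exact/derive1_val/is_derive_normal_cdf. Qed.

Lemma smooth_normal_cdf : smooth (@normal_cdf R).
Proof. exact: smooth_is_derive is_derive_normal_cdf smooth_gauss_density. Qed.

(** Substitution of x / s for x. *)
Lemma normal_prob_itvNy s y : 0 < s ->
  normal_prob 0 s `]-oo, y] = (normal_cdf (y / s))%:E.
Proof.
move=> s0; rewrite normal_cdf_prob /normal_prob -gauss_density_pdf.
pose F x := x / s; rewrite -/(F y).
have dF x : is_derive x 1 F s^-1.
  rewrite /F (_ : (fun x => _) = s^-1 \*: id); last by apply/funext => z /=; rewrite mulrC.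
  by apply: is_derive_eq; rewrite /GRing.scale /= mulr1.
have F1 : F^`() = cst s^-1 by apply/funext => x; exact/derive1_val.
rewrite (@increasing_ge0_integration_by_substitutionNy _ F) ?F1.
- by apply: eq_integral => x _ /=; rewrite normal_pdf_density.
- by move=> a b _ _ ab; rewrite ltr_pM2r // invr_gt0.
- by move=> x _; exact: cst_continuous.
- exact: is_cvg_cst.
- exact: cvg_cst.
- split=> [x _|]; first by have [] := dF x.
  have cF : continuous F.
    by move=> x; apply/differentiable_continuous/derivable1_diffP; have [] := dF x.
  exact: cvg_within_filter (cF y).
- by apply: gt0_cvgMlNy => //; rewrite invr_gt0.
- by apply: continuous_subspaceT => x; exact: smooth_continuous smooth_gauss_density x.
- by move=> x _; rewrite mulr_ge0 ?invr_ge0 ?expR_ge0.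
Qed.

Lemma normal_prob_itvNyo s y : 0 < s ->
  normal_prob 0 s `]-oo, y[ = (normal_cdf (y / s))%:E.
Proof.
move=> s0; rewrite -normal_prob_itvNy // /normal_prob integral_itv_bndo_bndc //.
by apply/measurable_EFinP; apply: measurable_funTS; exact: measurable_normal_pdf.
Qed.

Lemma normal_prob_set1 s y : normal_prob 0 s [set y] = 0%E.
Proof.
by apply: (integral_Sset1 (A := [set y])) => x ->.
Qed.

(** The density is even, so that N (- z) is the mass of the ray to the right of z. *)
Lemma normal_cdfN z : normal_cdf (- z) = 1 - normal_cdf z.
Proof.
have h : (normal_cdf (- z))%:E = normal_prob 0 1 `[z, +oo[.
  rewrite normal_cdf_prob /normal_prob -gauss_density_pdf.
  rewrite ge0_integration_by_substitutionNy.
  - by apply: eq_integral => x _ /=; rewrite /gauss_density sqrrN.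
  - by apply: continuous_subspaceT => x; exact: smooth_continuous smooth_gauss_density x.
  - by move=> x _; rewrite mulr_ge0 ?invr_ge0 ?expR_ge0.
pose Q : probability (measurableTypeR R) R := normal_prob 0 1.
have h1 : Q `]-oo, z]%classic = Q `]-oo, z[%classic.
  by rewrite /Q /= /normal_prob integral_itv_bndo_bndc //;
    apply/measurable_EFinP; apply: measurable_funTS; exact: measurable_normal_pdf.
have h2 : Q `[z, +oo[%classic = (1 - Q `]-oo, z[%classic)%E.
  by rewrite -probability_setC // setCitvl.
have h3 : (normal_cdf z)%:E = Q `]-oo, z]%classic := normal_cdf_prob z.
by apply: EFin_inj; rewrite h EFinB h3 h1; exact: h2.
Qed.

End NormalDistribution.

(** * The hitting probability *)

Section HittingProbability.
Context {d : measure_display} {Omega : measurableType d} {R : realType}.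
Context {P : probability Omega R} {B : R -> {RV P >-> R}}.
Hypothesis hB : standard_brownian_motion B.
Variables (f : R -> R) (T' : R).
Hypothesis hf : {within `[0, T'], continuous f}.
Hypothesis f0 : 0 < f 0.
Implicit Types (T t c v : R).

Lemma bm_shift_cdf T c v : 0 < T ->
  fine (P [set w | B T w + v < c]) = normal_cdf ((c - v) / Num.sqrt T).
Proof.
move=> T0; rewrite (_ : [set w | _] = B T @^-1` `]-oo, c - v[).
  by rewrite (bm_law hB) // normal_prob_itvNyo // sqrtr_gt0.
by apply/seteqP; split => w /=; rewrite in_itv /= ltrBrDr.
Qed.

Lemma terminal_cdf T : 0 < T -> P (terminal (B := B) f T) = (normal_cdf (f T / Num.sqrt T))%:E.
Proof.
move=> T0; rewrite (_ : terminal _ _ = B T @^-1` `]-oo, f T[).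
  by rewrite (bm_law hB) // normal_prob_itvNyo // sqrtr_gt0.
by apply/seteqP; split => w /=; rewrite in_itv.
Qed.

Lemma terminal_eq0 T c : 0 < T -> P [set w | B T w = c] = 0%E.
Proof.
move=> T0; rewrite (_ : [set w | _] = B T @^-1` [set c]) //.
by rewrite (bm_law hB) // normal_prob_set1.
Qed.

Definition hit_before T : set Omega := [set w | (hitting_time B f T' w < T%:E)%E].

Lemma hit_beforeP T w : T <= T' ->
  hit_before T w <-> exists2 t, 0 <= t < T & B t w = f t.
Proof.
move=> TT; split.
  move=> /ereal_inf_lt[_ [t /= [/andP[t0 _] ft] <-]]; rewrite lte_fin => tT.
  by exists t => //; rewrite t0.
move=> [t /andP[t0 tT] ft].
apply: (@le_lt_trans _ _ t%:E); last by rewrite lte_fin.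
by apply: ereal_inf_lbound; exists t => //=; rewrite t0 (lt_le_trans tT).
Qed.

(** The path starts below the boundary, since B_0 = 0 < f 0. *)
Lemma crossing w t : 0 <= t <= T' -> f t <= B t w ->
  exists2 u, 0 <= u <= t & B u w = f u.
Proof.
move=> /andP[t0 tT] ht.
have := IVT t0 (path_continuous hB hf (lexx 0) tT (w := w)) (v := 0).
rewrite (bm_start hB) sub0r => /(_ _)[|u].
  rewrite ge_min le_max oppr_le0 (ltW f0) /= subr_ge0 ht orbT //.
by rewrite in_itv /= => hu /eqP; rewrite subr_eq0 => /eqP; exists u.
Qed.

(** Being on or above the boundary at some positive time amounts to meeting it, by
[crossing]. The time 0 is not a meeting time. *)
Lemma touch_posP T w : T <= T' -> touch_pos (B := B) f T w <->
  exists2 u, 0 <= u <= T & B u w = f u.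
Proof.
move=> TT; split=> [[t /andP[t0 tT] ht]|[u /andP[u0 uT] hu]].
  have [|u /andP[u0 ut] hu] := crossing (t := t) _ ht.
    by rewrite ltW //= (le_trans tT).
  by exists u => //; rewrite u0 (le_trans ut).
exists u; last by rewrite hu.
rewrite uT andbT lt_def u0 andbT; apply/eqP => u00; move: hu.
by rewrite u00 (bm_start hB) => h; move: f0; rewrite -h ltxx.
Qed.

(** A hit before T happens before T - T / (m + 2) for some m, and hits up to such a
time are touches. *)
Lemma measurable_hit_before T : 0 < T <= T' -> measurable (hit_before T).
Proof.
move=> /andP[T0 TT].
pose S m := T - T / m.+2%:R.
have S0 m : 0 < S m < T.
  by have := itv_step m T0; rewrite /S subr_gt0 gtrBl => /andP[-> ->].
rewrite (_ : hit_before T = \bigcup_m touch_pos (B := B) f (S m)).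
  apply: bigcupT_measurable => m; apply: (measurable_touch_pos hB hf (T := S m)).
  by have /andP[-> h] := S0 m; exact: le_trans (ltW h) TT.
apply/seteqP; split => w.
  move=> /(hit_beforeP _ TT)[t /andP[t0 tT] ft].
  have [m hm] : exists m : nat, m.+1%:R^-1 < (T - t) / T.
    have /ltr_add_invr[m] : 0 < (T - t) / T by rewrite divr_gt0 // subr_gt0.
    by rewrite add0r; exists m.
  exists m => //; apply/touch_posP.
    by have /andP[_ h] := S0 m; exact: le_trans (ltW h) TT.
  exists t => //; rewrite t0 /S lerBrDr -lerBrDl mulrC -ler_pdivlMr //.
  by apply: le_trans (ltW hm); rewrite lef_pV2 ?posrE // ler_nat.
move=> [m _ /touch_posP]; have /andP[_ h] := S0 m.
move=> /(_ (le_trans (ltW h) TT))[u /andP[u0 uS] hu]; apply/hit_beforeP => //.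
by exists u => //; rewrite u0 (le_lt_trans uS).
Qed.

Lemma hit_before_terminal T : 0 < T <= T' ->
  hit_before T `&` terminal (B := B) f T = terminal (B := B) f T `&` touch_pos (B := B) f T.
Proof.
move=> /andP[T0 TT]; apply/seteqP; split => w.
  move=> [/(hit_beforeP _ TT)[t /andP[t0 tT] ft] h]; split => //.
  by apply/touch_posP => //; exists t => //; rewrite t0 ltW.
move=> [h /(touch_posP _ TT)[u /andP[u0 uT] hu]]; split => //.
apply/hit_beforeP => //; exists u => //; rewrite u0 lt_neqAle uT andbT.
by apply/eqP => uTE; move: h; rewrite /terminal /= -uTE hu ltxx.
Qed.

(** A path above f T at time T has crossed, and B_T = f T has probability 0. *)
Lemma hit_before_above T : 0 < T <= T' ->
  P (hit_before T `\` terminal (B := B) f T) = (normal_cdf (- f T / Num.sqrt T))%:E.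
Proof.
move=> /andP[T0 TT].
have mt := @measurable_terminal _ _ _ P B f T.
have -> : normal_cdf (- f T / Num.sqrt T) = 1 - normal_cdf (f T / Num.sqrt T).
  by rewrite mulNr normal_cdfN.
rewrite EFinB -terminal_cdf // -probability_setC //.
have mH : measurable (hit_before T) by apply: measurable_hit_before; rewrite T0.
have mE : measurable [set w | B T w = f T].
  have m : measurable_fun setT (B T) by [].
  by have := m measurableT _ (measurable_set1 (f T)); rewrite setTI.
apply/eqP; rewrite eq_le; apply/andP; split.
  apply: le_measure; rewrite ?inE; [exact: measurableD|exact: measurableC|].
  by move=> w [].
rewrite -[leRHS]adde0 -(terminal_eq0 (f T) T0).
apply: le_trans (measureU2 _ _ mE); last exact: measurableD.
apply: le_measure; rewrite ?inE; [exact: measurableC| |].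
  by apply: measurableU => //; exact: measurableD.
move=> w h; have {h}h : ~ terminal (B := B) f T w by [].
have [e|ne] := eqVneq (B T w) (f T); [by right|left; split => //].
have fB : f T <= B T w by rewrite leNgt; apply/negP.
have [|u /andP[u0 uT] hu] := crossing _ fB; first by rewrite ltW.
apply/hit_beforeP => //; exists u => //; rewrite u0 lt_neqAle uT andbT.
by apply/eqP => uTE; move: ne; rewrite -uTE hu eqxx.
Qed.

Lemma hit_before_prob T : 0 < T <= T' ->
  P (hit_before T) = (normal_cdf (- f T / Num.sqrt T) +
    fine (P (terminal (B := B) f T `&` touch_pos (B := B) f T)))%:E.
Proof.
move=> hT; have mt := @measurable_terminal _ _ _ P B f T.
have mH := measurable_hit_before hT.
have -> : P (hit_before T) = (P (hit_before T `\` terminal (B := B) f T) +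
    P (hit_before T `&` terminal (B := B) f T))%E := measureDI P mH mt.
rewrite hit_before_above // hit_before_terminal //.
rewrite EFinD fineK // fin_num_measure //; apply: measurableI => //.
exact: measurable_touch_pos.
Qed.

End HittingProbability.

(** * Derivatives within a set *)

Section WithinDerivative.
Context {R : realType}.
Implicit Types (g h A : R -> R) (D : set R) (x l : R).

Lemma is_derive_withinW D g x l : is_derive x 1 g l -> is_derive_within D g x l.
Proof.
move=> [dg <-]; apply/cvgrPdist_le => e e0.
have /cvgrPdist_le/(_ e e0) : k^-1 *: (g (k *: 1 + x) - g x) @[k --> 0^'] --> 'D_1 g x.
  exact: dg.
move=> /nbhs_ballP[dl /= dl0 hdl]; apply: cvg_within; apply/nbhs_ballP.
exists dl => // y xy yx.
have := hdl (y - x); rewrite /ball /= sub0r normrN distrC => /(_ _ _).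
rewrite subr_eq0 => /(_ xy yx); rewrite /GRing.scale /= mulr1 subrK mulrC.
by [].
Qed.

Lemma near_within_neq D x : \forall y \near within D x^', y != x.
Proof. by apply: cvg_within; rewrite /dnbhs /within /=; exact: nearW. Qed.

Lemma is_derive_within_cvg D g x l : is_derive_within D g x l ->
  g y @[y --> within D x^'] --> g x.
Proof.
move=> hg.
have hy : y - x @[y --> within D x^'] --> x - x.
  apply: cvgB; last exact: cvg_cst.
  apply: cvg_within_filter; apply: cvg_within_filter; exact: cvg_id.
have FF : Filter (within D x^') by exact: within_filter.
have h := cvgD (cvgM hg hy) (cvg_cst (g x)).
move: (h FF FF FF); rewrite subrr mulr0 add0r; apply: cvg_trans; apply: near_eq_cvg.
apply: filterS (near_within_neq D x) => y yx /=.
rewrite [LHS](_ : _ = (g y - g x) / (y - x) * (y - x) + g x) //.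
by rewrite divfK ?subr_eq0 // subrK.
Qed.

Lemma is_derive_withinM D g h x lg lh :
  is_derive_within D g x lg -> is_derive_within D h x lh ->
  is_derive_within D (g \* h) x (lg * h x + g x * lh).
Proof.
move=> hg hh; rewrite /is_derive_within.
have FF : Filter (within D x^') by exact: within_filter.
have H := cvgD (cvgM hg (is_derive_within_cvg hh)) (cvgM (cvg_cst (g x)) hh).
move: (H FF FF FF FF); apply: cvg_trans; apply: near_eq_cvg; apply: nearW => y /=.
rewrite [LHS](_ : _ = (g y - g x) / (y - x) * h y + g x * ((h y - h x) / (y - x))) //.
by rewrite mulrAC mulrA -mulrDl; congr (_ / _); ring.
Qed.

Lemma is_derive_withinD D g h x lg lh :
  is_derive_within D g x lg -> is_derive_within D h x lh ->
  is_derive_within D (g \+ h) x (lg + lh).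
Proof.
move=> hg hh; have FF : Filter (within D x^') by exact: within_filter.
have H := cvgD hg hh; move: (H FF); apply: cvg_trans; apply: near_eq_cvg; apply: nearW => y /=.
rewrite [LHS](_ : _ = (g y - g x) / (y - x) + (h y - h x) / (y - x)) //.
by rewrite -mulrDl; congr (_ / _); ring.
Qed.

(** By the mean value theorem the quotient of the composition is that of g times
A' at an intermediate point, which tends to g x. *)
Lemma is_derive_within_comp D A g x l : smooth A ->
  is_derive_within D g x l -> is_derive_within D (A \o g) x (A^`() (g x) * l).
Proof.
move=> sA hg; have gx := is_derive_within_cvg hg.
have /choice[c hc] : forall y, exists c, `|g x - c| <= `|g x - g y| /\
    A (g y) - A (g x) = A^`() c * (g y - g x).
  move=> y; have [c [c1 c2 cE]] := MVT_smooth (g x) (g y) sA; exists c; split => //.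
  move: c1 c2; rewrite ge_min le_max => /orP[] h1 /orP[] h2;
  by case: (ger0P (g x - c)) => ?; case: (ger0P (g x - g y)) => ?; lra.
have cc : c y @[y --> within D x^'] --> g x.
  apply/cvgrPdist_le => e e0; have /cvgrPdist_le/(_ e e0) := gx.
  by apply: filterS => y; apply: le_trans; have [] := hc y.
have cA : A^`() (c y) @[y --> within D x^'] --> A^`() (g x).
  by apply: continuous_cvg cc; exact/smooth_continuous/smooth_derive1.
have FF : Filter (within D x^') by exact: within_filter.
have H := cvgM cA hg; move: (H FF); apply: cvg_trans; apply: near_eq_cvg; apply: nearW => y /=.
by have [_ ->] := hc y; rewrite mulrA.
Qed.

Lemma is_derive_within_local D g h x l : D x -> (\forall y \near x, D y -> g y = h y) ->
  is_derive_within D g x l -> is_derive_within D h x l.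
Proof.
move=> Dx gh; have ghx : g x = h x by exact: (nbhs_singleton gh).
apply: cvg_trans; apply: near_eq_cvg.
rewrite /prop_near1 /nbhs /= /within /=; apply: nbhs_dnbhs.
by apply: filterS gh => y E Dy; rewrite E // ghx.
Qed.

End WithinDerivative.

(** * Derivative of the formula in T *)

Section FinalFormulas.
Context {R : realType} (mu : schwartz_distribution R).
Hypothesis cmu : compact (sd_supp mu).
Implicit Types (T c v z : R).

(** Translating the normal density by v multiplies it by the likelihood ratio. *)
Lemma gauss_density_kern T c v : 0 < T ->
  gauss_density ((c - v) / Num.sqrt T) = gauss_density (c / Num.sqrt T) * kern T c v.
Proof.
move=> T0; have Tn0 : T != 0 by rewrite gt_eqF.
rewrite /gauss_density /kern -[RHS]mulrA -expRD; congr (_ * expR _).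
by rewrite !expr_div_n sqr_sqrtr ?ltW //; field.
Qed.

Lemma is_derive_sqrtV T : 0 < T ->
  is_derive T 1 (fun S => (Num.sqrt S)^-1) (- (2 * T `^ (3 / 2))^-1).
Proof.
move=> T0; have s0 : 0 < Num.sqrt T by rewrite sqrtr_gt0.
have sn0 : Num.sqrt T != 0 by rewrite gt_eqF.
apply: (is_derive_eq (is_deriveV sn0 (is_derive1_sqrt T0))).
have -> : T `^ (3 / 2) = T * Num.sqrt T.
  have -> : 3 / 2 = 1 + 2^-1 :> R by lra.
  by rewrite powRD ?(gt_eqF T0) ?implybT // powRr1 ?ltW // powR12_sqrt // ltW.
rewrite -[X in 2 * (X * _)](sqr_sqrtr (ltW T0)) /GRing.scale /=.
by field.
Qed.

(** Let be S = f S / sqrt S. The term N (- be S) contributes - be' N' (be T), and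
differentiating inside the pairing contributes be' times the pairing of
N' ((f T - v) / sqrt T), which is N' (be T) by [gauss_density_kern]. *)
Lemma pairing_cdf_derivative (D : set R) (f : R -> R) T l : 0 < T ->
  heat mu T (f T) = 1 -> is_derive_within D f T l ->
  is_derive_within D (fun S => normal_cdf (- f S / Num.sqrt S) +
    pairing mu (fun v => normal_cdf ((f S - v) / Num.sqrt S))) T
    ((2 * T `^ (3 / 2))^-1 *
     pairing mu (fun v => v * derive1 normal_cdf ((f T - v) / Num.sqrt T))).
Proof.
move=> T0 qT hf.
pose al S : R := - (Num.sqrt S)^-1; pose be : R -> R := f \* (fun S => (Num.sqrt S)^-1).
set da := (2 * _)^-1.
have hV := is_derive_sqrtV T0.
have hal : is_derive_within D al T da.
  by have := is_derive_withinW D (is_deriveN hV); rewrite opprK.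
have [db hbe] : exists db, is_derive_within D be T db.
  by eexists; exact: is_derive_withinM hf (is_derive_withinW D hV).
have wE S v : (f S - v) / Num.sqrt S = al S * v + be S.
  by rewrite /be /al /= mulrBl addrC mulNr [v * _]mulrC.
have s1 : smooth (fun=> 1 : R) by exact: smooth_cst.
pose A0 : R -> R := (fun=> 1) \- normal_cdf.
have sA0 : smooth A0 by exact: smooth_sub s1 smooth_normal_cdf.
have dA0 z : A0^`() z = - gauss_density z.
  by rewrite /A0 (derive1_sub_smooth s1 smooth_normal_cdf) /= derive1_cst derive1_normal_cdf sub0r.
have pE : pairing mu (fun v => normal_cdf^`() (al T * v + be T)) = gauss_density (be T).
  rewrite derive1_normal_cdf (_ : (fun v => _) = gauss_density (be T) \*o kern T (f T)).
    rewrite (pairing_scale cmu); last by apply: smooth_kern; rewrite gt_eqF.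
    by rewrite -/(heat mu T (f T)) qT mulr1.
  by apply/funext => v /=; rewrite -wE gauss_density_kern.
have h := is_derive_withinD (is_derive_within_comp sA0 hbe)
  (pairing_path cmu smooth_normal_cdf hal hbe).
rewrite pE dA0 mulNr [db * _]mulrC addrCA addNr addr0 in h.
have -> : (fun v => v * normal_cdf^`() ((f T - v) / Num.sqrt T)) =
    (fun v => v * normal_cdf^`() (al T * v + be T)).
  by apply/funext => v; rewrite wE.
have -> : (fun S => normal_cdf (- f S / Num.sqrt S) +
      pairing mu (fun v => normal_cdf ((f S - v) / Num.sqrt S))) =
    (A0 \o be) \+ (fun S => pairing mu (fun v => normal_cdf (al S * v + be S))).
  apply/funext => S /=; congr (_ + pairing mu _).
    by rewrite /A0 /= -normal_cdfN mulNr.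
  by apply/funext => v; rewrite wE.
exact: h.
Qed.

End FinalFormulas.

(** * First passage through f *)

Theorem theorem6p2 (R : realType) (d : measure_display)
    (Omega : measurableType d) (P : probability Omega R)
    (B : R -> {RV P >-> R}) (hB : standard_brownian_motion B)
    (T' : R) (hT' : 0 < T')
    (f : R -> R) (hf : {within `[0, T'], continuous f}) (hf0 : 0 < f 0)
    (mu : schwartz_distribution R) (hmu_compact : compact (sd_supp mu))
    (hmu_supp : sd_supp mu `<=` `]f 0, +oo[)
    (hmu : forall t : R, 0 < t <= T' ->
       pairing mu (fun v => expR ((2 * f t * v - v ^+ 2) / (2 * t))) = 1) :
  (forall T : R, 0 < T <= T' ->
     P [set w | (hitting_time B f T' w < T%:E)%E] =
     (normal_cdf (- f T / Num.sqrt T)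
      + pairing mu (fun v => normal_cdf ((f T - v) / Num.sqrt T)))%:E) /\
  (forall I : set R,
     (exists U : set R, open U /\ I = U `&` `[0, T']) ->
     C1_on `[0, T'] I f ->
     forall T : R, I T -> 0 < T ->
     is_derive_within `[0, T']
       (fun S => fine (P [set w | (hitting_time B f T' w < S%:E)%E])) T
       ((2 * T `^ (3 / 2))^-1
        * pairing mu (fun v => v * derive1 normal_cdf ((f T - v) / Num.sqrt T)))).
Proof.
have hq t : 0 < t <= T' -> heat mu t (f t) = 1 by exact: hmu.
have prob T : 0 < T <= T' -> P [set w | (hitting_time B f T' w < T%:E)%E] =
    (normal_cdf (- f T / Num.sqrt T) +
     pairing mu (fun v => normal_cdf ((f T - v) / Num.sqrt T)))%:E.
  move=> hT; have /andP[T0 _] := hT.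
  rewrite -[LHS]/(P (hit_before (B := B) f T' T)) (hit_before_prob hB hf hf0 hT).
  rewrite -(touch_prob hB hf hT' hmu_compact hmu_supp hq hT).
  congr (_ + pairing mu _)%:E; apply/funext => v; exact: (bm_shift_cdf hB).
split=> // _ [U [_ ->]] [f' [_ hf']] T [UT DT] T0.
have TT : T <= T' by move: DT; rewrite /= in_itv /= => /andP[].
have hfT : is_derive_within `[0, T'] f T (f' T) by exact: hf'.
have hT : 0 < T <= T' by rewrite T0.
apply: is_derive_within_local (pairing_cdf_derivative hmu_compact T0 (hq T hT) hfT) => //.
have : \forall y \near T, 0 < y by exact: lt_nbhsr.
apply: filterS => y y0; rewrite /= in_itv /= => /andP[_ yT].
by rewrite prob ?y0.
Qed.
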